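(* Let $\mathfrak{g}$ be a simple finite-dimensional complex Lie algebra. An automorphic Lie algebra $\mathfrak{g}[X,Y,P^{-1}]^{B\Gamma}_0$ with factorisable action depends only on the base Lie algebra $\mathfrak{g}$ and the set (one entry for each orbifold point) of numbers $$\min\{\nu,\;k(\tilde\alpha)/2+1\},$$ when $\nu$ runs over all orders of orbifold points of the quotient map $\overline{\mathbb{C}}\to\overline{\mathbb{C}}/\Gamma$ in the holomorphic domain of the automorphic Lie algebra, and $\tilde\alpha$ is the highest root of $\mathfrak{g}$.
   Context: $\Gamma\subset \mathrm{SO}(3)$ is a polyhedral group, i.e. a finite subgroup, and $B\Gamma\subset\mathrm{SU}(2)$ is its full preimage under the double cover $\mathrm{SU}(2)\to\mathrm{SO}(3)$, so $\Gamma\cong B\Gamma/\{\pm\mathrm{Id}\}$ acts on the Riemann sphere $\overline{\mathbb{C}}$ (the complex projective line of lines in $\mathbb{C}^2$). $S$ is any $\Gamma$-orbit on the sphere, and $P\in\mathbb{C}[X,Y]$ is a homogeneous polynomial of degree $|\Gamma|$ vanishing on $S$ which each $\gamma\in B\Gamma$ multiplies by a scalar. A homomorphism $\rho:B\Gamma\to\mathrm{Aut}(\mathfrak{g})$ defines an action of $B\Gamma$ on $\mathfrak{g}[X,Y,P^{-1}]=\mathfrak{g}\otimes_{\mathbb{C}}\mathbb{C}[X,Y,P^{-1}]$ by $(\gamma\cdot f)(v)=\rho(\gamma)f(\gamma^{-1}v)$, $v=(X,Y)^T$, preserving the $\mathbb{C}[X,Y,P^{-1}]$-bilinear Lie bracket.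 The automorphic Lie algebra $\mathfrak{g}[X,Y,P^{-1}]^{B\Gamma}_0$ is the Lie algebra of $B\Gamma$-invariants of homogeneous degree $0$ in $X,Y$; its elements are functions of $X/Y$, i.e. meromorphic maps on $\overline{\mathbb{C}}$ with poles confined to $S$, and its holomorphic domain is $\overline{\mathbb{C}}\setminus S$. The action is called factorisable if $\rho$ is the restriction to $B\Gamma$ of a homomorphism $\bar\rho:\mathrm{SL}(2,\mathbb{C})\to\mathrm{Aut}(\mathfrak{g})$. The orbifold points of the quotient map $\overline{\mathbb{C}}\to\overline{\mathbb{C}}/\Gamma$ correspond to the $\Gamma$-orbits whose elements have nontrivial stabiliser, and the order of an orbifold point is the order of such a stabiliser; the orbifold points in the holomorphic domain are those whose orbit is not $S$. Let $H=\mathrm{d}\bar\rho(\mathrm{diag}(1,-1))$ and choose a Cartan subalgebra $\mathfrak{h}$ of $\mathfrak{g}$ with $H\in\mathrm{ad}(\mathfrak{h})$. For a root $\alpha$, $k(\alpha)$ is the eigenvalue of $H$ on the root space of $\alpha$; $k$ is the additive extension to the root system of a labelling of the simple roots by $0$, $1$, $2$ (a Dynkin grading), and $\tilde\alpha$ is the highest root relative to these simple roots.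
   Formalization: The formal version also assumes that the gradings k agree up to an automorphism of g and, for three or more orbifold points with k(α̃)>0, that their positions in the quotient match; P vanishes exactly on S and ρ̄ is algebraic. *)

(* Defs.v *)
From HB Require Import structures.
From mathcomp Require Import all_boot all_order all_algebra.
From mathcomp Require Import finmap boolp classical_sets functions reals.
From mathcomp Require Import complex mpoly.

Set Implicit Arguments.
Unset Strict Implicit.
Unset Printing Implicit Defensive.

Import Order.TTheory GRing.Theory Num.Theory.

Local Open Scope ring_scope.
Local Open Scope complex_scope.
Local Open Scope sesquilinear_scope.

Record lieBracket (K : fieldType) (V : lmodType K) := LieBracket {
  lie_br :> V -> V -> V;
  lie_linearl : forall (a : K) x y z,
    lie_br (a *: x + y) z = a *: lie_br x z + lie_br y z;
  lie_linearr : forall (a : K) x y z,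
    lie_br z (a *: x + y) = a *: lie_br z x + lie_br z y;
  lie_alt : forall x, lie_br x x = 0;
  lie_jacobi : forall x y z,
    lie_br x (lie_br y z) + lie_br y (lie_br z x) + lie_br z (lie_br x y) = 0
}.

Section LieFunctions.
Variables (T : Type) (K : fieldType) (V : lmodType K) (br : lieBracket V).

Let fbr (f g : T -> V) : T -> V := fun t => br (f t) (g t).

Fact fbr_linearl (a : K) f g h :
  fbr (a *: f + g) h = a *: fbr f h + fbr g h.
Proof. by apply/funext => t; rewrite /fbr !fctE lie_linearl. Qed.

Fact fbr_linearr (a : K) f g h :
  fbr h (a *: f + g) = a *: fbr h f + fbr h g.
Proof. by apply/funext => t; rewrite /fbr !fctE lie_linearr. Qed.

Fact fbr_alt f : fbr f f = 0.
Proof. by apply/funext => t; rewrite /fbr lie_alt. Qed.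

Fact fbr_jacobi f g h :
  fbr f (fbr g h) + fbr g (fbr h f) + fbr h (fbr f g) = 0.
Proof. by apply/funext => t; rewrite /fbr !fctE lie_jacobi. Qed.

Definition lie_fct : lieBracket (T -> V) :=
  LieBracket fbr_linearl fbr_linearr fbr_alt fbr_jacobi.

End LieFunctions.

Definition is_lie_subalgebra (K : fieldType) (V : lmodType K)
    (br : lieBracket V) (L : set V) : Prop :=
  [/\ L 0,
      forall (a : K) x y, L x -> L y -> L (a *: x + y) &
      forall x y, L x -> L y -> L (br x y)].

Definition lie_isomorphic (K : fieldType) (V1 V2 : lmodType K)
    (br1 : lieBracket V1) (br2 : lieBracket V2) (L1 : set V1) (L2 : set V2)
    : Prop :=
  exists phi : V1 -> V2,
    [/\ set_bij L1 L2 phi,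
        forall (a : K) x y, L1 x -> L1 y -> phi (a *: x + y) = a *: phi x + phi y &
        forall x y, L1 x -> L1 y -> phi (br1 x y) = br2 (phi x) (phi y)].

Section FiniteDimensional.
Variables (K : fieldType) (g : vectType K) (br : lieBracket g).

Definition is_simple_lie : Prop :=
  (exists x y, br x y != 0) /\
  forall I : {vspace g}, (forall x y, y \in I -> br x y \in I) ->
    I = 0%VS \/ I = fullv.

Definition is_lie_aut (f : 'End(g)) : Prop :=
  bijective f /\ forall x y, f (br x y) = br (f x) (f y).

Definition is_cartan (h : {vspace g}) : Prop :=
  [/\ forall x y, x \in h -> y \in h -> br x y \in h,
      (exists n : nat, forall (s : seq g) y,
         size s = n -> {subset s <= h} -> y \in h -> foldr br y s = 0) &
      forall x, (forall y, y \in h -> br x y \in h) -> x \in h].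

Variable h : {vspace g}.

Definition is_root (a : 'Hom(subvs_of h, K^o)) : Prop :=
  a != 0 /\
  exists2 x : g, x != 0 & forall t : subvs_of h, br (vsval t) x = a t *: x.

Definition nat_comb (D : seq 'Hom(subvs_of h, K^o)) a : Prop :=
  exists c : 'I_(size D) -> nat, a = \sum_(i < size D) D`_i *+ c i.

Definition is_root_base (D : seq 'Hom(subvs_of h, K^o)) : Prop :=
  [/\ forall d, d \in D -> is_root d,
      free D &
      forall a, is_root a -> nat_comb D a \/ nat_comb D (- a)].

Definition is_highest_root (D : seq 'Hom(subvs_of h, K^o)) a : Prop :=
  is_root a /\ forall b, is_root b -> nat_comb D (a - b).

End FiniteDimensional.

(* A Cartan subalgebra h with H = ad t0, t0 in h, together with simple roots
   for which the grading k is a Dynkin grading.  The eigenvalue k(a) of H on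
   the root space of a is a(t0), so k is additive. *)
Record dynkin_grading (K : fieldType) (g : vectType K) (br : lieBracket g)
    (H : 'End(g)) := DynkinGrading {
  dg_h : {vspace g};
  dg_cartan : is_cartan br dg_h;
  dg_t0 : subvs_of dg_h;
  dg_ad : forall x, H x = br (vsval dg_t0) x;
  dg_base : seq 'Hom(subvs_of dg_h, K^o);
  dg_baseP : is_root_base br dg_base;
  dg_labels : forall d, d \in dg_base ->
    [\/ d dg_t0 = 0, d dg_t0 = 1 | d dg_t0 = 2%:R];
  dg_highest : 'Hom(subvs_of dg_h, K^o);
  dg_highestP : is_highest_root br dg_base dg_highest;
  dg_top : nat;   (* the value of k at the highest root *)
  dg_topP : dg_highest dg_t0 = dg_top%:R
}.

(* An automorphism of g carries H1 to H2.  The value of k at the highest root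
   does not determine k: for sl_6 the sl(2)-triples of types [3,3] and
   [3,1,1,1] both give 4. *)
Definition same_grading (K : fieldType) (g : vectType K) (br : lieBracket g)
    (H1 H2 : 'End(g)) (D1 : dynkin_grading br H1) (D2 : dynkin_grading br H2)
    : Prop :=
  exists2 f : 'End(g), is_lie_aut br f &
    f (vsval (dg_t0 D1)) = vsval (dg_t0 D2).

Section Polyhedral.
Variable R : realType.
Local Notation C := R[i].

Definition isSU2 (u : 'M[C]_2) : Prop := u \is unitarymx /\ \det u = 1.

Definition isSL2 (A : 'M[C]_2) : Prop := \det A = 1.

Definition isSO3 (a : 'M[R]_3) : Prop := a *m a^T = 1%:M /\ \det a = 1.

Definition pauli (j : 'I_3) : 'M[C]_2 :=
  match val j with
  | 0%N => delta_mx 0 1 + delta_mx 1 0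
  | 1%N => 'i *: (delta_mx 1 0 - delta_mx 0 1)
  | _ => delta_mx 0 0 - delta_mx 1 1
  end.

(* The double cover SU(2) -> SO(3): the matrix of X |-> u X u^* in the basis of
   Pauli matrices, which are orthogonal with squared norm 2 for the trace
   form. *)
Definition cover (u : 'M[C]_2) : 'M[R]_3 :=
  \matrix_(i, j) complex.Re (\tr (pauli i *m u *m pauli j *m u ^t*) / 2%:R).

Definition is_polyhedral (G : {fset 'M[R]_3}) : Prop :=
  [/\ forall a, a \in G -> isSO3 a,
      1%:M \in G &
      forall a b, a \in G -> b \in G -> a *m invmx b \in G].

Definition binary (G : {fset 'M[R]_3}) (u : 'M[C]_2) : Prop :=
  isSU2 u /\ cover u \in G.

(* The points of the sphere are the lines in C^2. *)
Definition is_point (L : {vspace 'cV[C]_2}) : Prop := \dim L = 1%N.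

Definition act (u : 'M[C]_2) (L : {vspace 'cV[C]_2}) : {vspace 'cV[C]_2} :=
  (linfun (mulmx u) @: L)%VS.

Definition orbit (G : {fset 'M[R]_3}) (L : {vspace 'cV[C]_2})
    : set {vspace 'cV[C]_2} :=
  [set L' | exists2 u, binary G u & L' = act u L]%classic.

Definition stab_order (G : {fset 'M[R]_3}) (L : {vspace 'cV[C]_2}) : nat :=
  #|` [fset a in G | `[< exists u, [/\ isSU2 u, cover u = a & act u L = L] >]]%fset |.

Definition ev (P : {mpoly C[2]}) (v : 'cV[C]_2) : C := P.@[fun i => v i 0].

(* P vanishes exactly on S, so that inverting P allows poles at S only. *)
Definition is_pole_form (G : {fset 'M[R]_3}) (S : set {vspace 'cV[C]_2})
    (P : {mpoly C[2]}) : Prop :=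
  [/\ P \is #|` G|.-homog,
      forall v : 'cV[C]_2, v != 0 -> (ev P v = 0 <-> S <[v]>%VS) &
      forall u, binary G u ->
        exists c : C, forall v, ev P (invmx u *m v) = c * ev P v].

End Polyhedral.

Section Automorphic.
Variables (R : realType) (g : vectType R[i]) (br : lieBracket g).
Local Notation C := R[i].

Record automorphic_data := AutomorphicData {
  al_G : {fset 'M[R]_3};
  al_polyhedral : is_polyhedral al_G;
  al_S : set {vspace 'cV[C]_2};
  al_orbit : exists2 L, is_point L & al_S = orbit al_G L;
  al_P : {mpoly C[2]};
  al_pole : is_pole_form al_G al_S al_P;
  al_rho : 'M[C]_2 -> 'End(g);
  al_aut : forall u, binary al_G u -> is_lie_aut br (al_rho u);
  al_hom : forall u v, binary al_G u -> binary al_G v ->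
    al_rho (u *m v) = (al_rho u \o al_rho v)%VF
}.

(* The homogeneous elements of degree 0 of g (x) C[X, Y, P^-1], as functions on
   C^2; by convention they take the value 0 where P vanishes, so that functions
   agree iff they agree where P is invertible.  An entry (Q, x) of s with
   exponent n stands for x (x) Q / P^n. *)
Definition deg0_form (d : nat) (P : {mpoly C[2]}) (f : 'cV[C]_2 -> g) : Prop :=
  exists (n : nat) (s : seq ({mpoly C[2]} * g)),
    (forall t, t \in s -> t.1 \is (n * d).-homog) /\
    forall v, f v = if ev P v == 0 then 0
                    else \sum_(t <- s) (ev t.1 v / ev P v ^+ n) *: t.2.

Definition autom_lie (A : automorphic_data) : set ('cV[C]_2 -> g) :=
  [set f | deg0_form #|` al_G A| (al_P A) f /\
           forall u, binary (al_G A) u ->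
             (fun v => al_rho A u (f (invmx u *m v))) = f]%classic.

(* One representative for each orbit with nontrivial stabiliser other than the
   orbit S. *)
Definition is_orbifold_points (A : automorphic_data)
    (r : seq {vspace 'cV[C]_2}) : Prop :=
  let orbifold L :=
    [/\ is_point L, (1 < stab_order (al_G A) L)%N & ~ al_S A L] in
  [/\ forall L, L \in r -> orbifold L,
      uniq r,
      {in r &, forall L L', orbit (al_G A) L L' -> L = L'} &
      forall L, orbifold L -> exists2 L', L' \in r & orbit (al_G A) L' L].

Definition orbifold_number (A : automorphic_data) (k : nat)
    (L : {vspace 'cV[C]_2}) : rat :=
  Num.min (stab_order (al_G A) L)%:R (k%:R / 2%:R + 1).

(* Q / P is a coordinate (sphere \ S) / Gamma -> C on the quotient of the
   holomorphic domain. *)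
Definition is_quotient_coord (A : automorphic_data) (Q : {mpoly C[2]}) : Prop :=
  Q \is #|` al_G A|.-homog /\
  forall v w : 'cV[C]_2, ev (al_P A) v != 0 -> ev (al_P A) w != 0 ->
    (ev Q v / ev (al_P A) v = ev Q w / ev (al_P A) w <->
     orbit (al_G A) <[v]>%VS <[w]>%VS).

Definition coord_at (A : automorphic_data) (Q : {mpoly C[2]})
    (L : {vspace 'cV[C]_2}) : C :=
  ev Q (vpick L) / ev (al_P A) (vpick L).

(* An isomorphism of the quotients of the holomorphic domains which matches the
   orbifold points and their numbers.  Up to two marked points of C this amounts
   to equality of the numbers; three marked points have a modulus under affine
   maps. *)
Definition same_marked_quotient (A1 A2 : automorphic_data) (k1 k2 : nat)
    (r1 r2 : seq {vspace 'cV[C]_2}) : Prop :=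
  exists Q1 Q2 : {mpoly C[2]},
    [/\ is_quotient_coord A1 Q1, is_quotient_coord A2 Q2 &
        perm_eq [seq (coord_at A1 Q1 L, orbifold_number A1 k1 L) | L <- r1]
                [seq (coord_at A2 Q2 L, orbifold_number A2 k2 L) | L <- r2]].

(* A |-> rb A x is given on SL(2) by the entries (F, y) of s: the sum of the
   F(A) y, with F a polynomial in the entries of A. *)
Definition represents (rb : 'M[C]_2 -> 'End(g)) (x : g)
    (s : seq ({mpoly C[2 * 2]} * g)) : Prop :=
  forall A, isSL2 A -> rb A x = \sum_(t <- s) t.1.@[mxvec A 0] *: t.2.

(* homomorphisms SL(2) -> Aut(g) of algebraic groups *)
Definition is_SL2_action (rb : 'M[C]_2 -> 'End(g)) : Prop :=
  [/\ forall A, isSL2 A -> is_lie_aut br (rb A),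
      forall A B, isSL2 A -> isSL2 B -> rb (A *m B) = (rb A \o rb B)%VF &
      forall x, exists s, represents rb x s].

Definition factorises (A : automorphic_data) (rb : 'M[C]_2 -> 'End(g)) : Prop :=
  is_SL2_action rb /\ forall u, binary (al_G A) u -> al_rho A u = rb u.

(* H is the value at the tangent vector T of sl(2) of the differential of rb at
   the identity; as T is tangent to SL(2), it does not depend on the
   polynomials chosen. *)
Definition is_differential (rb : 'M[C]_2 -> 'End(g)) (T : 'M[C]_2)
    (H : 'End(g)) : Prop :=
  forall x s, represents rb x s ->
    H x = \sum_(t <- s)
      (\sum_j (t.1^`M(j)).@[mxvec (1%:M : 'M[C]_2) 0] * mxvec T 0 j) *: t.2.

Definition diag1N1 : 'M[C]_2 := delta_mx 0 0 - delta_mx 1 1.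

Lemma ev_sumM (s1 s2 : seq ({mpoly C[2]} * g)) (n1 n2 : nat)
    (P : {mpoly C[2]}) v :
  br (\sum_(t <- s1) (ev t.1 v / ev P v ^+ n1) *: t.2)
     (\sum_(t <- s2) (ev t.1 v / ev P v ^+ n2) *: t.2) =
  \sum_(t <- [seq (t1.1 * t2.1, br t1.2 t2.2) | t1 <- s1, t2 <- s2])
     (ev t.1 v / ev P v ^+ (n1 + n2)) *: t.2.
Proof.
have br0l y : br 0 y = 0.
  by have := lie_linearl br (-1) 0 0 y; rewrite scaleN1r oppr0 addr0 scaleN1r addNr.
have br0r y : br y 0 = 0.
  by have := lie_linearr br (-1) 0 0 y; rewrite scaleN1r oppr0 addr0 scaleN1r addNr.
elim: s1 => [|t1 s1 IH]; first by rewrite !big_nil br0l.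
rewrite big_cons lie_linearl IH /= big_cat big_map; congr (_ + _) => /=.
elim: s2 {IH} => [|t2 s2 IH]; first by rewrite !big_nil br0r scaler0.
rewrite !big_cons lie_linearr scalerDr IH scalerA; congr (_ *: _ + _).
by rewrite /ev mevalM exprD invfM mulrACA.
Qed.

Lemma autom_lie_subalgebra (A : automorphic_data) :
  is_lie_subalgebra (lie_fct _ br) (autom_lie A).
Proof.
case: A => G Gp S So P Pp rho aut hom; rewrite /autom_lie /=; set d := #|` _|.
have [Ph _ _] := Pp.
split => /=.
- split; last by move=> u _; apply/funext => v /=; rewrite [LHS]linear0.
  by exists 0%N, [::]; split => // v; rewrite big_nil if_same.
- move=> a f1 f2 [[n1 [s1 [h1 e1]]] i1] [[n2 [s2 [h2 e2]]] i2]; split; last first.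
    move=> u Gu; apply/funext => v; rewrite !fctE linearP.
    by rewrite -[in RHS](i1 u Gu) -[in RHS](i2 u Gu).
  exists (n1 + n2)%N, ([seq (P ^+ n2 * t.1, a *: t.2) | t <- s1]
                    ++ [seq (P ^+ n1 * t.1, t.2) | t <- s2]); split.
    have hP k : P ^+ k \is (k * d).-homog.
      by rewrite mulnC; apply/dhomogMn/Ph.
    move=> t; rewrite mem_cat => /orP[] /mapP[t' st' ->] /=; rewrite mulnDl.
      by rewrite addnC; apply: dhomogM => //; apply: h1.
    by apply: dhomogM => //; apply: h2.
  move=> v; rewrite !fctE e1 e2; have [_|P0] := ifPn.
    by rewrite scaler0 addr0.
  rewrite big_cat !big_map scaler_sumr; congr (_ + _); apply: eq_bigr => t _ /=.
    rewrite !scalerA; congr (_ *: _); rewrite /ev mevalM rmorphXn /= exprD.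
    rewrite mulrC; congr (_ * _); rewrite [in RHS](mulrC (_ ^+ n1)) -mulf_div divff ?mul1r //.
    exact: expf_neq0.
  congr (_ *: _); rewrite /ev mevalM rmorphXn /= exprD.
  by rewrite -mulf_div divff ?mul1r //; apply: expf_neq0.
- move=> f1 f2 [[n1 [s1 [h1 e1]]] i1] [[n2 [s2 [h2 e2]]] i2]; split; last first.
    move=> u Gu; apply/funext => v; have [_ ->] := aut u Gu.
    by rewrite -[in RHS](i1 u Gu) -[in RHS](i2 u Gu).
  exists (n1 + n2)%N, [seq (t1.1 * t2.1, br t1.2 t2.2) | t1 <- s1, t2 <- s2].
  split.
    move=> t /allpairsP[[t1 t2] /= [/h1 t1h /h2 t2h ->]] /=.
    by rewrite mulnDl; apply: dhomogM.
  move=> v; rewrite /= e1 e2; have [_|P0] := ifPn; first by rewrite lie_alt.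
  exact: ev_sumM.
Qed.

End Automorphic.

(* Main.v *)
From HB Require Import structures.
Require Import Defs.
From mathcomp Require Import all_boot all_order all_algebra.
From mathcomp Require Import finmap boolp classical_sets functions reals.
From mathcomp Require Import complex mpoly.
From mathcomp Require Import ring zify.

Set Implicit Arguments.
Unset Strict Implicit.
Unset Printing Implicit Defensive.

Import Order.TTheory GRing.Theory Num.Theory.
Local Open Scope ring_scope.
Local Open Scope complex_scope.

(** The quotient of the holomorphic domain is an affine line, over which a factorisable action can
be trivialised; this turns the automorphic Lie algebra into an explicit Lie algebra of functions
on that line, whose only ingredients are [g], the grading and the marked points with their
numbers.

Choose a basis of the plane, of determinant one, whose first vector spans a point of [S]. The
points off [S] then have an affine coordinate [x], on which the group acts by fractional linear
maps with denominators [den]. The product [theta] of the determinants of a vector with the images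
of another one is a form whose zeros are an orbit, and the quotient [J] of two such forms
([qcoord]) is a coordinate of the quotient: it separates the orbits and takes every value
([qcoord_eqP], [qcoord_surj]), with multiplicity the order of the stabiliser ([mup_level]), and
every invariant function is a polynomial in it ([invariant_poly]).

The logarithmic derivative of the form vanishing on [S] completes each point to an element of
SL(2), the [frame], in a way that commutes with the group up to the diagonal matrices with entries
[den] and [1 / den] ([coframe_mob]). As the action extends to SL(2), the frame turns an invariant
of the group into a function whose component of weight [2 m] for [H] is multiplied by [den ^+ 2]
to the power [m]; the odd weights do not occur because of the element [- 1]. The derivative of [J]
is multiplied by [den ^+ 2] as well, and it vanishes to order [k - 1] where the stabiliser has
order [k]. Comparing orders, the component of weight [2 m] is a polynomial in [J] times
[weight_gen m], the function of this weight whose order at a point with stabiliser of order [k] is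
as small as possible, namely the residue of [- m] modulo [k] ([weight_invariant]). After rescaling
the frame by a root of the derivative of [J] this becomes [autom_lie_model]: the automorphic Lie
algebra is isomorphic to the Lie algebra of the sums, over [m], of the products of [(z - z_i) ^
ceil (m / k_i)] over the orbifold points [z_i] of order [k_i] with polynomials in [z] having
values in the eigenspace of [H] for [2 m].

The eigenvalues of [H] lie between minus and plus its value at the highest root. Indeed the Cartan
subalgebra preserves the eigenspaces of [H]; being nilpotent it has a common eigenvector in each
of them ([nilpotent_eigenvector]), so that the nonzero eigenvalues are values of roots
([eigenvalue_top]), and the Weyl element of SL(2) exchanges an eigenvalue with its opposite
([wt_bound]). Therefore only the [m] with [`|m| <= K] matter, where [K] is the integral part of
half the value at the highest root, and for them [ceil (m / k)] depends on the minimum of [k] and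
[K + 1] alone ([ceil_div_trunc]); this is where the numbers of the statement come from.

It remains to match two models. An automorphism of the base Lie algebra that matches the gradings
and an affine change of the coordinate carry one model to another ([model_move_iso]). Up to two
marked points can always be matched by an affine map ([affine_match]). For more of them the two
given coordinates of the quotients are injective polynomials in the respective [J], hence affine
functions of it ([injective_poly_affine]), and their agreement at the orbifold points provides the
affine map. When the value at the highest root is zero only [m = 0] occurs and the marks can be
forgotten ([model_unmark]). *)

(** * The plane and fractional linear maps *)

Lemma ord2P (i : 'I_2) : i = 0 \/ i = 1.
Proof. by case: i => [[|[|//]] Hi]; [left|right]; apply/val_inj. Qed.

Definition mk2 (T : Type) (a b c d : T) : 'M[T]_2 :=
  \matrix_(i, j) if i == 0 then (if j == 0 then a else b) else (if j == 0 then c else d).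

Lemma eq_mx2 (T : Type) (u v : 'M[T]_2) :
  u 0 0 = v 0 0 -> u 0 1 = v 0 1 -> u 1 0 = v 1 0 -> u 1 1 = v 1 1 -> u = v.
Proof.
move=> e00 e01 e10 e11; apply/matrixP => i j.
by case: (ord2P i) => ->; case: (ord2P j) => ->.
Qed.

Section Plane.
Variable F : fieldType.
Implicit Types (u g : 'M[F]_2) (v w : 'cV[F]_2).

Lemma sum2 (V : nmodType) (f : 'I_2 -> V) : \sum_i f i = f 0 + f 1.
Proof. by rewrite big_ord_recl big_ord1; congr (_ + f _); apply/val_inj. Qed.

Lemma mxM2 u g (i j : 'I_2) : (u *m g) i j = u i 0 * g 0 j + u i 1 * g 1 j.
Proof. by rewrite mxE sum2. Qed.

Definition vec2 (a b : F) : 'cV[F]_2 := \col_i (if i == 0 then a else b).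
Definition det2 v w : F := v 0 0 * w 1 0 - v 1 0 * w 0 0.

Lemma vec2P v w : v 0 0 = w 0 0 -> v 1 0 = w 1 0 -> v = w.
Proof.
move=> e0 e1; apply/colP => i.
by case: (ord2P i) => ->.
Qed.

Lemma mul2E u v i : (u *m v) i 0 = u i 0 * v 0 0 + u i 1 * v 1 0.
Proof. by rewrite mxE sum2. Qed.

Lemma det2E u : \det u = u 0 0 * u 1 1 - u 1 0 * u 0 1.
Proof.
have l0 : lift 0 0 = 1 :> 'I_2 by apply/val_inj.
have l1 : lift 1 0 = 0 :> 'I_2 by apply/val_inj.
by rewrite (expand_det_row _ 0) big_ord_recl big_ord1 /cofactor !det_mx11 !mxE /= !l0 !l1 expr0 expr1; ring.
Qed.

Lemma det2_mul u v w : det2 (u *m v) (u *m w) = \det u * det2 v w.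
Proof. by rewrite /det2 det2E !mul2E; ring. Qed.

Lemma det2Zl a v w : det2 (a *: v) w = a * det2 v w.
Proof. by rewrite /det2 !mxE; ring. Qed.

Lemma det2Zr a v w : det2 v (a *: w) = a * det2 v w.
Proof. by rewrite /det2 !mxE; ring. Qed.

Lemma det2C v w : det2 v w = - det2 w v.
Proof. by rewrite /det2; ring. Qed.

Lemma det2Nr v w : det2 v (- w) = - det2 v w.
Proof. by rewrite /det2 !mxE; ring. Qed.

Lemma det2vv v : det2 v v = 0.
Proof. by rewrite /det2; ring. Qed.

Lemma det2_eq0 v w : v != 0 -> det2 v w = 0 -> exists c, w = c *: v.
Proof.
move=> v0 d0; have [v00|v00] := eqVneq (v 0 0) 0.
  have v10 : v 1 0 != 0.
    by apply: contraNneq v0 => v10; apply/eqP/vec2P; rewrite mxE.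
  exists (w 1 0 / v 1 0); apply: vec2P; rewrite mxE ?divfK //.
  move: d0; rewrite /det2 v00 mul0r sub0r mulr0 => /eqP.
  by rewrite oppr_eq0 mulf_eq0 (negPf v10) => /eqP.
exists (w 0 0 / v 0 0); apply: vec2P; rewrite mxE ?divfK //.
apply: (mulfI v00); move: d0 => /eqP; rewrite /det2 subr_eq0 => /eqP ->.
by field.
Qed.

Definition num u x : F := u 0 0 * x + u 0 1.
Definition den u x : F := u 1 0 * x + u 1 1.
Definition mob u x : F := num u x / den u x.

Lemma mul_pt u x : u *m vec2 x 1 = vec2 (num u x) (den u x).
Proof. by apply: vec2P; rewrite mul2E !mxE /num /den /=; ring. Qed.

Lemma vec2_den a b : b != 0 -> vec2 a b = b *: vec2 (a / b) 1.
Proof. by move=> b0; apply: vec2P; rewrite !mxE /= ?mulr1 // mulrC divfK. Qed.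

(** In homogeneous coordinates [mob u] is the action of [u] on lines, and [den u x] is the factor
of automorphy by which a form of degree one changes. *)
Lemma mul_pt_mob u x : den u x != 0 -> u *m vec2 x 1 = den u x *: vec2 (mob u x) 1.
Proof. by move=> d0; rewrite mul_pt vec2_den. Qed.

End Plane.

(** * Polynomials over an algebraically closed field *)

Section ClosedPoly.
Variable F : closedFieldType.
Implicit Types A B D e : {poly F}.

(** The product [e * (A - B)] vanishes everywhere, and a nonzero polynomial has a nonroot. *)
Lemma poly_dense e A B : e != 0 ->
  (forall x, e.[x] != 0 -> A.[x] = B.[x]) -> A = B.
Proof.
move=> e0 AB; apply/eqP; rewrite -subr_eq0; apply/negPn/negP => D0.
have : e * (A - B) != 0 by rewrite mulf_neq0.
move=> /closed_nonrootP[x]; rewrite /root hornerM mulf_eq0 negb_or.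
by rewrite hornerD hornerN => /andP[/AB->]; rewrite subrr eqxx.
Qed.

Lemma dvdp_prod_exp (s : seq F) A :
  (forall z, z \in s -> root A z) -> \prod_(z <- s) ('X - z%:P) %| A ^+ size s.
Proof.
elim: s => [|z s IH] As; first by rewrite big_nil dvd1p.
rewrite big_cons exprS dvdp_mul //.
  by rewrite dvdp_XsubCl As // mem_head.
by apply: IH => y ys; apply: As; rewrite in_cons ys orbT.
Qed.

Lemma dvdp_exp_roots D A : D != 0 ->
  (forall x, root D x -> root A x) -> exists n, D %| A ^+ n.
Proof.
move=> D0 DA; have [s Ds] := closed_field_poly_normal D.
exists (size s); rewrite Ds dvdpZl ?lead_coef_eq0 //; apply: dvdp_prod_exp.
move=> z zs; apply: DA; rewrite Ds rootZ ?lead_coef_eq0 //.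
by rewrite root_prod_XsubC.
Qed.

(** Removable singularities: after cancelling the greatest common divisor, the denominator can
only vanish where it had larger multiplicity than the numerator. *)
Lemma cancel_poles (U : pred F) A D : D != 0 ->
  (forall y, U y -> (mup y D <= mup y A)%N \/ A = 0) ->
  exists A1 D1, [/\ forall y, U y -> D1.[y] != 0,
    forall x, D.[x] != 0 -> D1.[x] != 0 /\ A1.[x] / D1.[x] = A.[x] / D.[x] &
    forall y, U y -> (mup y D < mup y A)%N \/ A = 0 -> A1.[y] = 0].
Proof.
move=> D0 UAD; have [->|A0] := eqVneq A 0.
  exists 0, 1; split=> [y _|x _|y _ _]; rewrite ?hornerC ?oner_eq0 //.
  by split; rewrite ?oner_eq0 // !mul0r.
set g := gcdp A D; have g0 : g != 0 by rewrite gcdp_eq0 negb_and A0.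
have eA : A = A %/ g * g by rewrite divpK // dvdp_gcdl.
have eD : D = D %/ g * g by rewrite divpK // dvdp_gcdr.
set A1 := A %/ g in eA; set D1 := D %/ g in eD.
have A10 : A1 != 0 by apply: contraNneq A0 => h; rewrite eA h mul0r.
have D10 : D1 != 0 by apply: contraNneq D0 => h; rewrite eD h mul0r.
have cop : coprimep A1 D1 by rewrite /A1 /D1 coprimep_div_gcd // A0.
have mA y : mup y A = (mup y A1 + mup y g)%N by rewrite {1}eA mupM.
have mD y : mup y D = (mup y D1 + mup y g)%N by rewrite {1}eD mupM.
have rootE (E : {poly F}) y : E != 0 -> root E y = (0 < mup y E)%N.
  by move=> E0; rewrite -XsubC_dvd // dvdp_XsubCl.
exists A1, D1; split.
- move=> y Uy; apply/negP => D1y; have [le|/eqP] := UAD y Uy; last by rewrite (negPf A0).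
  have A1y : root A1 y.
    rewrite rootE //; move: le; rewrite mA mD leq_add2r; apply: leq_trans.
    by rewrite -rootE.
  by have := coprimep_root cop A1y; rewrite D1y.
- move=> x; rewrite {1}eD hornerM mulf_eq0 negb_or => /andP[d1x gx]; split=> //.
  by rewrite {1}eA {1}eD !hornerM -mulf_div divff // mulr1.
- move=> y Uy [lt|/eqP]; last by rewrite (negPf A0).
  apply/eqP; change (root A1 y); rewrite rootE //.
  by move: lt; rewrite mA mD ltn_add2r; apply: leq_trans.
Qed.

End ClosedPoly.

(** * Finite groups of matrices up to sign *)

Section SignedGroup.
Variables (C : numClosedFieldType) (Ks : seq 'M[C]_2).
Implicit Types (u g h : 'M[C]_2) (v w : 'cV[C]_2) (x y : C).

Definition signed_mem g := (g \in Ks) || (- g \in Ks).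

(** The binary group is the set of all [u] and [- u] with [u] in [Ks]: one representative is kept
for each element of the polyhedral group, so that products over [Ks] have the right degree. *)
Record signed_group : Prop := SignedGroup {
  sg_det : forall u, u \in Ks -> \det u = 1;
  sg_uniq : uniq Ks;
  sg_sign : forall u, u \in Ks -> - u \notin Ks;
  sg_one : signed_mem 1%:M;
  sg_mul : forall u g, u \in Ks -> g \in Ks -> signed_mem (u *m g);
  sg_inv : forall u, u \in Ks -> signed_mem (invmx u)
}.

Hypothesis KG : signed_group.

Lemma signed_memN g : signed_mem (- g) = signed_mem g.
Proof. by rewrite /signed_mem opprK orbC. Qed.

Lemma mem_signed u : u \in Ks -> signed_mem u.
Proof. by rewrite /signed_mem => ->. Qed.

Lemma det_oppM g : \det (- g) = \det g.
Proof. by rewrite !det2E !mxE; ring. Qed.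

Lemma signed_ind (P : 'M[C]_2 -> Prop) : (forall g, P g -> P (- g)) ->
  (forall u, u \in Ks -> P u) -> forall g, signed_mem g -> P g.
Proof. by move=> PN PK g /orP[/PK//|/PK/PN]; rewrite opprK. Qed.

Lemma signed_det g : signed_mem g -> \det g = 1.
Proof. by move: g; apply: signed_ind => [g|u /(sg_det KG)//]; rewrite det_oppM. Qed.

Lemma signed_unit g : signed_mem g -> g \in unitmx.
Proof. by move=> Kg; rewrite unitmxE signed_det // unitr1. Qed.

Lemma signed_mul g h : signed_mem g -> signed_mem h -> signed_mem (g *m h).
Proof.
move=> Kg Kh; move: g Kg; apply: signed_ind => [g|u Ku].
  by rewrite mulNmx signed_memN.
move: h Kh; apply: signed_ind => [h|h Kh]; first by rewrite mulmxN signed_memN.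
exact: sg_mul.
Qed.

Lemma invmx_opp g : g \in unitmx -> invmx (- g) = - invmx g.
Proof.
move=> Ug; have UNg : - g \in unitmx by rewrite unitmxE det_oppM -unitmxE.
by apply: (can_inj (mulKmx UNg)); rewrite mulmxV // mulNmx mulmxN opprK mulmxV.
Qed.

Lemma signed_inv g : signed_mem g -> signed_mem (invmx g).
Proof.
move=> Kg; have := Kg; move: g Kg; apply: signed_ind => [g IH|u Ku _]; last exact: sg_inv.
rewrite signed_memN => Kg; rewrite invmx_opp ?signed_unit // signed_memN.
exact: IH.
Qed.

Lemma Ks_gt0 : (0 < size Ks)%N.
Proof. by have := sg_one KG; rewrite /signed_mem; case: Ks. Qed.

Lemma prod_const_seq (I : Type) (s : seq I) (a : C) : \prod_(i <- s) a = a ^+ size s.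
Proof. by rewrite big_const_seq count_predT -Monoid.iteropE. Qed.

Definition sign_rep g := if g \in Ks then g else - g.
Definition sign_of g : C := if g \in Ks then 1 else - 1.

Lemma sign_repP g : g = sign_rep g \/ g = - sign_rep g.
Proof. by rewrite /sign_rep; case: ifP => _; [left|right; rewrite opprK]. Qed.

Section Permutation.
Variable t : 'M[C]_2 -> 'M[C]_2.
Hypothesis tK : forall u, u \in Ks -> signed_mem (t u).
Hypothesis t_inj : forall u g, u \in Ks -> g \in Ks -> t u = t g \/ t u = - t g -> u = g.

(** A map that is injective up to sign permutes the representatives up to sign. Products over [Ks]
of odd functions are then invariant up to a constant, independent of the function, and counts of
even predicates are invariant. *)
Lemma sign_rep_perm : perm_eq [seq sign_rep (t u) | u <- Ks] Ks.
Proof.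
have ut : uniq [seq sign_rep (t u) | u <- Ks].
  rewrite map_inj_in_uniq ?(sg_uniq KG) // => u g Ku Kg e; apply: t_inj => //.
  have [eu|eu] := sign_repP (t u); have [eg|eg] := sign_repP (t g);
  rewrite eu eg e ?opprK; by [left|right].
have st : {subset [seq sign_rep (t u) | u <- Ks] <= Ks}.
  move=> _ /mapP[u /tK tu ->]; rewrite /sign_rep; case: ifP => // h.
  by move: tu; rewrite /signed_mem h.
have [_ e] := uniq_min_size ut st (eq_leq (esym (size_map _ _))).
exact: uniq_perm ut (sg_uniq KG) e.
Qed.

Lemma prod_signed : exists2 e : C, e != 0 & forall f : 'M[C]_2 -> C,
  (forall g, f (- g) = - f g) -> \prod_(u <- Ks) f (t u) = e * \prod_(u <- Ks) f u.
Proof.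
exists (\prod_(u <- Ks) sign_of (t u)).
  elim: Ks => [|u s IH]; rewrite ?big_nil ?oner_eq0 // big_cons mulf_neq0 //.
  by rewrite /sign_of; case: ifP; rewrite ?oppr_eq0 oner_eq0.
move=> f fN; rewrite -[X in _ * X](perm_big _ sign_rep_perm) /= big_map -big_split /=.
apply: eq_bigr => u _; rewrite /sign_of /sign_rep.
by case: ifP => _; rewrite ?mul1r // fN mulN1r opprK.
Qed.

Lemma count_signed (P : pred 'M[C]_2) :
  (forall g, P (- g) = P g) -> count (fun u => P (t u)) Ks = count P Ks.
Proof.
move=> PN; rewrite -(permP sign_rep_perm P) count_map /=.
apply: eq_count => u /=; have [e|e] := sign_repP (t u); first by rewrite -e.
by rewrite {1}e PN.
Qed.

End Permutation.

Lemma lmul_signed_inj h : signed_mem h -> forall u g, u \in Ks -> g \in Ks ->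
  h *m u = h *m g \/ h *m u = - (h *m g) -> u = g.
Proof.
move=> Kh u g Ku Kg; rewrite -mulmxN => -[] /(can_inj (mulKmx (signed_unit Kh))) // e.
by have := sg_sign KG Kg; rewrite -e Ku.
Qed.

Lemma prod_lmul h : signed_mem h -> exists2 e : C, e != 0 & forall f : 'M[C]_2 -> C,
  (forall g, f (- g) = - f g) ->
  \prod_(u <- Ks) f (h *m u) = e * \prod_(u <- Ks) f u.
Proof.
move=> Kh; apply: prod_signed; last exact: lmul_signed_inj.
by move=> u /mem_signed; apply: signed_mul.
Qed.

Lemma count_lmul h (P : pred 'M[C]_2) : signed_mem h -> (forall g, P (- g) = P g) ->
  count (fun u => P (h *m u)) Ks = count P Ks.
Proof.
move=> Kh; apply: count_signed; last exact: lmul_signed_inj.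
by move=> u /mem_signed; apply: signed_mul.
Qed.

Lemma prod_inv : exists2 e : C, e != 0 & forall f : 'M[C]_2 -> C,
  (forall g, f (- g) = - f g) ->
  \prod_(u <- Ks) f (invmx u) = e * \prod_(u <- Ks) f u.
Proof.
apply: prod_signed => [u /mem_signed|u g Ku Kg]; first exact: signed_inv.
case=> [/(can_inj (@invmxK _ _))//|e].
have eu : u = - g.
  by apply: (can_inj (@invmxK _ _)); rewrite e invmx_opp // signed_unit ?mem_signed.
by have := sg_sign KG Kg; rewrite -eu Ku.
Qed.

(** ** The invariant pairing *)

(** Up to the normalisation of [w], [theta v w] is the form in [v] whose zeros are the points of
the orbit of [w], with multiplicity the order of the stabiliser. *)
Definition theta v w : C := \prod_(u <- Ks) det2 v (u *m w).

(** Moving [v] by [h] amounts to permuting the factors up to sign. *)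
Lemma thetaL h : signed_mem h -> exists2 e : C, e != 0 &
  forall v w, theta (h *m v) w = e * theta v w.
Proof.
move=> Kh; have [e e0 he] := prod_lmul (signed_inv Kh); exists e => // v w.
rewrite /theta -(he (fun u => det2 v (u *m w))) => [|g]; last by rewrite mulNmx det2Nr.
apply: eq_bigr => u _; rewrite -[u in LHS](mulKVmx (signed_unit Kh)) -(mulmxA h) det2_mul.
by rewrite signed_det // mul1r.
Qed.

Lemma thetaC : exists2 e : C, e != 0 & forall v w, theta v w = e * theta w v.
Proof.
have [e e0 he] := prod_inv; exists ((- 1) ^+ size Ks * e).
  by rewrite mulf_neq0 // expf_neq0 // oppr_eq0 oner_eq0.
move=> v w; rewrite /theta -mulrA -(he (fun u => det2 w (u *m v))) => [|g]; last first.
  by rewrite mulNmx det2Nr.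
rewrite -prod_const_seq -big_split /= big_seq [in RHS]big_seq; apply: eq_bigr => u Ku.
rewrite mulN1r -det2C -{1}[v](mulKVmx (signed_unit (mem_signed Ku))).
by rewrite det2_mul (sg_det KG) // mul1r.
Qed.

Lemma thetaZl a v w : theta (a *: v) w = a ^+ size Ks * theta v w.
Proof.
rewrite /theta -prod_const_seq -big_split /=; apply: eq_bigr => u _.
by rewrite det2Zl.
Qed.

Lemma theta_eq0 v w : (theta v w == 0) = has (fun u => det2 v (u *m w) == 0) Ks.
Proof. by rewrite prodf_seq_eq0; apply: eq_has => u; rewrite andTb. Qed.

Lemma theta_signed v w h : signed_mem h -> det2 v (h *m w) = 0 -> theta v w = 0.
Proof.
move=> /orP[] Kh e; apply/eqP; rewrite theta_eq0; apply/hasP.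
  by exists h => //; rewrite e.
by exists (- h) => //; rewrite mulNmx det2Nr e oppr0.
Qed.

End SignedGroup.

(** * Orbits and the quotient *)

Section Quotient.
Variables (C : numClosedFieldType) (Ks : seq 'M[C]_2).
Hypothesis KG : signed_group Ks.
Implicit Types (u g h : 'M[C]_2) (v w : 'cV[C]_2) (x y z : C).

Local Notation pt x := (vec2 x 1).
Local Notation inf := (vec2 1 0 : 'cV[C]_2).
Local Notation K := (signed_mem Ks).
Local Notation n := (size Ks).
Local Notation th := (theta Ks).

Definition orbit_form w : {poly C} := \prod_(u <- Ks) ((u *m w) 1 0 *: 'X - ((u *m w) 0 0)%:P).

Lemma orbit_formE w x : (orbit_form w).[x] = th (pt x) w.
Proof.
rewrite horner_prod; apply: eq_bigr => u _.
by rewrite !hornerE /det2 !mxE /=; ring.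
Qed.

Lemma size_prod_lin (I : Type) (s : seq I) (a b : I -> C) :
  (size (\prod_(i <- s) (a i *: 'X - (b i)%:P))%R <= (size s).+1)%N /\
  (\prod_(i <- s) (a i *: 'X - (b i)%:P))`_(size s) = \prod_(i <- s) a i.
Proof.
elim: s => [|i s [IH1 IH2]]; first by rewrite !big_nil size_poly1 coef1.
rewrite !big_cons; set p := \prod_(_ <- s) _ in IH1 IH2 *; split.
  apply: leq_trans (size_polyMleq _ _) _.
  have h : (size (a i *: 'X - (b i)%:P)%R <= 2)%N.
    apply: leq_trans (size_polyD _ _) _; rewrite geq_max size_polyN.
    rewrite (leq_trans (size_scale_leq _ _)) ?size_polyX //=.
    by rewrite (leq_trans (size_polyC_leq1 _)).
  by rewrite -subn1 leq_subLR add1n -(add2n (size s).+1) leq_add.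
rewrite mulrBl coefB -scalerAl coefZ coefXM /= IH2 mul_polyC coefZ.
by rewrite (nth_default _ IH1) mulr0 subr0.
Qed.

Lemma size_orbit_form w : (size (orbit_form w) <= n.+1)%N.
Proof. by have [] := size_prod_lin Ks (fun u => (u *m w) 1 0) (fun u => (u *m w) 0 0). Qed.

Lemma lead_orbit_form w : (orbit_form w)`_n = th inf w.
Proof.
have [_ ->] := size_prod_lin Ks (fun u => (u *m w) 1 0) (fun u => (u *m w) 0 0).
by apply: eq_bigr => u _; rewrite /det2 !mxE /=; ring.
Qed.

Local Notation r := (orbit_form inf).

(** The orbit of [inf] will be the set of the poles, so that these are the points of the
holomorphic domain. *)
Definition finite_pt x := r.[x] != 0.

Lemma th_inf : th inf inf = 0.
Proof. by apply: (theta_signed (sg_one KG)); rewrite mul1mx det2vv. Qed.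

(** The form vanishing at the poles is invariant up to a scalar, so that the group does not move a
point off the poles to [inf]. *)
Lemma finite_mob h x : K h -> finite_pt x -> den h x != 0 /\ finite_pt (mob h x).
Proof.
rewrite /finite_pt !orbit_formE => Kh Ux; have [e e0 he] := thetaL KG Kh.
have hx0 : th (h *m pt x) inf != 0 by rewrite he mulf_neq0.
have d0 : den h x != 0.
  apply: contraNneq hx0 => d0; rewrite mul_pt d0.
  have -> : vec2 (num h x) 0 = num h x *: inf.
    by apply: vec2P; rewrite !mxE /= ?mulr1 ?mulr0.
  by rewrite thetaZl th_inf mulr0.
split=> //; move: hx0; rewrite mul_pt_mob // thetaZl mulf_eq0 negb_or.
by case/andP.
Qed.

Lemma th_mob h x w e : K h -> finite_pt x -> th (h *m pt x) w = e * th (pt x) w ->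
  th (pt (mob h x)) w * den h x ^+ n = e * th (pt x) w.
Proof.
by move=> Kh Ux <-; have [d0 _] := finite_mob Kh Ux; rewrite mul_pt_mob // thetaZl mulrC.
Qed.

Lemma mob_eqE h x y : den h y != 0 -> (mob h y == x) = (det2 (pt x) (h *m pt y) == 0).
Proof.
move=> d0; rewrite mul_pt_mob // det2Zr mulf_eq0 (negPf d0) /= /det2 !mxE /=.
by rewrite mulr1 mul1r subr_eq0 eq_sym.
Qed.

Lemma orbit_form_split y : finite_pt y -> exists2 c, c != 0 &
  orbit_form (pt y) = c *: \prod_(z <- [seq mob u y | u <- Ks]) ('X - z%:P).
Proof.
move=> Uy; exists (\prod_(u <- Ks) den u y).
  by rewrite prodf_seq_neq0; apply/allP => u Ku; have [] := finite_mob (mem_signed Ku) Uy.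
rewrite big_map -mul_polyC rmorph_prod -big_split /=.
rewrite /orbit_form big_seq [RHS]big_seq; apply: eq_bigr => u Ku.
have [d0 _] := finite_mob (mem_signed Ku) Uy.
rewrite mul_pt_mob // !mxE /= mulr1 mulrBr -mul_polyC; congr (_ - _).
by rewrite -rmorphM.
Qed.

(** ** Stabilisers and generic points *)

Definition stab_count x := count (fun u => det2 (pt x) (u *m pt x) == 0) Ks.

(** The factors vanishing at a point of the orbit correspond to a coset of the stabiliser. *)
Lemma mup_orbit_form h y : K h -> finite_pt y ->
  mup (mob h y) (orbit_form (pt y)) = stab_count y.
Proof.
move=> Kh Uy; have [c c0 ->] := orbit_form_split Uy.
rewrite -mul_polyC mupMr; last by rewrite rootC.
rewrite mu_prod_XsubC count_map /stab_count.
rewrite -(count_lmul (P := fun u => det2 _ (u *m _) == 0) KG (signed_inv KG Kh)); last first.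
  by move=> g; rewrite mulNmx det2Nr oppr_eq0.
apply: eq_in_count => u Ku /=.
have [d0 _] := finite_mob (mem_signed Ku) Uy; have [dh0 _] := finite_mob Kh Uy.
rewrite mob_eqE // -(mulr1 (det2 _ (_ *m _))).
have -> : (det2 (pt (mob h y)) (u *m pt y) * 1 == 0) =
  (det2 (h *m pt y) (u *m pt y) == 0).
  by rewrite [h *m _]mul_pt_mob // det2Zl mulr1 mulf_eq0 (negPf dh0).
rewrite -[u in LHS](mulKVmx (signed_unit KG Kh)) -(mulmxA h) det2_mul.
by rewrite (signed_det KG) // mul1r.
Qed.

Definition fix_form g : {poly C} := g 1 0 *: 'X^2 + (g 1 1 - g 0 0) *: 'X - (g 0 1)%:P.

Lemma fix_formE g x : (fix_form g).[x] = det2 (pt x) (g *m pt x).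
Proof. by rewrite mul_pt !hornerE /det2 !mxE /= /num /den; ring. Qed.

(** Only scalar matrices fix every point, and those of determinant one are [1] and [- 1]. *)
Lemma fix_form_neq0 g : \det g = 1 -> g != 1%:M -> g != - 1%:M -> fix_form g != 0.
Proof.
move=> dg g1 gN1; apply/eqP => f0.
have c2 := congr1 (fun p : {poly C} => p`_2) f0.
have c1 := congr1 (fun p : {poly C} => p`_1) f0.
have c0 := congr1 (fun p : {poly C} => p`_0) f0.
move: c0 c1 c2; rewrite !coefD !coefN !coefZ !coefXn !coefX !coefC /=.
rewrite !(mulr0, mulr1, addr0, add0r, oppr0, subr0) => /eqP.
rewrite oppr_eq0 => /eqP b0 /eqP; rewrite subr_eq0 => /eqP ad c0.
move: dg; rewrite det2E b0 c0 mulr0 subr0 ad -expr2 => /eqP; rewrite sqrf_eq1.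
have gE a : g 0 0 = a -> g = a%:M.
  move=> e; apply/matrixP => i j; rewrite mxE.
  by case: (ord2P i) => ->; case: (ord2P j) => ->; rewrite /= ?b0 ?c0 ?ad ?e.
case/orP => /eqP /gE e; first by rewrite e eqxx in g1.
by move: gN1; rewrite e raddfN eqxx.
Qed.

(** Points where this polynomial does not vanish are finite and have trivial stabilisers. *)
Definition generic_form : {poly C} :=
  r * \prod_(u <- Ks) \prod_(g <- Ks | g != u) fix_form (invmx u *m g).

Lemma generic_orbit y : generic_form.[y] != 0 ->
  finite_pt y /\ uniq [seq mob u y | u <- Ks].
Proof.
rewrite hornerM mulf_eq0 negb_or => /andP[Uy]; rewrite horner_prod => ny; split=> //.
rewrite map_inj_in_uniq ?(sg_uniq KG) // => u g Ku Kg e; apply/eqP/negPn/negP => ug.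
move/negP: ny; apply; rewrite prodf_seq_eq0; apply/hasP; exists u => //=.
rewrite horner_prod prodf_seq_eq0; apply/hasP; exists g => //=.
rewrite eq_sym ug /= fix_formE.
have [du0 _] := finite_mob (mem_signed Ku) Uy.
have [dg0 _] := finite_mob (mem_signed Kg) Uy.
have : det2 (u *m pt y) (g *m pt y) = 0.
  by rewrite !mul_pt_mob // e det2Zl det2Zr det2vv !mulr0.
rewrite -{1}(mulKVmx (signed_unit KG (mem_signed Ku)) g) -(mulmxA u) det2_mul.
by rewrite (sg_det KG) // mul1r => ->.
Qed.

Lemma r_neq0 y : finite_pt y -> r != 0.
Proof. by rewrite /finite_pt; apply: contraNneq => ->; rewrite horner0. Qed.

Lemma generic_form_neq0 y : finite_pt y -> generic_form != 0.
Proof.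
move=> Uy; rewrite mulf_neq0 ?(r_neq0 Uy) // prodf_seq_neq0; apply/allP => u Ku /=.
rewrite prodf_seq_neq0; apply/allP => g Kg /=; apply/implyP => gu.
have Uu := signed_unit KG (mem_signed Ku).
have eg : g = u *m (invmx u *m g) by rewrite mulKVmx.
apply: fix_form_neq0.
- apply: (signed_det KG); apply: (signed_mul KG); last exact: mem_signed.
  exact/(signed_inv KG)/mem_signed.
- by apply: contraNneq gu => e; rewrite eg e mulmx1.
- apply/eqP => e; have := sg_sign KG Ku.
  by rewrite -[u]mulmx1 -mulmxN -e -eg Kg.
Qed.

(** ** The coordinate on the quotient *)

Variable y0 : C.
Hypothesis Uy0 : finite_pt y0.

Local Notation q := (orbit_form (pt y0)).

Definition qcoord x := q.[x] / r.[x].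

Lemma qcoord_mob h x : K h -> finite_pt x -> qcoord (mob h x) = qcoord x.
Proof.
move=> Kh Ux; have [e e0 he] := thetaL KG Kh; have [d0 Uhx] := finite_mob Kh Ux.
move: (Ux) (Uhx); rewrite /qcoord /finite_pt !orbit_formE => tx thx.
have h1 := th_mob Kh Ux (he _ (pt y0)); have h2 := th_mob Kh Ux (he _ inf).
have dn0 : den h x ^+ n != 0 by rewrite expf_neq0.
apply: (mulIf dn0); rewrite mulrAC h1 -(mulfK dn0 (th (pt (mob h x)) inf)) h2.
by field; rewrite dn0 e0 tx.
Qed.

(** The invariant pairing in terms of the coordinate: [orbit_form (pt y)] is, up to a scalar, the
member of the pencil spanned by [q] and [r] that vanishes at [y]. For generic [y] the member has
as many zeros on the orbit as its degree allows; both sides are polynomials in [y]. *)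
Lemma pencil : exists2 k : C, k != 0 &
  forall x y, q.[x] * r.[y] - q.[y] * r.[x] = k * th (pt x) (pt y).
Proof.
have [e e0 he] := thetaC KG.
have t0 : th inf (pt y0) != 0.
  by rewrite he mulf_neq0 //; move: Uy0; rewrite /finite_pt orbit_formE.
exists (th inf (pt y0) / e); first by rewrite mulf_neq0 ?invr_neq0.
set k := _ / e => x.
suff gen y : generic_form.[y] != 0 -> q.[x] * r.[y] - q.[y] * r.[x] = k * th (pt x) (pt y).
  have P : q.[x] *: r - r.[x] *: q = (k * e) *: orbit_form (pt x).
    apply: (poly_dense (generic_form_neq0 Uy0)) => y /gen.
    move=> E; rewrite !hornerE [(orbit_form (pt x)).[y]]orbit_formE.
    by rewrite -[RHS]mulrA -he -E; ring.
  move=> y; have := congr1 (horner^~ y) P.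
  rewrite !hornerE [(orbit_form (pt x)).[y]]orbit_formE -mulrA -he => <-.
  by ring.
move=> gy; have [Uy uy] := generic_orbit gy.
pose D := r.[y] *: q - q.[y] *: r - k *: orbit_form (pt y).
suff D0 : D = 0.
  have := congr1 (horner^~ x) D0; rewrite !hornerE => /eqP; rewrite subr_eq0 => /eqP.
  by rewrite !orbit_formE => <-; ring.
apply/eqP/negPn/negP => D0.
have : (size [seq mob u y | u <- Ks] < size D)%N.
  apply: max_poly_roots => //; apply/allP => _ /mapP[u Ku ->].
  have Kh := mem_signed Ku; have [d0 Uh] := finite_mob Kh Uy.
  have t0' : th (pt (mob u y)) (pt y) = 0.
    apply: (theta_signed Kh); apply/eqP.
    by rewrite -mob_eqE.
  have := qcoord_mob Kh Uy; rewrite /qcoord => /eqP; rewrite eqr_div // => /eqP E.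
  rewrite /root !hornerE [(orbit_form (pt y)).[_]]orbit_formE t0' mulr0 subr0 subr_eq0.
  by rewrite mulrC E mulrC.
rewrite size_map ltnNge => /negP; apply.
have sD : (size D <= n.+1)%N.
  rewrite (leq_trans (size_polyD _ _)) // geq_max size_polyN.
  rewrite (leq_trans (size_polyD _ _)) ?geq_max ?size_polyN;
  by rewrite ?(leq_trans (size_scale_leq _ _)) ?size_orbit_form.
move: sD; rewrite leq_eqVlt => /orP[/eqP sD|//].
have : D`_n = 0.
  rewrite !coefB !coefZ !lead_orbit_form th_inf mulr0 subr0 orbit_formE.
  rewrite (he inf (pt y)) /k; apply/eqP; rewrite subr_eq0; apply/eqP; by field.
by move=> Dn; have := D0; rewrite -lead_coef_eq0 lead_coefE sD Dn eqxx.
Qed.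

Lemma qcoord_eq x y : finite_pt x -> finite_pt y ->
  (qcoord x == qcoord y) = (th (pt x) (pt y) == 0).
Proof.
move=> Ux Uy; have [k k0 hk] := pencil.
by rewrite /qcoord eqr_div // -subr_eq0 hk mulf_eq0 (negPf k0).
Qed.

Lemma qcoord_eqP x y : finite_pt x -> finite_pt y ->
  reflect (exists2 u, u \in Ks & x = mob u y) (qcoord x == qcoord y).
Proof.
move=> Ux Uy; rewrite qcoord_eq // theta_eq0.
apply: (iffP hasP) => -[u Ku] e; have [d0 _] := finite_mob (mem_signed Ku) Uy.
  by exists u => //; apply/esym/eqP; rewrite mob_eqE.
by exists u => //; rewrite -mob_eqE // e.
Qed.

Definition level z : {poly C} := q - z *: r.

Lemma levelE z x : finite_pt x -> (level z).[x] = (qcoord x - z) * r.[x].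
Proof. by move=> Ux; rewrite !hornerE /qcoord; field. Qed.

Lemma lead_level z : (level z)`_n = th inf (pt y0) /\ th inf (pt y0) != 0.
Proof.
rewrite coefB coefZ !lead_orbit_form th_inf mulr0 subr0; split=> //.
have [e e0 ->] := thetaC KG; rewrite mulf_neq0 //.
by move: Uy0; rewrite /finite_pt orbit_formE.
Qed.

Lemma level_neq0 z : level z != 0.
Proof.
by apply/eqP => l0; have [<-] := lead_level z; rewrite l0 coef0 eqxx.
Qed.

(** A point of the fibre over [z] is a root of [level z]. The root is not a pole: there [q] would
vanish as well, although the zeros of [q] form the orbit of the finite point [y0]. *)
Lemma qcoord_surj z : exists2 x, finite_pt x & qcoord x = z.
Proof.
have [x /rootP lx] : exists x, root (level z) x.
  apply/closed_rootP; have [l1 l2] := lead_level z.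
  apply: contraL (Ks_gt0 KG) => /eqP s1; rewrite -leqNgt leqn0; apply/negPn/negP => n0.
  by move: l1 l2; rewrite nth_default => [<-|]; rewrite ?eqxx // s1 lt0n.
have Ux : finite_pt x.
  apply/negP => /eqP rx; move: lx; rewrite !hornerE rx mulr0 subr0 orbit_formE => /eqP.
  rewrite theta_eq0 => /hasP[u Ku]; have [d0 Uu] := finite_mob (mem_signed Ku) Uy0.
  by rewrite -mob_eqE // => /eqP ux; move: Uu; rewrite ux /finite_pt rx eqxx.
exists x => //; move: lx; rewrite levelE // => /eqP.
by rewrite mulf_eq0 subr_eq0 (negPf Ux) orbF => /eqP.
Qed.

(** By the [pencil] the level set through [y] is cut out by the form of the orbit of [y]. *)
Lemma mup_level h y : K h -> finite_pt y ->
  mup (mob h y) (level (qcoord y)) = stab_count y.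
Proof.
move=> Kh Uy; have [k k0 hk] := pencil.
have -> : level (qcoord y) = (k / r.[y])%:P * orbit_form (pt y).
  apply: (poly_dense (oner_neq0 _)) => x _; have ry : r.[y] != 0 := Uy.
  rewrite !hornerE [(orbit_form (pt y)).[x]]orbit_formE /qcoord.
  transitivity ((q.[x] * r.[y] - q.[y] * r.[x]) / r.[y]); first by field.
  by rewrite hk mulrAC.
rewrite mupMr ?mup_orbit_form // rootC mulf_neq0 ?invr_neq0 //.
Qed.

Lemma mup_level0 z x : finite_pt x -> qcoord x != z -> mup x (level z) = 0%N.
Proof.
move=> Ux xz; apply: mupNroot; rewrite /root levelE // mulf_eq0 subr_eq0.
by rewrite (negPf xz).
Qed.

End Quotient.

(** * Polynomials and fractional linear maps *)

Section MoebiusPoly.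
Variable C : closedFieldType.
Implicit Types (A B : {poly C}) (g : 'M[C]_2) (x : C).

Definition num_poly g : {poly C} := g 0 0 *: 'X + (g 0 1)%:P.
Definition den_poly g : {poly C} := g 1 0 *: 'X + (g 1 1)%:P.

Lemma num_polyE g x : (num_poly g).[x] = num g x. Proof. by rewrite !hornerE. Qed.
Lemma den_polyE g x : (den_poly g).[x] = den g x. Proof. by rewrite !hornerE. Qed.

Lemma den_poly_neq0 g : \det g = 1 -> den_poly g != 0.
Proof.
move=> dg; apply/eqP => d0; have := congr1 (fun p : {poly C} => (p`_0, p`_1)) d0.
rewrite !coefD !coefZ !coefX !coefC /= mulr0 mulr1 add0r addr0 => -[g11 g10].
by move: dg; rewrite det2E g11 g10 mulr0 mul0r subr0 => /eqP; rewrite eq_sym oner_eq0.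
Qed.

(** Substituting a fractional linear map in a polynomial only creates powers of its
denominator. *)
Lemma horner_mob A g : exists B k, forall x, den g x != 0 ->
  A.[mob g x] = B.[x] / den g x ^+ k.
Proof.
elim/poly_ind: A => [|A c [B [k IH]]].
  by exists 0, 0%N => x _; rewrite !horner0 mul0r.
exists (B * num_poly g + c *: den_poly g ^+ k.+1), k.+1 => x d0.
have -> : (B * num_poly g + c *: den_poly g ^+ k.+1).[x] =
    B.[x] * num g x + c * den g x ^+ k.+1.
  by rewrite hornerD hornerZ hornerM horner_exp num_polyE den_polyE.
rewrite hornerD hornerM hornerX hornerC IH // /mob exprS; field.
by rewrite d0 expf_neq0.
Qed.

(** The chain rule for a form of degree [k] that a fractional linear map multiplies by [e],
written in the affine coordinate. *)
Lemma deriv_mob A (k : nat) g e : \det g = 1 -> (size A <= k.+1)%N ->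
  (forall x, den g x != 0 -> A.[mob g x] * den g x ^+ k = e * A.[x]) ->
  forall x, den g x != 0 ->
  e * A^`().[x] * den g x ^+ 2 =
  den g x ^+ k * (A^`().[mob g x] + k%:R * g 1 0 * den g x * A.[mob g x]).
Proof.
move=> dg sA Ag x d0.
have AE : A = \sum_(i < k.+1) A`_i *: 'X^i.
  by rewrite -poly_def; apply/polyP => i; rewrite coef_poly; case: ltnP => // /(leq_trans sA)/leq_sizeP->.
pose H := \sum_(i < k.+1) A`_i *: (num_poly g ^+ i * den_poly g ^+ (k - i)).
have HE : H = e *: A.
  apply: (poly_dense (den_poly_neq0 dg)) => y; rewrite den_polyE => dy.
  rewrite hornerZ -Ag // {1}AE !horner_sum mulr_suml; apply: eq_bigr => i _.
  rewrite !hornerZ hornerXn hornerM !horner_exp num_polyE den_polyE -mulrA; congr (_ * _).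
  have ik : (i <= k)%N by rewrite -ltnS.
  have -> : den g y ^+ k = den g y ^+ i * den g y ^+ (k - i) by rewrite -exprD subnKC.
  by rewrite mulrA -exprMn /mob divfK.
have dH : H^`().[x] = e * A^`().[x] by rewrite HE derivZ hornerZ.
rewrite -dH; set y := mob g x.
have ny : num g x = y * den g x by rewrite divfK.
have -> : A^`().[y] = \sum_(i < k.+1) A`_i * (y ^+ i.-1 *+ i).
  rewrite {1}AE raddf_sum horner_sum /=; apply: eq_bigr => i _.
  by rewrite derivZ derivXn !hornerE hornerMn hornerXn.
have -> : A.[y] = \sum_(i < k.+1) A`_i * y ^+ i.
  by rewrite {1}AE horner_sum; apply: eq_bigr => i _; rewrite !hornerE.
rewrite mulr_sumr -big_split /= mulr_sumr raddf_sum horner_sum mulr_suml /=.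
apply: eq_bigr => i _.
have dn : (num_poly g)^`() = (g 0 0)%:P.
  by rewrite derivD derivZ derivX derivC addr0 alg_polyC.
have dd : (den_poly g)^`() = (g 1 0)%:P.
  by rewrite derivD derivZ derivX derivC addr0 alg_polyC.
rewrite derivZ derivM !deriv_exp dn dd hornerZ hornerD !hornerM !hornerMn !hornerM !horner_exp.
rewrite !hornerC num_polyE den_polyE ny.
have dy : g 0 0 * den g x = 1 + g 1 0 * den g x * y.
  move: dg; rewrite det2E => dg; apply: (addIr (- (g 1 0 * den g x * y))).
  by rewrite addrK -mulrA (mulrC (den _ _)) -ny -dg /num /den; ring.
move: (den g x) y dy {ny AE Ag H HE dH sA d0} => t y dy.
case: i => i /=; rewrite ltnS => ik.
have [j ->] : exists j, k = (i + j)%N by exists (k - i)%N; rewrite subnKC.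
(* The boundary terms [i = 0] and [i = k] are treated apart because of the truncated exponents. *)
rewrite addKn {ik}; case: i j => [|i'] [|j'] /=.
- by rewrite !mulr0n !expr0; ring.
- by rewrite !mulr0n !exprS; ring.
- rewrite addn0 mulr0n mulr0 addr0 exprMn.
  transitivity (A`_i'.+1 * y ^+ i' * t ^+ i'.+1 * (g 0 0 * t) *+ i'.+1).
    by rewrite !exprS; ring.
  by rewrite dy !exprS; ring.
- rewrite !exprMn.
  transitivity (A`_i'.+1 * y ^+ i' * t ^+ (i' + j').+2 * (g 0 0 * t) *+ i'.+1
     + A`_i'.+1 * y ^+ i'.+1 * t ^+ (i' + j').+3 * g 1 0 *+ j'.+1).
    by rewrite !exprS !exprD; ring.
  by rewrite dy addSn addnS !exprS !exprD; ring.
Qed.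

End MoebiusPoly.

(** * Invariant functions *)

Section Invariants.
Variables (C : numClosedFieldType) (Ks : seq 'M[C]_2).
Hypothesis KG : signed_group Ks.
Variable y0 : C.
Hypothesis Uy0 : finite_pt Ks y0.
Implicit Types (A B D e : {poly C}) (phi psi : C -> C) (h : 'M[C]_2) (x y z : C).

Local Notation pt x := (vec2 x 1).
Local Notation inf := (vec2 1 0 : 'cV[C]_2).
Local Notation K := (signed_mem Ks).
Local Notation n := (size Ks).
Local Notation U := (finite_pt Ks).
Local Notation r := (orbit_form Ks inf).
Local Notation q := (orbit_form Ks (pt y0)).
Local Notation J := (qcoord Ks y0).

(** ** Regular functions *)

Definition regular phi := exists A D, (forall x, U x -> D.[x] != 0) /\
  forall x, U x -> phi x = A.[x] / D.[x].

Lemma regular_ext phi psi : (forall x, U x -> phi x = psi x) -> regular phi -> regular psi.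
Proof.
by move=> e [A [D [D0 h]]]; exists A, D; split=> // x Ux; rewrite -e // h.
Qed.

Lemma regular_poly A : regular (fun x => A.[x]).
Proof. by exists A, 1; split=> x _; rewrite hornerC ?oner_eq0 // divr1. Qed.

Lemma regular_cst c : regular (fun=> c).
Proof. by apply: regular_ext (regular_poly c%:P) => x _; rewrite hornerC. Qed.

Lemma regularD phi psi : regular phi -> regular psi -> regular (fun x => phi x + psi x).
Proof.
move=> [A [D [D0 hA]]] [B [E [E0 hB]]]; exists (A * E + B * D), (D * E).
split=> x Ux; rewrite hornerM ?mulf_neq0 ?D0 ?E0 // hA // hB // hornerD !hornerM.
by rewrite addf_div ?D0 ?E0.
Qed.

Lemma regularM phi psi : regular phi -> regular psi -> regular (fun x => phi x * psi x).
Proof.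
move=> [A [D [D0 hA]]] [B [E [E0 hB]]]; exists (A * B), (D * E).
by split=> x Ux; rewrite hornerM ?mulf_neq0 ?D0 ?E0 // hA // hB // hornerM mulf_div.
Qed.

Lemma regularB phi psi : regular phi -> regular psi -> regular (fun x => phi x - psi x).
Proof.
move=> r1 r2; apply: regular_ext (regularD r1 (regularM (regular_cst (- 1)) r2)) => x _.
by rewrite mulN1r.
Qed.

Lemma regular_id : regular (fun x => x).
Proof. by apply: regular_ext (regular_poly 'X) => x _; rewrite hornerX. Qed.

Lemma regularX phi k : regular phi -> regular (fun x => phi x ^+ k).
Proof.
move=> rp; elim: k => [|k IH]; first exact: regular_cst.
by apply: regular_ext (regularM rp IH) => x _; rewrite exprS.
Qed.

Lemma regularV_poly A : (forall x, U x -> A.[x] != 0) -> regular (fun x => A.[x]^-1).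
Proof. by move=> A0; exists 1, A; split=> // x _; rewrite hornerC div1r. Qed.

Lemma regular_sum (I : Type) (s : seq I) (f : I -> C -> C) :
  (forall i, regular (f i)) -> regular (fun x => \sum_(i <- s) f i x).
Proof.
move=> rf; elim: s => [|i s IH].
  by apply: regular_ext (regular_cst 0) => x _; rewrite big_nil.
by apply: regular_ext (regularD (rf i) IH) => x _; rewrite big_cons.
Qed.

Lemma regular_mob h phi : K h -> regular phi -> regular (fun x => phi (mob h x)).
Proof.
move=> Kh [A [D [D0 hA]]].
have [B [k hB]] := horner_mob A h; have [E [l hE]] := horner_mob D h.
have U0 x : U x -> den h x != 0 /\ U (mob h x) by apply: finite_mob.
exists (B * den_poly h ^+ l), (E * den_poly h ^+ k); split=> x Ux;
  have [d0 Uh] := U0 x Ux; have := D0 _ Uh; rewrite hE // mulf_eq0 negb_or => /andP[E0 _];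
  rewrite ?hA // ?hB // ?hE // !hornerM !horner_exp !den_polyE.
  by rewrite mulf_neq0 // expf_neq0.
by field; rewrite E0 !expf_neq0.
Qed.

(** Both sides are quotients of polynomials, which agree off the zeros of [e] and off the
poles. *)
Lemma regular_dense e phi psi : e != 0 -> regular phi -> regular psi ->
  (forall x, U x -> e.[x] != 0 -> phi x = psi x) -> forall x, U x -> phi x = psi x.
Proof.
move=> e0 [A [D [D0 hA]]] [B [E [E0 hB]]] pp x Ux.
have AB : A * E = B * D.
  apply: (poly_dense (e := e * r)); first by rewrite mulf_neq0 // (r_neq0 Uy0).
  move=> z; rewrite hornerM mulf_eq0 negb_or => /andP[ez Uz].
  have := pp z Uz ez; rewrite hA // hB // => /eqP; rewrite eqr_div ?D0 ?E0 // => /eqP.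
  by rewrite !hornerM.
rewrite hA // hB //; apply/eqP; rewrite eqr_div ?D0 ?E0 //.
by rewrite -!hornerM AB.
Qed.

(** Being zero at [inf], the form [r] has degree less than [n] in the affine coordinate. *)
Lemma size_r : (size r <= n)%N.
Proof.
have := size_orbit_form Ks inf; rewrite leq_eqVlt => /orP[/eqP s|//].
have := lead_orbit_form Ks inf; rewrite (th_inf KG) => l0.
have := r_neq0 Uy0; rewrite -lead_coef_eq0 lead_coefE s /= l0 eqxx //.
Qed.

(** A denominator without zeros off the poles divides a power of any polynomial [p] vanishing
exactly there; as [p] has degree less than [N], a large power turns the numerator into a form of
the same degree as the denominator. *)
Lemma regular_frac phi p N : regular phi -> (forall x, U x = (p.[x] != 0)) -> (size p <= N)%N ->
  exists k0, forall k, (k0 <= k)%N -> exists E : {poly C},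
    (size E <= (k * N).+1)%N /\ forall x, U x -> phi x = E.[x] / p.[x] ^+ k.
Proof.
move=> [A [D [D0 hA]]] Up sp.
have nD : D != 0 by apply: contraNneq (D0 _ Uy0) => ->; rewrite horner0.
have [l] : exists l, D %| p ^+ l.
  apply: dvdp_exp_roots => // x Dx; apply/negPn/negP => px.
  by have := D0 x; rewrite Up (rootP Dx) eqxx => /(_ px).
move=> /dvdpP[E0 pE]; pose E := A * E0; exists (l + size E)%N => k lk.
exists (E * p ^+ (k - l)); split; last first.
  move=> x Ux; have px : p.[x] != 0 by rewrite -Up.
  have Dx := D0 _ Ux; rewrite hA // hornerM horner_exp hornerM.
  have kl : (l <= k)%N by apply: leq_trans lk; rewrite leq_addr.
  have -> : p.[x] ^+ k = p.[x] ^+ l * p.[x] ^+ (k - l) by rewrite -exprD subnKC.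
  have := congr1 (horner^~ x) pE; rewrite horner_exp hornerM => e.
  have Ex : E0.[x] != 0.
    by have := expf_neq0 l px; rewrite e mulf_eq0 negb_or => /andP[].
  by rewrite e; field; rewrite expf_neq0 // Ex Dx.
apply: leq_trans (size_polyMleq _ _) _.
have := size_poly_exp_leq p (k - l); have p0 : (0 < size p)%N.
  rewrite size_poly_gt0; apply: contraTneq Uy0 => p0.
  by rewrite Up p0 horner0 eqxx.
have := leq_trans p0 sp; move: lk sp.
move: (size E) (size p) N (size (p ^+ (k - l))%R) => e s m t lk sm m0 tb.
have : (s.-1 * (k - l) <= m.-1 * (k - l))%N by rewrite leq_mul2r; apply/orP; right; lia.
case: m m0 sm => // m _ sm /= sb; rewrite mulnS.
have : (m * (k - l) <= m * k)%N by rewrite leq_mul2l leq_subr orbT.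
rewrite (mulnC k m); lia.
Qed.

(** ** Invariant functions are polynomials in the coordinate *)

(** An invariant function takes its value at a generic point [y] at [n] points, so the form of the
orbit of [y] divides the difference; the quotient is invariant with smaller poles. *)
Lemma invariant_poly phi e : regular phi -> e != 0 ->
  (forall h x, h \in Ks -> U x -> e.[x] != 0 -> phi (mob h x) = phi x) ->
  exists a : {poly C}, forall x, U x -> phi x = a.[J x].
Proof.
move=> rphi; have [k0 /(_ _ (leqnn k0))[A [sA hA]]] := regular_frac rphi (fun=> erefl) size_r.
move: k0 sA hA => k sA hA.
(* Induction on the order of the pole; the polynomial [e] accumulates the orbits used so far. *)
elim: k => [|k IH] in phi rphi A sA hA e * => e0 inv.
  have /size1_polyC AE : (size A <= 1)%N := sA.
  exists (A`_0)%:P => x Ux; rewrite hA // expr0 divr1 hornerC.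
  by rewrite AE hornerC coefC.
have /closed_nonrootP[y] : generic_form Ks * e != 0.
  by rewrite mulf_neq0 // (generic_form_neq0 KG Uy0).
rewrite /root hornerM mulf_eq0 negb_or => /andP[gy ey].
have [Uy uy] := generic_orbit KG gy.
pose c := phi y; pose G := A - c *: r ^+ k.+1.
have Gx x : U x -> G.[x] = (phi x - c) * r.[x] ^+ k.+1.
  move=> Ux; rewrite !hornerE hA // mulrBl divfK // expf_neq0 //.
have [d d0 oE] := orbit_form_split KG Uy.
have /dvdpP[B GE] : orbit_form Ks (pt y) %| G.
  rewrite oE dvdpZl //; apply: uniq_roots_dvdp; last by rewrite uniq_rootsE.
  apply/allP => _ /mapP[u Ku ->]; have [_ Uu] := finite_mob KG (mem_signed Ku) Uy.
  by rewrite /root Gx // (inv _ _ Ku Uy ey) subrr mul0r.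
have [kk k0 hk] := pencil KG Uy0.
have rk x : U x -> r.[x] ^+ k.+1 != 0 by move=> ?; rewrite expf_neq0.
pose psi x := B.[x] / r.[x] ^+ k.
have ofE x : U x -> (orbit_form Ks (pt y)).[x] = (J x - J y) * (r.[x] * r.[y] / kk).
  move=> Ux; rewrite orbit_formE.
  have -> : theta Ks (pt x) (pt y) = (q.[x] * r.[y] - q.[y] * r.[x]) / kk.
    by rewrite hk mulrC mulKf.
  have rx : r.[x] != 0 := Ux; have ry : r.[y] != 0 := Uy.
  by rewrite /qcoord; field; rewrite rx ry k0.
have phiE x : U x -> phi x = c + (J x - J y) * (r.[y] / kk) * psi x.
  move=> Ux; have rx : r.[x] != 0 := Ux.
  have := Gx x Ux; rewrite GE hornerM ofE // => E.
  apply: (mulIf (rk _ Ux)); rewrite mulrDl -[LHS](subrK (c * r.[x] ^+ k.+1)).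
  rewrite -mulrBl -E addrC /psi exprS; congr (_ + _).
  by field; rewrite k0 expf_neq0 ?rx.
have rpsi : regular psi.
  exists B, (r ^+ k); split=> x Ux; rewrite horner_exp //.
  by rewrite expf_neq0.
have sB : (size B <= (k * n).+1)%N.
  have [->|B0] := eqVneq B 0; first by rewrite size_poly0.
  have o0 : orbit_form Ks (pt y) != 0.
    by rewrite oE scaler_eq0 negb_or d0 monic_neq0 // monic_prod_XsubC.
  have : (size G <= (k.+1 * n).+1)%N.
    rewrite (leq_trans (size_polyD _ _)) // geq_max sA size_polyN.
    rewrite (leq_trans (size_scale_leq _ _)) //.
    rewrite (leq_trans (size_poly_exp_leq _ _)) // ltnS mulnC leq_mul2l /=.
    by rewrite (leq_trans (leq_pred _)) // size_r.
  rewrite GE size_mul // oE size_scale // size_prod_XsubC size_map addnS /= mulSn.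
  by rewrite -addnS addnC leq_add2l.
have [] := IH psi rpsi B sB _ (e * orbit_form Ks (pt y)).
- by [].
- rewrite mulf_neq0 // oE scaler_eq0 negb_or d0 monic_neq0 // monic_prod_XsubC //.
- move=> h x Kh Ux; rewrite hornerM mulf_eq0 negb_or => /andP[ex ox].
  have [_ Uh] := finite_mob KG (mem_signed Kh) Ux.
  have := inv _ _ Kh Ux ex; rewrite (phiE _ Uh) (phiE _ Ux) (qcoord_mob KG y0 (mem_signed Kh) Ux).
  move=> /addrI; apply: mulfI; rewrite mulf_neq0 //.
    by apply: contraNneq ox => e0'; rewrite ofE // e0' mul0r.
  by rewrite mulf_neq0 ?invr_neq0.
move=> a ha; exists (c%:P + ('X - (J y)%:P) * (r.[y] / kk)%:P * a) => x Ux.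
by rewrite phiE // ha // !hornerE.
Qed.

End Invariants.

(** * Functions with an automorphy factor *)

Section Weights.
Variables (C : numClosedFieldType) (Ks : seq 'M[C]_2).
Hypothesis KG : signed_group Ks.
Variable y0 : C.
Hypothesis Uy0 : finite_pt Ks y0.
Implicit Types (A B D e : {poly C}) (phi psi : C -> C) (h : 'M[C]_2) (x y z : C).

Local Notation pt x := (vec2 x 1).
Local Notation inf := (vec2 1 0 : 'cV[C]_2).
Local Notation K := (signed_mem Ks).
Local Notation n := (size Ks).
Local Notation U := (finite_pt Ks).
Local Notation r := (orbit_form Ks inf).
Local Notation q := (orbit_form Ks (pt y0)).
Local Notation J := (qcoord Ks y0).

(** ** The derivative of the coordinate *)

Definition wronskian : {poly C} := q^`() * r - q * r^`().
Definition dcoord x := wronskian.[x] / r.[x] ^+ 2.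
(** As [r] is a form of degree [n], this is the logarithmic derivative of an [n]-th root of [r], a
form of degree one. *)
Definition slope x := r^`().[x] / (n%:R * r.[x]).

Lemma nK_neq0 : n%:R != 0 :> C.
Proof. by rewrite pnatr_eq0 -lt0n (Ks_gt0 KG). Qed.

(** The scalar [e] does not depend on the orbit, so that it cancels in quotients and in Wronskians
divided by squares. *)
Lemma form_mob h : K h -> exists2 e : C, e != 0 & forall w x, U x ->
  let A := orbit_form Ks w in
  A.[mob h x] * den h x ^+ n = e * A.[x] /\
  e * A^`().[x] * den h x ^+ 2 =
    den h x ^+ n * (A^`().[mob h x] + n%:R * h 1 0 * den h x * A.[mob h x]).
Proof.
move=> Kh; have [e e0 he] := thetaL KG Kh; exists e => // w x Ux /=.
have E z : den h z != 0 ->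
    (orbit_form Ks w).[mob h z] * den h z ^+ n = e * (orbit_form Ks w).[z].
  by move=> dz; rewrite !orbit_formE -he mul_pt_mob // thetaZl mulrC.
have [d0 _] := finite_mob KG Kh Ux; split; first exact: E.
apply: deriv_mob => //; [exact: (signed_det KG)|exact: size_orbit_form].
Qed.

(** This is the chain rule for the invariant function [J], as [mob h] has derivative [(den h x) ^-
2]. *)
Lemma dcoord_mob h x : K h -> U x -> dcoord (mob h x) = den h x ^+ 2 * dcoord x.
Proof.
move=> Kh Ux; have [e e0 he] := form_mob Kh; have [d0 Uh] := finite_mob KG Kh Ux.
have [q1 q2] := he (pt y0) x Ux; have [r1 r2] := he inf x Ux.
rewrite /dcoord /wronskian !hornerD !hornerN !hornerM.
have dn0 : den h x ^+ n != 0 by rewrite expf_neq0.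
have rx : r.[x] != 0 := Ux; have rh : r.[mob h x] != 0 := Uh.
move: q1 q2 r1 r2; move: (den h x ^+ n) dn0 => t t0.
move: (den h x) d0 => d d0 q1 q2 r1 r2.
have qE : q.[mob h x] = e * q.[x] / t by apply: (canRL (mulfK t0)).
have rE : r.[mob h x] = e * r.[x] / t by apply: (canRL (mulfK t0)).
have dqE : q^`().[mob h x] = e * q^`().[x] * d ^+ 2 / t - n%:R * h 1 0 * d * q.[mob h x].
  by rewrite q2; field.
have drE : r^`().[mob h x] = e * r^`().[x] * d ^+ 2 / t - n%:R * h 1 0 * d * r.[mob h x].
  by rewrite r2; field.
rewrite dqE drE qE rE; field.
by rewrite t0 e0 rx.
Qed.

(** The affine term comes from differentiating the factor [den h x ^+ n] of the form [r]. *)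
Lemma slope_mob h x : K h -> U x ->
  slope (mob h x) = den h x ^+ 2 * slope x - h 1 0 * den h x.
Proof.
move=> Kh Ux; have [e e0 he] := form_mob Kh; have [d0 Uh] := finite_mob KG Kh Ux.
have [r1 r2] := he inf x Ux; rewrite /slope.
have dn0 : den h x ^+ n != 0 by rewrite expf_neq0.
have rx : r.[x] != 0 := Ux; have rh : r.[mob h x] != 0 := Uh; have n0 := nK_neq0.
move: r1 r2; move: (den h x ^+ n) dn0 => t t0.
move: (den h x) d0 => d d0 r1 r2.
have rE : r.[mob h x] = e * r.[x] / t by apply: (canRL (mulfK t0)).
have drE : r^`().[mob h x] = e * r^`().[x] * d ^+ 2 / t - n%:R * h 1 0 * d * r.[mob h x].
  by rewrite r2; field.
by rewrite drE rE; field; rewrite t0 e0 rx n0.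
Qed.

Lemma regular_r_inv : regular Ks (fun x => r.[x]^-1).
Proof. exact: regularV_poly. Qed.

Lemma regular_qcoord : regular Ks J.
Proof. exact: regularM (regular_poly _ _) regular_r_inv. Qed.

Lemma regular_slope : regular Ks slope.
Proof.
apply: regular_ext (regularM (regular_poly _ (n%:R^-1 *: r^`())) regular_r_inv) => x Ux.
have rx : r.[x] != 0 := Ux; have n0 := nK_neq0.
by rewrite /slope hornerZ; field; rewrite n0 rx.
Qed.

(** The Wronskian of [q] and [r] is also that of the level [L] of [x] and [r]; with [L] written as
[B * ('X - x%:P) ^+ k], where [B] is nonzero at [x], one factor is lost by differentiation. *)
Lemma mup_wronskian x : U x ->
  wronskian != 0 /\ (mup x wronskian).+1 = mup x (level Ks y0 (J x)).
Proof.
move=> Ux; have rx : r.[x] != 0 := Ux.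
pose L := level Ks y0 (J x); have L0 : L != 0 := level_neq0 KG Uy0 (J x).
have wE : wronskian = L^`() * r - L * r^`().
  by rewrite /wronskian /L /level derivB derivZ -!mul_polyC; ring.
have [k [B]] := multiplicity_XsubC L x; rewrite L0 /= => Bx LE.
have Lx : root L x by rewrite /root levelE // subrr mul0r.
case: k LE => [|k] LE.
  by move: Lx; rewrite LE expr0 mulr1 (negPf Bx).
pose E := (B^`() * ('X - x%:P) + B *+ k.+1) * r - B * ('X - x%:P) * r^`().
have wE2 : wronskian = ('X - x%:P) ^+ k * E.
  rewrite wE LE derivM deriv_exp derivXsubC mul1r /= /E exprS.
  by ring.
have Ex : ~~ root E x.
  rewrite /root /E hornerD hornerN !hornerM hornerD hornerM hornerMn !hornerXsubC subrr.
  by rewrite !(mulr0, mul0r, add0r, subr0, oppr0, addr0) mulf_neq0 // mulrn_eq0 negb_or.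
have Xk m : ('X - x%:P) ^+ m != 0 by rewrite expf_neq0 // polyXsubC_eq0.
have w0 : wronskian != 0.
  by rewrite wE2 mulf_neq0 //; apply: contraNneq Ex => ->; rewrite root0.
split=> //; rewrite wE2 mupMl // mup_XsubCX eqxx.
by rewrite -/L LE mupMr // mup_XsubCX eqxx.
Qed.

(** ** Orders at the marked points *)

(** A mark is the coordinate of an exceptional orbit with the order of its stabilisers. *)
Variable ms : seq (C * nat).
Hypothesis ms_uniq : uniq (unzip1 ms).
Hypothesis ms_orbit : forall m, m \in ms ->
  exists2 y, U y & J y = m.1 /\ stab_count Ks y = m.2.
Hypothesis ms_all : forall y, U y -> (1 < stab_count Ks y)%N -> J y \in unzip1 ms.

Definition unmarked x := U x && (J x \notin unzip1 ms).

Lemma unmarked_finite x : unmarked x -> U x. Proof. by case/andP. Qed.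

Lemma unmarked_mob h x : K h -> unmarked x -> unmarked (mob h x).
Proof.
move=> Kh /andP[Ux ux]; have [_ Uh] := finite_mob KG Kh Ux.
by rewrite /unmarked Uh (qcoord_mob KG) // ux.
Qed.

Lemma stab_gt0 x : (0 < stab_count Ks x)%N.
Proof.
rewrite /stab_count -has_count; apply/hasP; have /orP[h|h] := sg_one KG.
  by exists 1%:M => //; rewrite mul1mx det2vv.
by exists (- 1%:M) => //; rewrite mulNmx mul1mx det2Nr det2vv oppr0.
Qed.

Lemma mup_wronskian_stab x : U x -> (mup x wronskian).+1 = stab_count Ks x.
Proof.
move=> Ux; have [_ ->] := mup_wronskian Ux.
have := mup_level KG Uy0 (sg_one KG) Ux.
have -> // : mob 1%:M x = x.
by rewrite /mob /num /den !mxE /= mul1r mul0r addr0 add0r divr1.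
Qed.

Lemma mark_stab m y : m \in ms -> U y -> J y = m.1 ->
  stab_count Ks y = m.2 /\ mup y (level Ks y0 m.1) = m.2.
Proof.
move=> /ms_orbit[y1 Uy1 [<- <-]] Uy /eqP.
move=> /(qcoord_eqP KG Uy0 Uy Uy1)[u Ku yu].
have h := mup_level KG Uy0 (mem_signed Ku) Uy1.
rewrite {2}yu h; split=> //.
rewrite -mup_wronskian_stab //; have [_ ->] := mup_wronskian Uy.
have -> : J y = J y1 by rewrite yu (qcoord_mob KG) // mem_signed.
by rewrite yu h.
Qed.

Lemma mup_wronskian_unmarked x : unmarked x -> mup x wronskian = 0%N.
Proof.
case/andP=> Ux ux; apply/eqP; rewrite -eqSS mup_wronskian_stab // eqn_leq stab_gt0 andbT.
by rewrite leqNgt; apply: contra ux => /(ms_all Ux).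
Qed.

Lemma dcoord_neq0 x : unmarked x -> dcoord x != 0.
Proof.
move=> ux; have Ux := unmarked_finite ux; have [w0 _] := mup_wronskian Ux.
rewrite mulf_neq0 // ?invr_eq0 ?expf_neq0 //.
have := mup_wronskian_unmarked ux.
by move/eqP; rewrite eqn0Ngt -XsubC_dvd // dvdp_XsubCl.
Qed.

Lemma sub_mark_neq0 x m : unmarked x -> m \in ms -> J x - m.1 != 0.
Proof. by case/andP=> _ ux mm; rewrite subr_eq0; apply: contraNneq ux => ->; apply: map_f. Qed.

Definition mark_form : {poly C} := \prod_(m <- ms) level Ks y0 m.1.

Lemma mark_form_neq0 : mark_form != 0.
Proof. by rewrite prodf_seq_neq0; apply/allP => m _; apply: (level_neq0 KG Uy0). Qed.

Lemma mark_formP x : U x -> mark_form.[x] != 0 -> unmarked x.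
Proof.
move=> Ux; rewrite /unmarked Ux /= horner_prod prodf_seq_neq0 => /allP mx.
apply/mapP => -[m mm Jm]; have := mx m mm.
by rewrite /= levelE // Jm subrr mul0r eqxx.
Qed.

(** The functions with zeros and poles only over the marks, with their divisors: unlike the
regular functions they admit negative powers. *)
Definition has_order phi (o : C -> int) := exists A D, [/\ A != 0, D != 0,
  forall x, unmarked x -> [/\ A.[x] != 0, D.[x] != 0 & phi x = A.[x] / D.[x]] &
  forall y, U y -> (mup y A)%:Z - (mup y D)%:Z = o y].

Lemma has_orderM phi psi o1 o2 : has_order phi o1 -> has_order psi o2 ->
  has_order (fun x => phi x * psi x) (fun y => o1 y + o2 y).
Proof.
move=> [A [D [A0 D0 hA oA]]] [B [E [B0 E0 hB oB]]].
exists (A * B), (D * E); (split; rewrite ?mulf_neq0 //) => [x ux|y Uy].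
  have [a d ->] := hA x ux; have [b e ->] := hB x ux.
  by rewrite !hornerM !mulf_neq0 // mulf_div.
by rewrite !mupM // -oA // -oB // !PoszD; lia.
Qed.

Lemma has_orderV phi o : has_order phi o ->
  has_order (fun x => (phi x)^-1) (fun y => - o y).
Proof.
move=> [A [D [A0 D0 hA oA]]]; exists D, A; split=> // [x ux|y Uy].
  by have [a d ->] := hA x ux; rewrite invf_div.
by rewrite -oA // opprB.
Qed.

Lemma has_order1 : has_order (fun=> 1) (fun=> 0).
Proof.
exists 1, 1; (split; rewrite ?oner_neq0 //) => [x _|y _]; last by rewrite subrr.
by rewrite hornerC oner_neq0 divr1.
Qed.

Lemma has_orderXz phi o (k : int) : has_order phi o ->
  has_order (fun x => phi x ^ k) (fun y => k * o y).
Proof.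
move=> ho.
have nat_case (i : nat) : has_order (fun x => phi x ^+ i) (fun y => i%:Z * o y).
  elim: i => [|i IH].
    have [A [D [A0 D0 h1 h2]]] := has_order1; exists A, D; split=> // y Uy.
    by rewrite h2 // mul0r.
  have [A [D [A0 D0 h1 h2]]] := has_orderM ho IH; exists A, D; split=> // [x ux|y Uy].
    by rewrite exprS; apply: h1.
  by rewrite h2 // -addn1 PoszD mulrDl mul1r addrC.
case: k => i; first exact: nat_case.
have [A [D [A0 D0 h1 h2]]] := has_orderV (nat_case i.+1); exists A, D; split=> // y Uy.
by rewrite h2 // NegzE mulNr.
Qed.

Lemma has_order_prod (I : eqType) (s : seq I) (f : I -> C -> C) (o : I -> C -> int) :
  (forall i, i \in s -> has_order (f i) (o i)) ->
  has_order (fun x => \prod_(i <- s) f i x) (fun y => \sum_(i <- s) o i y).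
Proof.
elim: s => [|i s IH] hs.
  have [A [D [A0 D0 h1 h2]]] := has_order1; exists A, D.
  by split=> // [x ux|y Uy]; rewrite big_nil ?h2 //; apply: h1.
have hs' j : j \in s -> has_order (f j) (o j) by move=> js; apply: hs; rewrite in_cons js orbT.
have [A [D [A0 D0 h1 h2]]] := has_orderM (hs i (mem_head _ _)) (IH hs').
by exists A, D; split=> // [x ux|y Uy]; rewrite big_cons ?h2 //; apply: h1.
Qed.

Lemma mup_nonroot x A : A.[x] != 0 -> mup x A = 0%N.
Proof. by move=> Ax; apply: mupNroot. Qed.

Lemma order_dcoord : has_order dcoord (fun y => (mup y wronskian)%:Z).
Proof.
have [w0 _] := mup_wronskian Uy0; have r0 := r_neq0 Uy0.
exists wronskian, (r ^+ 2); (split; rewrite ?expf_neq0 //) => [x ux|y Uy].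
  have := dcoord_neq0 ux; rewrite horner_exp /dcoord mulf_eq0 negb_or invr_eq0.
  by case/andP.
by rewrite [mup y (r ^+ 2)]mup_nonroot ?subr0 // horner_exp expf_neq0.
Qed.

Lemma order_sub_mark m : m \in ms ->
  has_order (fun x => J x - m.1) (fun y => (mup y (level Ks y0 m.1))%:Z).
Proof.
move=> mm; exists (level Ks y0 m.1), r; split=> [|||y Uy].
- exact: level_neq0.
- exact: r_neq0 Uy0.
- move=> x ux; have Ux := unmarked_finite ux; have rx : r.[x] != 0 := Ux.
  by rewrite levelE // mulf_neq0 ?sub_mark_neq0 // mulfK.
- by rewrite [mup y r]mup_nonroot // subr0.
Qed.

(** ** Invariants of a given weight *)

Definition ceil_div (m : int) (k : nat) : int := - ((- m) %/ k)%Z.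

(** A power of the derivative of [J], corrected so that its order at a marked point of order [k]
is the residue of [- m] modulo [k], the least order that an invariant of weight [2 m] can have. *)
Definition weight_gen (m : int) x : C :=
  dcoord x ^ m * \prod_(t <- ms) (J x - t.1) ^ (ceil_div m t.2 - m).

Definition weight_order (m : int) y : int :=
  m * (mup y wronskian)%:Z +
  \sum_(t <- ms) (ceil_div m t.2 - m) * (mup y (level Ks y0 t.1))%:Z.

Definition mark_order y : int := \sum_(t <- ms) (mup y (level Ks y0 t.1))%:Z.

Lemma order_weight_gen m : has_order (weight_gen m) (weight_order m).
Proof.
apply: has_orderM; first exact: has_orderXz order_dcoord.
by apply: has_order_prod => t tm; apply: has_orderXz; apply: order_sub_mark.
Qed.

Lemma order_mark_prod : has_order (fun x => \prod_(t <- ms) (J x - t.1)) mark_order.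
Proof. by apply: has_order_prod => t tm; apply: order_sub_mark. Qed.

Lemma sum_marks (f : C * nat -> int) t y : t \in ms -> U y -> J y = t.1 ->
  \sum_(s <- ms) f s * (mup y (level Ks y0 s.1))%:Z = f t * t.2%:Z.
Proof.
move=> tm Uy Jy; have [_ mt] := mark_stab tm Uy Jy.
have um : uniq ms by apply: map_uniq ms_uniq.
rewrite (bigD1_seq t) //= mt big_seq_cond big1 ?addr0 // => s /andP[sm st].
rewrite mup_level0 ?mulr0 // Jy; apply: contraNneq st => e.
move: ms_uniq sm tm e; elim: ms {um} => // a s0 IH /= /andP[a0 u0].
rewrite !in_cons => /predU1P[->|ss] /predU1P[->|ts] e //.
- by move: a0; rewrite -e map_f.
- by move: a0; rewrite e map_f.
- exact: IH.
Qed.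

Lemma weight_order_unmarked m y : unmarked y -> weight_order m y = 0 /\ mark_order y = 0.
Proof.
move=> uy; have Uy := unmarked_finite uy; have /andP[_ yn] := uy.
have h t : t \in ms -> mup y (level Ks y0 t.1) = 0%N.
  by move=> tm; apply: mup_level0 => //; apply: contraNneq yn => ->; apply: map_f.
rewrite /weight_order /mark_order mup_wronskian_unmarked // mulr0 add0r.
by split; rewrite big_seq big1 // => t /h ->; rewrite ?mulr0.
Qed.

Lemma weight_order_marked m t y : t \in ms -> U y -> J y = t.1 ->
  [/\ 0 <= weight_order m y, weight_order m y < t.2%:Z & mark_order y = t.2%:Z].
Proof.
move=> tm Uy Jy; have [st mt] := mark_stab tm Uy Jy.
have mo : mark_order y = t.2%:Z.
  rewrite -[RHS]mul1r -(sum_marks (fun=> 1) tm Uy Jy).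
  by apply: eq_bigr => s _; rewrite mul1r.
have t0 : (0 < t.2)%N by rewrite -st stab_gt0.
have wE : weight_order m y = ((- m) %% t.2)%Z.
  rewrite /weight_order (sum_marks (fun s => ceil_div m s.2 - m) tm Uy Jy).
  have -> : (mup y wronskian)%:Z = t.2%:Z - 1.
    by rewrite -st -mup_wronskian_stab // -addn1 PoszD addrK.
  have := divz_eq (- m) t.2; rewrite /ceil_div => E.
  by apply: (addrI (((- m) %/ t.2)%Z * t.2)); rewrite -E; ring.
by rewrite wE modz_ge0 ?ltz_pmod //; lia.
Qed.

(** At a marked point the order is a residue modulo the order of the stabiliser. *)
Lemma weight_order_ge0 m y : U y -> 0 <= weight_order m y.
Proof.
move=> Uy; have [uy|] := boolP (unmarked y).
  by have [-> _] := weight_order_unmarked m uy.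
rewrite /unmarked Uy /= negbK => /mapP[t tm Jy].
by have [] := weight_order_marked m tm Uy Jy.
Qed.

Lemma weight_gen_neq0 m x : unmarked x -> weight_gen m x != 0.
Proof.
move=> ux; rewrite mulf_neq0 ?expfz_neq0 ?dcoord_neq0 // prodf_seq_neq0; apply/allP => t tm.
by rewrite /= expfz_neq0 ?sub_mark_neq0.
Qed.

Lemma weight_gen_mob m h x : K h -> U x ->
  weight_gen m (mob h x) = (den h x ^+ 2) ^ m * weight_gen m x.
Proof.
move=> Kh Ux; rewrite /weight_gen dcoord_mob // expfzMl -mulrA; congr (_ * (_ * _)).
by apply: eq_bigr => t _; rewrite (qcoord_mob KG).
Qed.

(** All orders are nonnegative, so that the poles of the formula can be cancelled. *)
Lemma weight_gen_regular m : exists2 psi, regular Ks psi &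
  forall x, unmarked x -> psi x = weight_gen m x.
Proof.
have [A [D [A0 D0 hA oA]]] := order_weight_gen m.
have [|A1 [D1 [D10 E _]]] := @cancel_poles _ U A D D0.
  by move=> y Uy; left; have := weight_order_ge0 m Uy; rewrite -oA // subr_ge0 lez_nat.
exists (fun x => A1.[x] / D1.[x]); first by exists A1, D1.
by move=> x ux; have [_ d ->] := hA x ux; have [_ ->] := E x d.
Qed.

Lemma order_sum_le (a d p q b : nat) (o o' : int) :
  a%:Z - d%:Z = o -> p%:Z - q%:Z = o' ->
  (o <= o' -> (a + q <= b + d + p)%N) /\ (o < o' -> (a + q < b + d + p)%N).
Proof. by move=> <- <-; split; lia. Qed.

(** Dividing by [weight_gen m] gives an invariant with poles of order less than that of [J - z] at
the marked points; multiplied by [J - z] it is regular and vanishes there, so that it is a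
polynomial in [J] divisible by [J - z]. *)
Lemma weight_invariant m phi : regular Ks phi ->
  (forall h x, h \in Ks -> U x -> phi (mob h x) = (den h x ^+ 2) ^ m * phi x) ->
  exists a : {poly C}, forall x, unmarked x -> phi x = weight_gen m x * a.[J x].
Proof.
move=> [B [E [E0 hB]]] inv.
have [A [D [A0 D0 hA oA]]] := order_weight_gen m.
have [P [Q [P0 Q0 hP oP]]] := order_mark_prod.
have Em0 : E != 0 by apply: contraNneq (E0 _ Uy0) => ->; rewrite horner0.
have T0 : E * A * Q != 0 by rewrite !mulf_neq0.
have ord y : U y -> mup y (E * A * Q) = (mup y A + mup y Q)%N.
  by move=> Uy; rewrite !mupM ?mulf_neq0 // (mup_nonroot (E0 y Uy)).
have ord2 y : B != 0 ->
    mup y (B * D * P) = (mup y B + mup y D + mup y P)%N.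
  by move=> B0; rewrite !mupM ?mulf_neq0.
have [|A1 [D1 [D10 hA1 vA1]]] := @cancel_poles _ U (B * D * P) (E * A * Q) T0.
  move=> y Uy; have [->|B0] := eqVneq B 0; first by right; rewrite !mul0r.
  left; rewrite ord // ord2 //.
  have [le _] := order_sum_le (mup y B) (oA y Uy) (oP y Uy); apply: le.
  have [uy|] := boolP (unmarked y).
    by have [-> ->] := weight_order_unmarked m uy.
  rewrite /unmarked Uy /= negbK => /mapP[t tm Jy].
  by have [_ lt ->] := weight_order_marked m tm Uy Jy; apply: ltW.
pose psi x := A1.[x] / D1.[x].
have rpsi : regular Ks psi by exists A1, D1.
have psiE x : unmarked x ->
    psi x = phi x * (weight_gen m x)^-1 * \prod_(t <- ms) (J x - t.1).
  move=> ux; have Ux := unmarked_finite ux.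
  have [a d w] := hA x ux; have [p s pE] := hP x ux; have e0 := E0 x Ux.
  have T0x : (E * A * Q).[x] != 0 by rewrite !hornerM !mulf_neq0.
  rewrite /psi; have [_ ->] := hA1 x T0x.
  rewrite w pE hB // !hornerM; field.
  by rewrite e0 a d s.
have [|b hb] := invariant_poly KG Uy0 rpsi mark_form_neq0.
  move=> h x Kh Ux /(mark_formP Ux) ux; have Kh' := mem_signed Kh.
  rewrite !psiE ?unmarked_mob // inv // weight_gen_mob // (qcoord_mob KG) //.
  have [d0 _] := finite_mob KG Kh' Ux.
  by rewrite invfM mulrACA divff ?mul1r // expfz_neq0 // expf_neq0.
have /dvdpP[c bE] : \prod_(z <- unzip1 ms) ('X - z%:P) %| b.
  apply: uniq_roots_dvdp; last by rewrite uniq_rootsE.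
  apply/allP => _ /mapP[t tm ->]; have [y Uy [Jy _]] := ms_orbit tm.
  rewrite /root -Jy -hb // /psi vA1 ?mul0r //.
  have [->|B0] := eqVneq B 0; first by right; rewrite !mul0r.
  left; rewrite ord // ord2 //.
  have [_ lt] := order_sum_le (mup y B) (oA y Uy) (oP y Uy); apply: lt.
  by have [_ lt ->] := weight_order_marked m tm Uy Jy.
exists c => x ux; have Ux := unmarked_finite ux.
have p0 : \prod_(t <- ms) (J x - t.1) != 0.
  by rewrite prodf_seq_neq0; apply/allP => t tm; apply: sub_mark_neq0.
apply: (mulIf (invr_neq0 (weight_gen_neq0 m ux))); apply: (mulIf p0).
have -> : weight_gen m x * c.[J x] / weight_gen m x = c.[J x].
  by rewrite mulrAC divff ?mul1r ?weight_gen_neq0.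
rewrite -psiE // hb // bE hornerM big_map horner_prod; congr (_ * _).
by apply: eq_bigr => t _; rewrite hornerXsubC.
Qed.

End Weights.

(** * Vector-valued polynomials *)

Section VectorPolynomials.
Variables (R : realType) (V : vectType R[i]).
Local Notation C := R[i].

Lemma scaler_swap (a b : C) (v : V) : a *: (b *: v) = b *: (a *: v).
Proof. by rewrite !scalerA; congr (_ *: _); exact: mulrC. Qed.

Lemma endZ (f : 'End(V)) (a : C) (v : V) : f (a *: v) = a *: (f v : V).
Proof. exact: linearZ. Qed.

Lemma end0 (f : 'End(V)) : f 0 = 0 :> V. Proof. exact: linear0. Qed.

Lemma end_sum (f : 'End(V)) (I : Type) (s : seq I) (P : pred I) (F : I -> V) :
  f (\sum_(i <- s | P i) F i) = \sum_(i <- s | P i) (f (F i) : V).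
Proof. exact: linear_sum. Qed.

Lemma coord_inj (x y : V) :
  (forall j, coord (vbasis fullv) j x = coord (vbasis fullv) j y) -> x = y.
Proof.
move=> h; rewrite (coord_vbasis (memvf x)) (coord_vbasis (memvf y)).
by apply: eq_bigr => j _; rewrite h.
Qed.

(** A vector-valued polynomial is encoded by a list of terms, in which an exponent may occur
several times. *)
Implicit Types s : seq (nat * V).

Definition vsum s (c : C) : V := \sum_(t <- s) c ^+ t.1 *: t.2.
Definition vderiv1 s : V := \sum_(t <- s) t.1%:R *: t.2.
Definition vcoef s k : V := \sum_(t <- s | t.1 == k) t.2.
Definition vshift n s := [seq (t.1 + n, t.2)%N | t <- s].

Definition coord_poly (j : 'I_(\dim {:V})) s : {poly C} :=
  \sum_(t <- s) coord (vbasis fullv) j t.2 *: 'X^(t.1).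

Lemma coord_polyE j s c : (coord_poly j s).[c] = coord (vbasis fullv) j (vsum s c).
Proof.
rewrite horner_sum linear_sum /=; apply: eq_bigr => t _.
by rewrite hornerZ hornerXn linearZ /= mulrC.
Qed.

(** In coordinates the two sides are polynomials with the same values, hence the same coefficients
and the same derivative at [1]. *)
Lemma vsum_inj s1 s2 : (forall c, c != 0 -> vsum s1 c = vsum s2 c) ->
  (forall k, vcoef s1 k = vcoef s2 k) /\ vderiv1 s1 = vderiv1 s2.
Proof.
move=> s12; have E j : coord_poly j s1 = coord_poly j s2.
  apply: (poly_dense (e := 'X)) => [|c]; first by rewrite polyX_eq0.
  by rewrite hornerX => c0; rewrite !coord_polyE s12.
have kE j s k : coord (vbasis fullv) j (vcoef s k) = (coord_poly j s)`_k.
  rewrite linear_sum coef_sum /= big_mkcond /=; apply: eq_bigr => t _.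
  by rewrite coefZ coefXn eq_sym; case: eqP; rewrite ?mulr1 ?mulr0.
have dE j s : coord (vbasis fullv) j (vderiv1 s) = (coord_poly j s)^`().[1].
  rewrite linear_sum /= raddf_sum horner_sum /=; apply: eq_bigr => t _.
  by rewrite derivZ derivXn hornerZ hornerMn hornerXn expr1n linearZ /= mulrC.
by split=> [k|]; apply: coord_inj => j; rewrite ?kE ?dE E.
Qed.

Lemma vsum_coef s (f : nat -> C) : exists m, forall m', (m <= m')%N ->
  \sum_(t <- s) f t.1 *: t.2 = \sum_(k < m') f k *: vcoef s k.
Proof.
exists (\max_(t <- s) t.1).+1 => m' sm.
rewrite (eq_bigr (fun k : 'I_m' => \sum_(t <- s | t.1 == k) f k *: t.2)); last first.
  by move=> k _; rewrite scaler_sumr.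
rewrite (exchange_big_dep xpredT) //= big_seq [RHS]big_seq; apply: eq_bigr => t ts.
have tm : (t.1 < m')%N 
  by apply: leq_trans sm; rewrite ltnS; apply: (leq_bigmax_seq (F := fun t => t.1)).
by rewrite (big_pred1 (Ordinal tm)) // => k; rewrite /= -val_eqE eq_sym.
Qed.

Lemma vsum_cat s1 s2 c : vsum (s1 ++ s2) c = vsum s1 c + vsum s2 c.
Proof. by rewrite /vsum big_cat. Qed.

Lemma vsum_shift n s c : vsum (vshift n s) c = c ^+ n *: vsum s c.
Proof.
rewrite /vsum big_map scaler_sumr; apply: eq_bigr => t _ /=.
by rewrite scalerA exprD mulrC.
Qed.

Lemma vderiv1_cat s1 s2 : vderiv1 (s1 ++ s2) = vderiv1 s1 + vderiv1 s2.
Proof. by rewrite /vderiv1 big_cat. Qed.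

Lemma vderiv1_shift n s : vderiv1 (vshift n s) = vderiv1 s + n%:R *: vsum s 1.
Proof.
rewrite /vderiv1 big_map scaler_sumr -big_split /=; apply: eq_bigr => t _ /=.
by rewrite expr1n scale1r natrD scalerDl.
Qed.

Definition poly_terms (L : {poly C}) (y : V) : seq (nat * V) :=
  [seq (nat_of_ord i, L`_i *: y) | i : 'I_(size L)].

Lemma vsum_poly L y c : vsum (poly_terms L y) c = L.[c] *: y.
Proof.
rewrite /vsum big_map big_enum /= horner_coef scaler_suml; apply: eq_bigr => i _.
by rewrite scalerA mulrC.
Qed.

Lemma vderiv1_poly L y : vderiv1 (poly_terms L y) = L^`().[1] *: y.
Proof.
have -> : L^`() = (\sum_(i < size L) L`_i *: 'X^i)^`() by rewrite -poly_def coefK.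
rewrite raddf_sum horner_sum scaler_suml /vderiv1 big_map big_enum /=.
apply: eq_bigr => i _; rewrite scalerA derivZ derivXn hornerZ hornerMn hornerXn expr1n.
by rewrite mulrC.
Qed.

End VectorPolynomials.

(** * The diagonal torus of SL(2) *)

Section TorusCurve.
Variable R : realType.
Local Notation C := R[i].

Definition torus (c : C) : 'M[C]_2 := c *: delta_mx 0 0 + c^-1 *: delta_mx 1 1.

Lemma torusE c i j : torus c i j = if i == j then (if i == 0 then c else c^-1) else 0.
Proof.
rewrite !mxE.
by case: (ord2P i) => ->; case: (ord2P j) => -> /=; rewrite ?(mulr0, mulr1, add0r, addr0).
Qed.

Lemma torus_SL2 c : c != 0 -> isSL2 (torus c).
Proof. by move=> c0; rewrite /isSL2 det2E !torusE /= mulr0 subr0 divff. Qed.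

Lemma torusM c d : torus c *m torus d = torus (c * d).
Proof.
apply/matrixP => i j; rewrite mxE big_ord_recl big_ord1 !torusE.
have -> : lift ord0 ord0 = 1 :> 'I_2 by apply/val_inj.
by case: (ord2P i) => ->; case: (ord2P j) => -> /=; rewrite ?invfM ?(mulr0, mul0r, addr0, add0r).
Qed.

(** [L] is [F] along the curve [torus], cleared of denominators; the second condition computes the
derivative of [F] at the identity in the direction of the curve. *)
Definition torus_poly (F : {mpoly C[2 * 2]}) (N : nat) (L : {poly C}) :=
  (forall c, c != 0 -> L.[c] = c ^+ N * F.@[mxvec (torus c) 0]) /\
  L^`().[1] - N%:R * L.[1] =
  \sum_j (F^`M(j)).@[mxvec (1%:M : 'M[C]_2) 0] * mxvec (diag1N1 R) 0 j.

Lemma torus_one : torus 1 = 1%:M.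
Proof.
apply/matrixP => i j; rewrite torusE mxE invr1.
by case: (i == j) => //=; case: ifP.
Qed.

Lemma torus_poly1 F N L : torus_poly F N L -> L.[1] = F.@[mxvec (1%:M : 'M[C]_2) 0].
Proof. by case=> h _; rewrite h ?oner_eq0 // expr1n mul1r torus_one. Qed.

Lemma torus_poly_shift F N L k : torus_poly F N L -> torus_poly F (N + k) (L * 'X^k).
Proof.
move=> [h1 h2]; split=> [c c0|].
  by rewrite hornerM hornerXn h1 // exprD mulrAC.
rewrite -h2 derivM hornerD !hornerM derivXn hornerMn !hornerXn !expr1n.
by rewrite natrD; ring.
Qed.

Lemma torus_polyD F G N M L K : torus_poly F N L -> torus_poly G M K ->
  torus_poly (F + G) (N + M) (L * 'X^M + K * 'X^N).
Proof.
move=> /(torus_poly_shift M)[h1 h2] /(torus_poly_shift N)[k1 k2]; split=> [c c0|].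
  by rewrite hornerD h1 // k1 // addnC mevalD mulrDr.
rewrite derivD !hornerD mulrDr opprD addrACA h2 {1}[(N + M)%N]addnC k2 -big_split /=.
by apply: eq_bigr => j _; rewrite mderivD mevalD mulrDl.
Qed.

Lemma torus_polyM F G N M L K : torus_poly F N L -> torus_poly G M K ->
  torus_poly (F * G) (N + M) (L * K).
Proof.
move=> hF hG; have [h1 h2] := hF; have [k1 k2] := hG; split=> [c c0|].
  by rewrite hornerM h1 // k1 // exprD mevalM mulrACA.
transitivity ((L^`().[1] - N%:R * L.[1]) * K.[1] + (K^`().[1] - M%:R * K.[1]) * L.[1]).
  by rewrite derivM hornerD !hornerM natrD; ring.
rewrite h2 k2 (torus_poly1 hF) (torus_poly1 hG) !mulr_suml -big_split /=.
apply: eq_bigr => j _; rewrite mderivM mevalD !mevalM mulrDl.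
by rewrite [X in _ = X + _]mulrAC; congr (_ + _); rewrite -[RHS]mulrA [RHS]mulrC.
Qed.

Lemma torus_polyC (a : C) : torus_poly a%:MP 0 a%:P.
Proof.
split=> [c c0|]; first by rewrite hornerC mevalC mul1r.
rewrite derivC horner0 mul0r subr0 big1 // => j _.
by rewrite mderivC meval0 mul0r.
Qed.

Lemma torus_polyX k : exists N L, torus_poly 'X_k N L.
Proof.
have dX j : ('X_k : {mpoly C[2 * 2]})^`M(j) = (k == j)%:R%:MP.
  rewrite mderivX mnm1E; case: eqP => [->|_]; last by rewrite scale0r mpolyC0.
  have -> : (U_(j) - U_(j))%MM = 0%MM :> 'X_{1..2 * 2} by apply/mnmP => i; rewrite mnmBE subnn mnm0E.
  by rewrite scale1r mpolyX0 mpolyC1.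
have E : \sum_j ('X_k^`M(j)).@[mxvec (1%:M : 'M[C]_2) 0] * mxvec (diag1N1 R) 0 j
    = mxvec (diag1N1 R) 0 k.
  rewrite (bigD1 k) //= dX eqxx mevalC mul1r big1 ?addr0 // => j jk.
  by rewrite dX eq_sym (negPf jk) mevalC mul0r.
case/mxvec_indexP: k E {dX} => i j E.
have [ij|ij] := boolP (i == j); last first.
  exists 0%N, 0; split=> [c c0|]; rewrite ?E ?deriv0 ?horner0 ?mulr0 ?subr0.
    by rewrite mevalXU mxvecE torusE (negPf ij) mulr0.
  by rewrite mxvecE !mxE; move: ij; case: (ord2P i) => ->; case: (ord2P j) => -> //=; rewrite subr0.
case: (ord2P i) ij E => ->; case: (ord2P j) => -> //= _ E.
- exists 0%N, 'X; split=> [c c0|]; rewrite ?E.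
    by rewrite mevalXU mxvecE torusE /= hornerX mul1r.
  by rewrite derivX hornerC mxvecE !mxE /= mul0r !subr0.
- exists 1%N, 1; split=> [c c0|]; rewrite ?E.
    by rewrite mevalXU mxvecE torusE /= hornerC mulfV.
  by rewrite derivC horner0 hornerC mxvecE !mxE /= mulr1 sub0r.
Qed.

(** Such an [L] exists for the coordinates and for constants, and the property passes to products
by the Leibniz rule and to sums. *)
Lemma torus_poly_ex F : exists N L, torus_poly F N L.
Proof.
elim/mpolyind: F => [|a m p _ _ [N [L h]]].
  by exists 0%N, 0%:P; rewrite -mpolyC0; apply: torus_polyC.
suff [M [K k]] : exists M K, torus_poly 'X_[m] M K.
  exists (0 + M + N)%N, (a%:P * K * 'X^N + L * 'X^(0 + M)); apply: torus_polyD h.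
  by rewrite -mul_mpolyC; apply: torus_polyM k; apply: torus_polyC.
rewrite mpolyXE_id.
elim/big_ind: _ => [|p1 p2 [N1 [L1 h1]] [N2 [L2 h2]]|i _].
- by exists 0%N, 1%:P; rewrite -mpolyC1; apply: torus_polyC.
- by exists (N1 + N2)%N, (L1 * L2); apply: torus_polyM.
elim: (m i) => [|k [M [K hk]]].
  by exists 0%N, 1%:P; rewrite expr0 -mpolyC1; apply: torus_polyC.
have [M1 [K1 h1]] := torus_polyX i.
by exists (M1 + M)%N, (K1 * K); rewrite exprS; apply: torus_polyM.
Qed.

End TorusCurve.

(** * Weight spaces of an action of SL(2) *)

(** The powers of a single element of the torus, the one with entries [2] and [1 / 2], already
separate the weights. *)
Lemma pow2_inj (F : numFieldType) (a b : int) : (2%:R : F) ^ a = 2%:R ^ b -> a = b.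
Proof.
have c0 : (2%:R : F) != 0 by rewrite pnatr_eq0.
move=> E; apply/eqP; rewrite -subr_eq0; apply/eqP.
have : (2%:R : F) ^ (a - b) = 1 by rewrite expfzDr // E -expfzDr // subrr.
have pow n : (2%:R : F) ^+ n = 1 -> n = 0%N.
  rewrite -natrX => /eqP; rewrite -[X in _ == X]/(1%:R) eqr_nat -[X in _ == X](expn0 2).
  by rewrite eqn_exp2l // => /eqP.
case: (a - b) => n; first by move/pow ->.
by rewrite NegzE -exprnN => /eqP; rewrite invr_eq1 => /eqP /pow.
Qed.

Section Torus.
Variables (R : realType) (g : vectType R[i]) (br : lieBracket g).
Local Notation C := R[i].
Variable rb : 'M[C]_2 -> 'End(g).
Hypothesis rbA : is_SL2_action br rb.
Variable H : 'End(g).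
Hypothesis Hdiff : is_differential rb (diag1N1 R) H.
Implicit Types (x y z : g) (c d : C) (s : seq (nat * g)) (j : int).

Lemma rbM A B x : isSL2 A -> isSL2 B -> rb (A *m B) x = rb A (rb B x).
Proof. by case: rbA => _ hom _ sA sB; rewrite hom // comp_lfunE. Qed.

Lemma SL2_1 : isSL2 (1%:M : 'M[C]_2). Proof. exact: det1. Qed.

Lemma SL2M (A B : 'M[C]_2) : isSL2 A -> isSL2 B -> isSL2 (A *m B).
Proof. by move=> sA sB; rewrite /isSL2 det_mulmx sA sB mulr1. Qed.

Lemma rb1 x : rb 1%:M x = x.
Proof.
case: rbA => aut _ _; have [bij _] := aut _ SL2_1.
by apply: (bij_inj bij); rewrite -rbM ?mulmx1 //; apply: SL2_1.
Qed.

Lemma rb_inj A : isSL2 A -> injective (rb A).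
Proof. by case: rbA => aut _ _ /aut[/bij_inj]. Qed.

(** Along the torus the action is a Laurent polynomial, and [H] is its derivative at the
identity. *)
Lemma torus_expand x : exists N s,
  (forall c, c != 0 -> c ^+ N *: (rb (torus c) x : g) = vsum s c) /\
  H x = vderiv1 s - N%:R *: x.
Proof.
have [_ _ /(_ x)[s hs]] := rbA.
have Hx := Hdiff hs.
pose X c := \sum_(t <- s) t.1.@[mxvec (torus c) 0] *: t.2.
suff [N [s' [h1 h2]]] : exists N s', (forall c, c != 0 -> c ^+ N *: X c = vsum s' c) /\
    H x = vderiv1 s' - N%:R *: X 1.
  exists N, s'; split=> [c c0|]; first by rewrite hs ?h1 //; apply: torus_SL2.
  rewrite h2; congr (_ - _ *: _).
  by rewrite /X torus_one -hs ?rb1 //; apply: SL2_1.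
rewrite Hx {}/X; elim: s {hs Hx} => [|[F y] s [N [s' [h1 h2]]]].
  exists 0%N, [::]; split=> [c _|]; rewrite /vsum /vderiv1 !big_nil ?scaler0 //.
  by rewrite subr0.
have [M [L hL]] := torus_poly_ex F; have [l1 l2] := hL.
exists (N + M)%N, (vshift N (poly_terms L y) ++ vshift M s'); split=> [c c0|].
  rewrite vsum_cat !vsum_shift vsum_poly l1 // -h1 // big_cons /= scalerDr !scalerA.
  by rewrite mulrA -!exprD addnC.
rewrite !big_cons /= -l2 h2 vderiv1_cat !vderiv1_shift vsum_poly vderiv1_poly.
rewrite -h1 ?oner_eq0 // expr1n scale1r torus_one -(torus_poly1 hL).
set S := \sum_(t <- s) _; apply: coord_inj => k.
pose f : g -> C := coord (vbasis {:g}) k; rewrite -/f.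
have fD a b : f (a + b) = f a + f b by rewrite /f linearD.
have fN a : f (- a) = - f a by rewrite /f linearN.
have fZ c a : f (c *: a) = c * f a by rewrite /f linearZ.
by rewrite natrD !(fD, fN, fZ); ring.
Qed.

(** Replace [c] by [d * c] and compare the coefficients of the powers of [c]. *)
Lemma torus_terms x N s k d : d != 0 ->
  (forall c, c != 0 -> c ^+ N *: (rb (torus c) x : g) = vsum s c) ->
  d ^+ N *: (rb (torus d) (vcoef s k) : g) = d ^+ k *: vcoef s k.
Proof.
move=> d0 hs.
pose s1 := [seq (t.1, d ^+ N *: (rb (torus d) t.2 : g)) | t <- s].
pose s2 := [seq (t.1, d ^+ t.1 *: t.2) | t <- s].
have [|E _] := @vsum_inj _ _ s1 s2.
  move=> c c0; rewrite /s1 /s2 /vsum !big_map /=.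
  have := hs (d * c) (mulf_neq0 d0 c0).
  rewrite -torusM rbM; try exact: torus_SL2.
  rewrite exprMn -scalerA.
  have <- : rb (torus d) (c ^+ N *: (rb (torus c) x : g)) = c ^+ N *: (rb (torus d) (rb (torus c) x) : g).
    by rewrite endZ.
  rewrite hs // /vsum end_sum scaler_sumr => E.
  transitivity (\sum_(t <- s) d ^+ N *: (rb (torus d) (c ^+ t.1 *: t.2) : g)).
    apply: eq_bigr => t _; rewrite [in RHS]endZ !scalerA; congr (_ *: _); exact: mulrC.
  rewrite E; apply: eq_bigr => t _.
  rewrite exprMn !scalerA; congr (_ *: _); exact: mulrC.
have := E k; rewrite /vcoef /s1 /s2 !big_map /= => {}E.
rewrite end_sum scaler_sumr E scaler_sumr.
by apply: eq_bigr => t /eqP ->.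
Qed.

(** Compare the derivatives at the identity of the two expressions of the orbit of [y] under the
torus. *)
Lemma torus_eigen y N k : (forall d, d != 0 -> d ^+ N *: (rb (torus d) y : g) = d ^+ k *: y) ->
  H y = (k%:R - N%:R) *: y.
Proof.
move=> hy; have [M [s [h1 h2]]] := torus_expand y.
have [|_ E] := @vsum_inj _ _ [:: ((M + k)%N, y)] (vshift N s).
  move=> c c0; rewrite vsum_shift -h1 // scalerA mulrC -scalerA hy //.
  by rewrite /vsum big_seq1 exprD -scalerA.
move: E; rewrite vderiv1_shift -h1 ?oner_eq0 // expr1n scale1r torus_one rb1 h2.
rewrite {1}/vderiv1 big_seq1 /= => E; apply: (addIr (N%:R *: y)).
rewrite addrAC -E -scalerBl -scalerDl; congr (_ *: _).
by rewrite natrD; ring.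
Qed.

(** The coefficients of the orbit of [x] under the torus are weight vectors, whose sum is the
value at the identity. *)
Lemma weight_split x : exists N m (a : nat -> g), [/\ x = \sum_(k < m) a k,
  forall k, H (a k) = (k%:Z - N%:Z)%:~R *: a k &
  forall k c, c != 0 -> c ^+ N *: (rb (torus c) (a k) : g) = c ^+ k *: a k].
Proof.
have [N [s [h1 _]]] := torus_expand x.
have [m hm] := vsum_coef s (fun=> 1); exists N, m, (vcoef s); split.
- have := h1 1; rewrite oner_eq0 => /(_ isT); rewrite expr1n scale1r torus_one rb1 => ->.
  rewrite /vsum; under eq_bigr do rewrite expr1n.
  by rewrite (hm m) //; apply: eq_bigr => k _; rewrite scale1r.
- move=> k; rewrite (@torus_eigen _ N k) => [|d d0]; last exact: torus_terms d0 h1.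
  by rewrite rmorphB.
- by move=> k c c0; apply: torus_terms c0 h1.
Qed.

(** Apply the torus: the vectors are the coefficients of a polynomial that vanishes
identically. *)
Lemma weight_indep N m (u : nat -> g) :
  (forall k c, c != 0 -> c ^+ N *: (rb (torus c) (u k) : g) = c ^+ k *: u k) ->
  \sum_(k < m) u k = 0 -> forall k, (k < m)%N -> u k = 0.
Proof.
move=> hu u0 k km; have io : iota 0 m = index_iota 0 m by rewrite /index_iota subn0.
pose s := [seq (i, u i) | i <- iota 0 m].
have [|E _] := @vsum_inj _ _ s [::].
  move=> c c0; rewrite /vsum big_nil big_map /= io big_mkord; under eq_bigr do rewrite -hu //.
  by rewrite -scaler_sumr -end_sum u0 end0 scaler0.
have := E k; rewrite /vcoef big_nil big_map /= io.
by rewrite big_mkord (big_pred1 (Ordinal km)).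
Qed.

Lemma eigen_terms N m (a : nat -> g) (f : int -> C) :
  (forall k, H (a k) = (k%:Z - N%:Z)%:~R *: a k) ->
  (forall k c, c != 0 -> c ^+ N *: (rb (torus c) (a k) : g) = c ^+ k *: a k) ->
  \sum_(k < m) f (k%:Z - N%:Z) *: a k = 0 ->
  forall k, (k < m)%N -> f (k%:Z - N%:Z) = 0 \/ a k = 0.
Proof.
move=> Ha ta fa k km.
have hu i c : c != 0 -> c ^+ N *: (rb (torus c) (f (i%:Z - N%:Z) *: a i) : g) =
    c ^+ i *: (f (i%:Z - N%:Z) *: a i).
  by move=> c0; rewrite endZ scaler_swap ta // scaler_swap.
have /eqP := weight_indep hu fa km.
by rewrite scaler_eq0 => /orP[]/eqP; [left|right].
Qed.

Lemma eigen_torus y j c : c != 0 -> H y = j%:~R *: y -> rb (torus c) y = c ^ j *: y.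
Proof.
move=> c0 Hy; have [N [m [a [yE Ha ta]]]] := weight_split y.
have z0 : \sum_(k < m) ((k%:Z - N%:Z)%:~R - j%:~R) *: a k = 0.
  under eq_bigr do rewrite scalerBl -Ha.
  by rewrite sumrB -end_sum -scaler_sumr -yE Hy subrr.
rewrite yE end_sum scaler_sumr /=; apply: eq_bigr => k _.
have [/eqP|->] := eigen_terms (f := fun i => i%:~R - j%:~R) Ha ta z0 (ltn_ord k); last first.
  by rewrite end0 scaler0.
rewrite subr_eq0 eqr_int => /eqP <-.
have cN : c ^+ N != 0 by rewrite expf_neq0.
apply: (scalerI cN); rewrite ta // scalerA; congr (_ *: _).
by rewrite -[c ^+ N]/(c ^ N%:Z) -expfzDr // addrC subrK.
Qed.

Lemma torus_eigenz y j : (forall c, c != 0 -> rb (torus c) y = c ^ j *: y) -> H y = j%:~R *: y.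
Proof.
move=> hy; have [N [m [a [yE Ha ta]]]] := weight_split y.
have c0 : 2%:R != 0 :> C by rewrite pnatr_eq0.
have cN : 2%:R ^+ N != 0 :> C by rewrite expf_neq0.
have ta2 k : rb (torus 2%:R) (a k) = 2%:R ^ (k%:Z - N%:Z) *: a k.
  apply: (scalerI cN); rewrite ta // scalerA; congr (_ *: _).
  by rewrite -[_ ^+ N]/(_ ^ N%:Z) -expfzDr // addrC subrK.
have z0 : \sum_(k < m) (2%:R ^ (k%:Z - N%:Z) - 2%:R ^ j) *: a k = 0.
  under eq_bigr do rewrite scalerBl -ta2.
  by rewrite sumrB -end_sum -scaler_sumr -yE hy // subrr.
rewrite yE end_sum scaler_sumr /=; apply: eq_bigr => k _.
have [/eqP|->] := eigen_terms (f := fun i => 2%:R ^ i - 2%:R ^ j) Ha ta z0 (ltn_ord k); last first.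
  by rewrite end0 scaler0.
rewrite subr_eq0 => /eqP E0.
by rewrite Ha (pow2_inj E0).
Qed.

(** [H] is diagonalisable, because it acts by integers on the weight vectors of the torus. *)
Lemma eigen_semisimple y (l : C) n :
  iter n (fun z => H z - l *: z) y = 0 -> H y = l *: y.
Proof.
have [N [m [a [yE Ha ta]]]] := weight_split y.
have E : iter n (fun z => H z - l *: z) y =
    \sum_(k < m) ((k%:Z - N%:Z)%:~R - l) ^+ n *: a k.
  elim: n => [|n IH]; first by rewrite /= {1}yE; apply: eq_bigr => k _; rewrite scale1r.
  rewrite iterS IH end_sum scaler_sumr -sumrB; apply: eq_bigr => k _.
  by rewrite endZ Ha !scalerA -scalerBl exprSr; congr (_ *: _); ring.
rewrite E => z0; apply/eqP; rewrite -subr_eq0; apply/eqP.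
rewrite yE end_sum scaler_sumr -sumrB big1 // => k _.
have [|->] := eigen_terms (f := fun i => (i%:~R - l) ^+ n) Ha ta z0 (ltn_ord k); last first.
  by rewrite end0 scaler0 subrr.
move/eqP; rewrite expf_eq0 => /andP[_]; rewrite subr_eq0 => /eqP <-.
by rewrite Ha subrr.
Qed.

Definition weyl : 'M[C]_2 := delta_mx 0 1 - delta_mx 1 0.

Lemma weyl_SL2 : isSL2 weyl.
Proof. by rewrite /isSL2 det2E !mxE /=; ring. Qed.

Lemma torus_weyl c : torus c *m weyl = weyl *m torus c^-1.
Proof.
apply/matrixP => i j; rewrite !mxE !big_ord_recl !big_ord0 !torusE invrK.
have -> : lift ord0 ord0 = 1 :> 'I_2 by apply/val_inj.
by case: (ord2P i) => ->; case: (ord2P j) => -> /=; rewrite !mxE /=; ring.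
Qed.

(** Conjugation by the Weyl element inverts the torus. *)
Lemma eigen_weyl y j : H y = j%:~R *: y -> H (rb weyl y) = (- j)%:~R *: (rb weyl y : g).
Proof.
move=> Hy; apply: torus_eigenz => c c0.
have c1 : c^-1 != 0 by rewrite invr_eq0.
rewrite -(rbM _ (torus_SL2 c0) weyl_SL2) torus_weyl (rbM _ weyl_SL2 (torus_SL2 c1)).
by rewrite (eigen_torus c1 Hy) endZ exprz_inv.
Qed.

(** ** Weight projections *)

Variable B : nat.
Hypothesis wt_le : forall y j, y != 0 -> H y = j%:~R *: y -> (j <= B%:Z)%R.

(** The Weyl element turns the upper bound into a lower one. *)
Lemma wt_bound y j : y != 0 -> H y = j%:~R *: y -> (`|j|%N <= B)%N.
Proof.
move=> y0 Hy; have := wt_le y0 Hy.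
have w0 : rb weyl y != 0.
  by apply: contraNneq y0 => h; apply/eqP/(rb_inj weyl_SL2); rewrite h end0.
by have := wt_le w0 (eigen_weyl Hy); lia.
Qed.

Definition wts : seq int := [seq k%:Z - B%:Z | k <- iota 0 B.*2.+1].

Lemma wts_uniq : uniq wts.
Proof. by rewrite map_inj_uniq ?iota_uniq // => i j; lia. Qed.

Lemma mem_wts j : (j \in wts) = (`|j|%N <= B)%N.
Proof.
apply/mapP/idP => [[k]|jB]; first by rewrite mem_iota; lia.
by exists (`|(j + B%:Z)%R|%N); rewrite ?mem_iota; lia.
Qed.

(** The Lagrange interpolation polynomial at the weights, evaluated at [H]. *)
Definition wt_proj j : 'End(g) :=
  foldr (fun i f => ((j - i)%:~R^-1 *: (H - i%:~R *: \1) \o f)%VF) \1%VF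
    [seq i <- wts | i != j].

Lemma wt_proj_eigen x j k : H x = k%:~R *: x -> k \in wts ->
  wt_proj j x = if k == j then x else 0.
Proof.
move=> Hx kw; rewrite /wt_proj.
have E (l : seq int) :
    foldr (fun i f => ((j - i)%:~R^-1 *: (H - i%:~R *: \1) \o f)%VF) \1%VF l x =
    (\prod_(i <- l) ((j - i)%:~R^-1 * (k - i)%:~R)) *: x.
  elim: l => [|i l IH] /=; first by rewrite big_nil scale1r id_lfunE.
  rewrite comp_lfunE IH endZ scale_lfunE add_lfunE opp_lfunE scale_lfunE id_lfunE Hx.
  by rewrite big_cons rmorphB /= -scalerBl !scalerA; congr (_ *: _); ring.
rewrite E; have [->|kj] := eqVneq k j.
  rewrite big_filter big_seq_cond big1 ?scale1r // => i /andP[_ ij].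
  by rewrite mulVf // intr_eq0 subr_eq0 eq_sym.
have -> : \prod_(i <- [seq i <- wts | i != j]) ((j - i)%:~R^-1 * (k - i)%:~R) = 0 :> C.
  apply/eqP; rewrite prodf_seq_eq0; apply/hasP; exists k.
    by rewrite mem_filter kj.
  by rewrite /= subrr mulr0.
by rewrite scale0r.
Qed.

Lemma wt_split x : exists N m (a : nat -> g), x = \sum_(k < m) a k /\
  forall k : nat, H (a k) = (k%:Z - N%:Z)%:~R *: a k /\
    (k%:Z - N%:Z \in wts \/ a k = 0).
Proof.
have [N [m [a [xE Ha _]]]] := weight_split x; exists N, m, a; split=> // k; split=> //.
have [->|a0] := eqVneq (a k) 0; first by right.
by left; rewrite mem_wts (wt_bound a0 (Ha k)).
Qed.

Lemma wt_proj_sum x : x = \sum_(j <- wts) (wt_proj j x : g).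
Proof.
have [N [m [a [xE Ha]]]] := wt_split x.
rewrite xE; under [RHS]eq_bigr do rewrite end_sum.
rewrite exchange_big /=; apply: eq_bigr => k _.
have [Hk [kw|->]] := Ha k; last by rewrite big1 // => j _; rewrite end0.
rewrite (bigD1_seq _ kw wts_uniq) /= (wt_proj_eigen _ Hk kw) eqxx big1 ?addr0 // => j jk.
by rewrite (wt_proj_eigen _ Hk kw) eq_sym (negPf jk).
Qed.

Lemma wt_projP j x : H (wt_proj j x) = j%:~R *: (wt_proj j x : g).
Proof.
have [N [m [a [-> Ha]]]] := wt_split x.
rewrite !end_sum scaler_sumr /=; apply: eq_bigr => k _.
have [Hk [kw|->]] := Ha k; last by rewrite !end0 scaler0.
rewrite (wt_proj_eigen _ Hk kw); case: eqP => [<- //|_].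
by rewrite end0 scaler0.
Qed.

Lemma rb_torus c x : c != 0 -> rb (torus c) x = \sum_(j <- wts) c ^ j *: (wt_proj j x : g).
Proof.
move=> c0; rewrite {1}[x]wt_proj_sum end_sum; apply: eq_bigr => j _.
by apply: eigen_torus => //; apply: wt_projP.
Qed.

Lemma wt_proj_torus c x j : c != 0 -> wt_proj j (rb (torus c) x) = c ^ j *: (wt_proj j x : g).
Proof.
move=> c0; have [N [m [a [-> Ha]]]] := wt_split x.
rewrite !end_sum scaler_sumr /=; apply: eq_bigr => k _.
have [Hk [kw|->]] := Ha k; last by rewrite !end0 scaler0.
rewrite (eigen_torus c0 Hk) endZ (wt_proj_eigen _ Hk kw).
by case: eqP => [-> //|_]; rewrite !scaler0.
Qed.

End Torus.

(** * Weights and roots *)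

Section LieWeights.
Variables (R : realType) (g : vectType R[i]) (br : lieBracket g).
Local Notation C := R[i].
Implicit Types (x y z t : g) (c l : C) (W h : {vspace g}).

Lemma br_suml (I : Type) (s : seq I) (F : I -> g) x :
  br (\sum_(i <- s) F i) x = \sum_(i <- s) br (F i) x.
Proof.
have D a b : br (a + b) x = br a x + br b x by rewrite -[a]scale1r lie_linearl !scale1r.
have Z : br 0 x = 0 by apply: (addrI (br 0 x)); rewrite -D !addr0.
by elim: s => [|i s IH]; rewrite ?big_nil // !big_cons D IH.
Qed.

Lemma br_sumr (I : Type) (s : seq I) (F : I -> g) x :
  br x (\sum_(i <- s) F i) = \sum_(i <- s) br x (F i).
Proof.
have D a b : br x (a + b) = br x a + br x b by rewrite -[a]scale1r lie_linearr !scale1r.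
have Z : br x 0 = 0 by apply: (addrI (br x 0)); rewrite -D !addr0.
by elim: s => [|i s IH]; rewrite ?big_nil // !big_cons D IH.
Qed.

Lemma br0r x : br x 0 = 0.
Proof. by have := @br_sumr nat [::] (fun=> 0) x; rewrite !big_nil. Qed.

Lemma br0l x : br 0 x = 0.
Proof. by have := @br_suml nat [::] (fun=> 0) x; rewrite !big_nil. Qed.

Lemma brZr c x y : br x (c *: y) = c *: br x y.
Proof. by have := lie_linearr br c y 0 x; rewrite br0r !addr0. Qed.

Lemma brZl c x y : br (c *: x) y = c *: br x y.
Proof. by have := lie_linearl br c x 0 y; rewrite br0l !addr0. Qed.

Lemma brC x y : br x y = - br y x.
Proof.
have := lie_alt br (1 *: x + y).
rewrite lie_linearl !lie_linearr !lie_alt !scale1r add0r addr0 => /eqP.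
by rewrite addr_eq0 => /eqP.
Qed.

Lemma br_br t z x : br (br t z) x = br t (br z x) - br z (br t x).
Proof.
have := lie_jacobi br t z x; rewrite (brC z (br x t)) (brC x t) (brC x (br t z)) => /eqP.
have -> : br (- br t x) z = - br (br t x) z by rewrite -scaleN1r brZl scaleN1r.
rewrite opprK (brC (br t x) z) => /eqP/(canRL (addrK _)).
by rewrite add0r opprK => <-.
Qed.

Definition stable h W := forall t x, t \in h -> x \in W -> br t x \in W.

Section Matrices.
Variables (W : {vspace g}).
Local Notation X := (vbasis W).

Definition ad_mx z : 'M[C]_(\dim W) := \matrix_(i, j) coord X j (br z X`_i).

Lemma ad_mxE z (i : 'I_(\dim W)) : (forall x, x \in W -> br z x \in W) ->
  br z X`_i = \sum_j ad_mx z i j *: X`_j.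
Proof.
move=> zW; have WX : X`_i \in W by rewrite vbasis_mem // mem_nth // size_tuple.
rewrite {1}(coord_vbasis (zW _ WX)); apply: eq_bigr => j _; by rewrite mxE.
Qed.

Lemma ad_mx_sum z (v : 'rV[C]_(\dim W)) : (forall x, x \in W -> br z x \in W) ->
  br z (\sum_i v 0 i *: X`_i) = \sum_j (v *m ad_mx z) 0 j *: X`_j.
Proof.
move=> zW; rewrite br_sumr; under eq_bigr do rewrite brZr ad_mxE // scaler_sumr.
rewrite exchange_big /=; apply: eq_bigr => j _; rewrite mxE scaler_suml.
by apply: eq_bigr => i _; rewrite scalerA.
Qed.

Lemma ad_eigen z : W != 0%VS -> (forall x, x \in W -> br z x \in W) ->
  exists l x, [/\ x \in W, x != 0 & br z x = l *: x].
Proof.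
move=> W0 zW; have d0 : (0 < \dim W)%N by rewrite lt0n dimv_eq0.
have /closed_rootP[a ra] : size (char_poly (ad_mx z)) != 1%N.
  by rewrite size_char_poly eqSS -lt0n.
have /eigenvalueP[v vA v0] : eigenvalue (ad_mx z) a by rewrite eigenvalue_root_char.
exists a, (\sum_i v 0 i *: X`_i); split.
- apply: memv_suml => i _; apply: memvZ; rewrite vbasis_mem // mem_nth // size_tuple //.
- apply: contraNneq v0 => x0; apply/eqP/rowP => i; rewrite mxE.
  have fX : free X := basis_free (vbasisP W).
  by rewrite -(coord_sum_free (fun i => v 0 i) i fX) x0 linear0.
- rewrite ad_mx_sum // vA scaler_sumr; apply: eq_bigr => i _.
  by rewrite mxE scalerA.
Qed.

(** A commutator has trace zero, so that the only scalar it can be is zero. *)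
Lemma scalar_commutator t z c : W != 0%VS ->
  (forall x, x \in W -> br t x \in W) -> (forall x, x \in W -> br z x \in W) ->
  (forall x, x \in W -> br (br t z) x = c *: x) -> c = 0.
Proof.
move=> W0 tW zW tzc.
have E : c%:M = ad_mx z *m ad_mx t - ad_mx t *m ad_mx z.
  apply/matrixP => i j.
  have WX : X`_i \in W by rewrite vbasis_mem // mem_nth // size_tuple.
  have fX : free X := basis_free (vbasisP W).
  have h u w : (forall x, x \in W -> br u x \in W) -> (forall x, x \in W -> br w x \in W) ->
      coord X j (br u (br w X`_i)) = (ad_mx w *m ad_mx u) i j.
    move=> uW wW; rewrite (ad_mxE i wW).
    have -> : \sum_j ad_mx w i j *: X`_j = \sum_j row i (ad_mx w) 0 j *: X`_j.
      by apply: eq_bigr => k _; rewrite [in RHS]mxE.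
    by rewrite ad_mx_sum // -row_mul (coord_sum_free (fun j => row i _ 0 j) j fX) mxE.
  have -> : (ad_mx z *m ad_mx t - ad_mx t *m ad_mx z) i j =
      (ad_mx z *m ad_mx t) i j - (ad_mx t *m ad_mx z) i j by rewrite !mxE.
  rewrite mxE -(h t z) // -(h z t) // -linearB /= -br_br tzc // linearZ /= coord_free //.
  by rewrite mulr_natr.
have := congr1 mxtrace E; rewrite linearB /= mxtrace_mulC subrr mxtrace_scalar => /eqP.
by rewrite mulrn_eq0 dimv_eq0 (negPf W0) => /eqP.
Qed.

End Matrices.

(** On an irreducible module the successive centralisers of a nilpotent algebra act by scalars: an
element whose brackets with the algebra are scalars has these scalars zero, so that its
eigenspaces are submodules. *)
Lemma nilpotent_eigenvector h W :
  (exists n : nat, forall (s : seq g) y,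
     size s = n -> {subset s <= h} -> y \in h -> foldr br y s = 0) ->
  (forall x y, x \in h -> y \in h -> br x y \in h) ->
  stable h W -> W != 0%VS ->
  exists x, [/\ x \in W, x != 0 & forall t, t \in h -> exists c, br t x = c *: x].
Proof.
move=> [n nil] hh; have [m] := ubnP (\dim W); elim: m => // m IH in W *.
rewrite ltnS => dW sW W0.
have [[W' [W'W sW' W'0 nW']]|irr] := pselect (exists W' : {vspace g},
    [/\ (W' <= W)%VS, stable h W', W' != 0%VS & W' != W]).
  have [||//|x [xW' x0 hx]] := IH W'.
  - apply: leq_trans dW; rewrite ltn_neqAle dimvS // andbT.
    by apply: contra nW' => /eqP e; rewrite eqEdim W'W e leqnn.
  - by [].
  by exists x; split=> //; apply: (subvP W'W).
suff scal j z : z \in h ->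
    (forall s, size s = j -> {subset s <= h} -> foldr br z s = 0) ->
    exists c, forall x, x \in W -> br z x = c *: x.
  have [x xW x0] : exists2 x, x \in W & x != 0.
    by exists (vpick W); rewrite ?memv_pick // vpick0.
  exists x; split=> // t th; have [|c hc] := scal n t th.
    by move=> s sn sh; apply: nil.
  by exists c; apply: hc.
elim: j z => [|j IHj] z zh zs.
  by exists 0 => x _; rewrite scale0r (_ : z = 0) ?br0l //; apply: (zs [::]).
have comm t x : t \in h -> x \in W -> br t (br z x) = br z (br t x).
  move=> th xW; have [|c hc] := IHj (br t z) (hh _ _ th zh).
    move=> s sj sh; rewrite -foldr_rcons; apply: zs; first by rewrite size_rcons sj.
    by move=> y; rewrite mem_rcons in_cons => /predU1P[->|/sh].
  have c0 : c = 0 by apply: (@scalar_commutator W t z c) => // y; apply: sW.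
  have := hc _ xW; rewrite c0 scale0r br_br => /eqP; rewrite subr_eq0 => /eqP //.
have [l [x0 [x0W x00 hx0]]] := @ad_eigen W z W0 (fun y => sW z y zh).
pose f (x : g) := br z x - l *: x.
have flin : linear f.
  move=> a x y; rewrite /f lie_linearr scalerDr scalerBr !scalerA mulrC.
  by rewrite opprD addrACA.
pose F : {linear g -> g} := HB.pack f (GRing.isLinear.Build _ _ _ _ f flin).
pose W' := (W :&: lker (linfun F))%VS.
have inW' x : (x \in W') = (x \in W) && (br z x == l *: x).
  by rewrite memv_cap memv_ker lfunE /= /f subr_eq0.
have W'E : W' = W.
  apply/eqP/negPn/negP => nW'; apply: irr; exists W'; split=> //.
  - exact: capvSl.
  - move=> t x th; rewrite !inW' => /andP[xW /eqP zx]; rewrite sW //=.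
    by rewrite -comm // zx brZr.
  - apply: contraNneq x00 => W'0; rewrite -memv0 -W'0 inW' x0W hx0 eqxx //.
by exists l => x; rewrite -{1}W'E inW' => /andP[_ /eqP].
Qed.

Section Grading.
Variables (H : 'End(g)) (D : dynkin_grading br H).
Hypothesis Hss : forall x l n, iter n (fun z => H z - l *: z) x = 0 -> H x = l *: x.
Local Notation h := (dg_h D).
Local Notation t0 := (dg_t0 D).

(** For [t] in the Cartan subalgebra and [x] in the eigenspace, [H - l] acts on [br t x] through
iterated brackets of [t] with [t0], which vanish eventually; as [H] is semisimple, the generalised
eigenvector [br t x] is an eigenvector. *)
Lemma eigenspace_stable l : stable h (lker (H - l *: \1)%VF).
Proof.
have inE x : (x \in lker (H - l *: \1)%VF) = (H x == l *: x).
  by rewrite memv_ker add_lfunE opp_lfunE scale_lfunE id_lfunE subr_eq0.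
have [hh [n nil] _] := dg_cartan D.
move=> t x th; rewrite !inE => /eqP Hx; apply/eqP/(Hss (n := n)).
have E j : iter j (fun z => H z - l *: z) (br t x) =
    br (foldr br t (nseq j (vsval t0))) x.
  elim: j => [//|j IH]; rewrite iterS IH /= br_br -!(dg_ad D) Hx brZr.
  by [].
rewrite E nil ?size_nseq ?br0l // => u; rewrite mem_nseq => /andP[_ /eqP ->].
exact: subvsP.
Qed.

(** A common eigenvector of the Cartan subalgebra in the eigenspace is a root vector, and its root
takes the value [l] at [t0]. *)
Lemma eigenvalue_root x l : x != 0 -> H x = l *: x -> l != 0 ->
  exists2 a, is_root br (h := h) a & a t0 = l.
Proof.
move=> x0 Hx l0; have [hh nil _] := dg_cartan D.
have [|y [yW y0 hy]] := nilpotent_eigenvector nil hh (@eigenspace_stable l).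
  apply: contraNneq x0 => W0; rewrite -memv0 -W0.
  by rewrite memv_ker add_lfunE opp_lfunE scale_lfunE id_lfunE Hx subrr.
have Hy : H y = l *: y.
  by apply/eqP; move: yW; rewrite memv_ker add_lfunE opp_lfunE scale_lfunE id_lfunE subr_eq0.
have [j yj] : exists j, coord (vbasis fullv) j y != 0.
  apply/existsP; apply: contraNT y0; rewrite negb_exists => /forallP h0.
  by apply/eqP/coord_inj => j; rewrite linear0; apply/eqP/negPn/h0.
pose f (t : subvs_of h) : C^o := coord (vbasis fullv) j (br (vsval t) y) / coord (vbasis fullv) j y.
have flin : linear f.
  move=> c t u; rewrite /f !linearP /= lie_linearl linearP /=.
  by rewrite mulrDl -mulrA.
pose F : {linear subvs_of h -> C^o} := HB.pack f (GRing.isLinear.Build _ _ _ _ f flin).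
have hF (t : subvs_of h) : br (vsval t) y = F t *: y.
  have [c hc] := hy _ (subvsP t).
  by rewrite /F /= /f hc linearZ /= mulfK.
have Ft0 : F t0 = l.
  apply/eqP; rewrite -subr_eq0; have /eqP : (F t0 - l) *: y = 0.
    by rewrite scalerBl -hF -(dg_ad D) Hy subrr.
  by rewrite scaler_eq0 (negPf y0) orbF.
exists (linfun F); last by rewrite lfunE.
split; last by exists y => // t; rewrite lfunE hF.
by apply: contraNneq l0 => F0; rewrite -Ft0 -[F _](lfunE F) F0 zero_lfunE.
Qed.

Lemma nat_comb_label a : nat_comb (dg_base D) a -> exists n : nat, a t0 = n%:R.
Proof.
case=> c ->; rewrite sum_lfunE.
elim/big_ind: _ => [|u v [n ->] [m ->]|i _]; first by exists 0%N.
  by exists (n + m)%N; rewrite natrD.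
have -> : ((dg_base D)`_i *+ c i) t0 = (dg_base D)`_i t0 *+ c i.
  by elim: (c i) => [|k IH]; rewrite ?mulr0n ?zero_lfunE // !mulrS add_lfunE IH.
have := dg_labels (mem_nth 0 (ltn_ord i)).
case=> ->; [exists 0%N|exists (c i)|exists (2 * c i)%N]; rewrite ?mul0rn //.
by rewrite natrM mulr_natr.
Qed.

(** A nonzero eigenvalue is the value of a root, and the highest root exceeds it by a sum of
simple roots, which have nonnegative labels. *)
Lemma eigenvalue_top x l : x != 0 -> H x = l *: x -> exists n : nat, (dg_top D)%:R = l + n%:R.
Proof.
move=> x0 Hx; have [->|l0] := eqVneq l 0; first by exists (dg_top D); rewrite add0r.
have [a ra <-] := eigenvalue_root x0 Hx l0.
have [_ /(_ a ra)/nat_comb_label[n]] := dg_highestP D.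
rewrite add_lfunE opp_lfunE (dg_topP D) => /(canRL (subrK _)) E.
by exists n; rewrite addrC -E.
Qed.

Lemma top_eigen : exists2 x, x != 0 & H x = (dg_top D)%:R *: x.
Proof.
have [[_ [x x0 hx]] _] := dg_highestP D; exists x => //.
by rewrite (dg_ad D) hx (dg_topP D).
Qed.

End Grading.
End LieWeights.

(** * The double cover of the rotation group *)

Section Cover.
Local Open Scope sesquilinear_scope.
Variable R : realType.
Local Notation C := R[i].
Local Notation cover := Defs.cover.
Implicit Types (u v Y : 'M[C]_2) (i j k : 'I_3).

Definition o0 : 'I_3 := inord 0.
Definition o1 : 'I_3 := inord 1.
Definition o2 : 'I_3 := inord 2.

Lemma ord3P i : [\/ i = o0, i = o1 | i = o2].
Proof.
by case: i => [[|[|[|//]]] Hi]; [apply: Or31|apply: Or32|apply: Or33];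
  apply/val_inj; rewrite /= inordK.
Qed.

Lemma sum3 (V : nmodType) (F : 'I_3 -> V) : \sum_i F i = F o0 + F o1 + F o2.
Proof.
rewrite !big_ord_recl big_ord0 addr0 addrA.
by congr (F _ + F _ + F _); apply/val_inj; rewrite /= inordK.
Qed.

Lemma tr2 u : \tr u = u 0 0 + u 1 1.
Proof. by rewrite /mxtrace sum2. Qed.

Lemma pauliE : [/\ pauli R o0 = mk2 0 1 1 0, pauli R o1 = mk2 0 (- 'i) 'i 0 &
  pauli R o2 = mk2 1 0 0 (- 1)].
Proof.
split; apply: eq_mx2; rewrite /pauli /= inordK // !mxE /=.
all: by rewrite ?(mulr0, mulr1, add0r, addr0, subr0, sub0r, mulrN1, oppr0).
Qed.

Lemma mulii : 'i * 'i = - 1 :> C.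
Proof. by rewrite -expr2 sqr_i. Qed.

Lemma tr_pauli j : \tr (pauli R j) = 0.
Proof.
have [p0 p1 p2] := pauliE.
by case: (ord3P j) => ->; rewrite ?(p0, p1, p2) tr2 !mxE /= ?addr0 ?subrr.
Qed.

(** The Pauli matrices are an orthogonal basis of the traceless matrices. *)
Lemma pauli_complete Y : \tr Y = 0 ->
  \sum_k (\tr (pauli R k *m Y) / 2%:R) *: pauli R k = Y.
Proof.
have [p0 p1 p2] := pauliE; rewrite tr2 => /eqP; rewrite addr_eq0 => /eqP Y00.
have c2 : 2%:R != 0 :> C by rewrite pnatr_eq0.
have i2 := mulii; rewrite sum3 p0 p1 p2 !tr2 !mxM2 !mxE /=.
apply: eq_mx2; rewrite !mxE /= ?Y00.
- by field.
- rewrite ?(mul0r, mul1r, add0r, addr0, mulr0, mulr1).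
  have -> : (- 'i * Y 1 0 + 'i * Y 0 1) / 2%:R * - 'i =
     ((- 1) * Y 0 1 - (- 1) * Y 1 0) / - 2%:R by rewrite -!i2; field.
  by field.
- rewrite ?(mul0r, mul1r, add0r, addr0, mulr0, mulr1).
  have -> : (- 'i * Y 1 0 + 'i * Y 0 1) / 2%:R * 'i =
     ((- 1) * Y 0 1 - (- 1) * Y 1 0) / 2%:R by rewrite -!i2; field.
  by field.
- by field.
Qed.

Lemma pauli_ortho i j : \tr (pauli R i *m pauli R j) / 2%:R = (i == j)%:R.
Proof.
have [p0 p1 p2] := pauliE; have c2 : 2%:R != 0 :> C by rewrite pnatr_eq0.
have n01 : (o0 == o1) = false by rewrite -val_eqE /= !inordK.
have n02 : (o0 == o2) = false by rewrite -val_eqE /= !inordK.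
have n12 : (o1 == o2) = false by rewrite -val_eqE /= !inordK.
have two : (1 + 1) / 2%:R = 1 :> C by rewrite -[1 + 1]/(2%:R) divff.
case: (ord3P i) => ->; case: (ord3P j) => ->.
all: rewrite ?eqxx ?n01 ?n02 ?n12 ?(eq_sym o1 o0) ?(eq_sym o2 o0) ?(eq_sym o2 o1) ?n01 ?n02 ?n12.
all: rewrite ?(p0, p1, p2) tr2 !mxM2 !mxE /=.
all: rewrite ?(mul0r, mul1r, mulr0, mulr1, mulrN, mulNr, mulii, opprK, add0r, addr0, oppr0).
all: by rewrite ?two ?subrr ?addNr ?mul0r.
Qed.

Lemma pauli_herm j : (pauli R j) ^t* = pauli R j.
Proof.
have [p0 p1 p2] := pauliE.
have ci : Num.conj ('i : C) = - 'i by apply/eqP; rewrite eq_complex /= oppr0 !eqxx.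
case: (ord3P j) => ->; rewrite ?(p0, p1, p2); apply: eq_mx2; rewrite !mxE /=.
all: by rewrite ?rmorphN /= ?conjC0 ?conjC1 ?rmorphN //= ?ci ?opprK.
Qed.

Lemma tr_conj Y : \tr (Y ^t*) = Num.conj (\tr Y).
Proof. by rewrite !tr2 !mxE rmorphD. Qed.

Lemma conj_opp u : (- u) ^t* = - u ^t*.
Proof. by apply/matrixP => i j; rewrite !mxE rmorphN. Qed.

Lemma conj_one : (1%:M : 'M[C]_2) ^t* = 1%:M.
Proof.
by apply/matrixP => i j; rewrite !mxE eq_sym; case: (i == j); rewrite ?mulr1n ?mulr0n ?conjC1 ?conjC0.
Qed.

Lemma conj_mul u v : (u *m v) ^t* = v ^t* *m u ^t*.
Proof. by rewrite trmx_mul map_mxM. Qed.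

(** The trace is real because the Pauli matrices are Hermitian. *)
Lemma coverE u i j : (cover u i j)%:C = \tr (pauli R i *m u *m pauli R j *m u ^t*) / 2%:R.
Proof.
set T := \tr _; have cT : Num.conj T = T.
  rewrite -tr_conj !conj_mul trmxCK !pauli_herm !mulmxA.
  by rewrite /T mxtrace_mulC !mulmxA.
rewrite mxE; apply: RRe_real; apply/CrealP.
by rewrite rmorphM fmorphV rmorph_nat; congr (_ / _); exact: cT.
Qed.

Lemma SU2_adj u : isSU2 u -> u ^t* *m u = 1%:M.
Proof. by case=> /unitarymxP/mulmx1C. Qed.

Lemma realC_inj : injective (fun a : R => a%:C : C).
Proof. by move=> a b [->]. Qed.

Lemma tr_conjugate u Y : isSU2 u -> \tr (u *m Y *m u ^t*) = \tr Y.
Proof. by move=> su; rewrite -mulmxA mxtrace_mulC -mulmxA SU2_adj ?mulmx1. Qed.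

Lemma coverM u v : isSU2 u -> isSU2 v -> cover (u *m v) = cover u *m cover v.
Proof.
move=> su sv; apply/matrixP => i j; apply: realC_inj.
rewrite coverE conj_mul [in RHS]mxE rmorph_sum /=.
pose Y := v *m pauli R j *m v ^t*.
have Y0 : \tr Y = 0 by rewrite tr_conjugate // tr_pauli.
transitivity (\tr (pauli R i *m u *m Y *m u ^t*) / 2%:R); first by rewrite /Y !mulmxA.
rewrite -[Y in LHS](pauli_complete Y0) mulmx_sumr mulmx_suml raddf_sum mulr_suml /=.
have rC (a b : R) : (a * b)%:C = a%:C * b%:C :> C by rewrite rmorphM.
apply: eq_bigr => k _; rewrite rC !coverE -!scalemxAr -!scalemxAl mxtraceZ.
by rewrite /Y !mulmxA -[LHS]mulrA mulrC.
Qed.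

Lemma cover1 : cover (1%:M : 'M[C]_2) = 1%:M.
Proof.
apply/matrixP => i j; apply: realC_inj.
rewrite coverE conj_one !mulmx1 pauli_ortho mxE.
by case: (i == j).
Qed.

Lemma coverN u : cover (- u) = cover u.
Proof.
apply/matrixP => i j; apply: realC_inj; rewrite !coverE conj_opp.
by rewrite !(mulmxN, mulNmx) opprK.
Qed.

(** An element of the kernel commutes with the Pauli matrices, hence is scalar. *)
Lemma cover_kernel u : isSU2 u -> cover u = 1%:M -> u = 1%:M \/ u = - 1%:M.
Proof.
move=> su cu.
have comm j : u *m pauli R j = pauli R j *m u.
  have t0 : \tr (u *m pauli R j *m u ^t*) = 0 by rewrite tr_conjugate // tr_pauli.
  have := pauli_complete t0; rewrite (bigD1 j) //= big1 ?addr0.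
    rewrite !mulmxA -coverE cu mxE eqxx scale1r => {2}->.
    by rewrite -mulmxA SU2_adj ?mulmx1.
  by move=> k kj; rewrite !mulmxA -coverE cu mxE (negPf kj) scale0r.
have [p0 _ p2] := pauliE; have c0 := comm o0; have c2 := comm o2.
rewrite p0 in c0; rewrite p2 in c2.
have u01 : u 0 1 = 0.
  have := congr1 (fun A : 'M[C]_2 => A 0 1) c2; rewrite /= !mxM2 !mxE /=.
  rewrite ?(mul0r, mul1r, mulr0, mulr1, add0r, addr0, mulrN1) => /eqP.
  by rewrite eq_sym -addr_eq0 -mulr2n mulrn_eq0 => /eqP.
have u10 : u 1 0 = 0.
  have := congr1 (fun A : 'M[C]_2 => A 1 0) c2; rewrite /= !mxM2 !mxE /=.
  rewrite ?(mul0r, mul1r, mulr0, mulr1, add0r, addr0, mulN1r) => /eqP.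
  by rewrite -addr_eq0 -mulr2n mulrn_eq0 => /eqP.
have u00 : u 0 0 = u 1 1.
  have := congr1 (fun A : 'M[C]_2 => A 0 1) c0; rewrite /= !mxM2 !mxE /=.
  by rewrite ?(mul0r, mul1r, mulr0, mulr1, add0r, addr0).
have [_] := su; rewrite det2E u01 u10 mulr0 subr0 -u00 -expr2 => /eqP; rewrite sqrf_eq1.
case/orP => /eqP e; [left|right]; apply: eq_mx2;
  by rewrite !mxE /= -?u00 ?u01 ?u10 ?oppr0 ?e.
Qed.

Lemma isSU2M u v : isSU2 u -> isSU2 v -> isSU2 (u *m v).
Proof.
move=> [/unitarymxP uu du] [/unitarymxP uv dv].
split; last by rewrite det_mulmx du dv mulr1.
by apply/unitarymxP; rewrite conj_mul -mulmxA (mulmxA v) uv mul1mx uu.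
Qed.

Lemma isSU2_1 : isSU2 (1%:M : 'M[C]_2).
Proof.
split; last exact: det1.
by apply/unitarymxP; rewrite conj_one mulmx1.
Qed.

Lemma isSU2N u : isSU2 u -> isSU2 (- u).
Proof.
move=> [/unitarymxP uu du]; split; last by rewrite det_oppM.
by apply/unitarymxP; rewrite conj_opp mulNmx mulmxN opprK.
Qed.

Lemma isSU2V u : isSU2 u -> isSU2 (invmx u).
Proof.
move=> su; have [/unitarymxP uu du] := su; split; last by rewrite det_inv du invr1.
have -> : invmx u = u ^t*.
  have Uu : u \in unitmx by rewrite unitmxE du unitr1.
  by rewrite -[RHS](mulKmx Uu) uu mulmx1.
by apply/unitarymxP; rewrite trmxCK SU2_adj.
Qed.

Lemma coverV u : isSU2 u -> cover (invmx u) = invmx (cover u).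
Proof.
move=> su; have sv := isSU2V su.
have Uu : u \in unitmx by have [_ du] := su; rewrite unitmxE du unitr1.
have uv : cover u *m cover (invmx u) = 1%:M by rewrite -coverM // mulmxV // cover1.
have [Uc _] := mulmx1_unit uv.
by rewrite -[LHS](mulKmx Uc) uv mulmx1.
Qed.

Lemma cover_fibre u v : isSU2 u -> isSU2 v -> cover u = cover v -> u = v \/ u = - v.
Proof.
move=> su sv cuv; have Uv : v \in unitmx by have [_ dv] := sv; rewrite unitmxE dv unitr1.
have sw := isSU2M (isSU2V sv) su.
have [||e] := cover_kernel sw.
- rewrite (coverM (isSU2V sv) su) (coverV sv) cuv mulVmx //.
  have : cover v *m cover (invmx v) = 1%:M.
    by rewrite -(coverM sv (isSU2V sv)) (mulmxV Uv) cover1.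
  by case/mulmx1_unit.
- by move=> e; left; rewrite -[u](mulKVmx Uv) e mulmx1.
- by right; rewrite -[u](mulKVmx Uv) e mulmxN mulmx1.
Qed.

(** ** The binary group *)

Variable G : {fset 'M[R]_3}.
Hypothesis Gp : is_polyhedral G.
Local Notation bin := (binary G).

Lemma binary_1 : bin 1%:M.
Proof. by case: Gp => _ G1 _; split; [apply: isSU2_1|rewrite cover1]. Qed.

Lemma binaryV u : bin u -> bin (invmx u).
Proof.
case: Gp => _ G1 Gm [su Gu]; split; first exact: isSU2V.
by rewrite coverV // -[invmx _]mul1mx; apply: Gm.
Qed.

Lemma binaryM u v : bin u -> bin v -> bin (u *m v).
Proof.
case: (Gp) => _ G1 Gm [su Gu] bv; have [sv _] := bv; split; first exact: isSU2M.
have [_ Gv] := binaryV bv; rewrite (coverM su sv).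
have -> : cover v = invmx (cover (invmx v)) by rewrite (coverV sv) invmxK.
exact: (Gm _ _ Gu Gv).
Qed.

Lemma binaryN u : bin u -> bin (- u).
Proof. by move=> [su Gu]; split; [apply: isSU2N|rewrite coverN]. Qed.

Definition lifted (a : 'M[R]_3) : Prop := exists u, isSU2 u /\ cover u = a.

Definition lift_of (a : 'M[R]_3) : 'M[C]_2 :=
  if pselect (lifted a) is left p then projT1 (cid p) else 0.

Lemma lift_ofP a : lifted a -> isSU2 (lift_of a) /\ cover (lift_of a) = a.
Proof. by rewrite /lift_of; case: pselect => // p _; case: cid. Qed.

(** One preimage is chosen for each element of [G] that has one; the binary group consists of
these and of their opposites. *)
Definition lifts : seq 'M[C]_2 := [seq lift_of a | a <- enum_fset G & `[< lifted a >]].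

Lemma mem_lifts u : u \in lifts -> bin u.
Proof.
move=> /mapP[a]; rewrite mem_filter => /andP[/asboolP la Ga] ->.
by have [s c] := lift_ofP la; split=> //; rewrite c.
Qed.

Lemma lifts_inj u v : u \in lifts -> v \in lifts -> cover u = cover v -> u = v.
Proof.
move=> /mapP[a]; rewrite mem_filter => /andP[/asboolP la _] ->.
move=> /mapP[b]; rewrite mem_filter => /andP[/asboolP lb _] ->.
by have [_ ->] := lift_ofP la; have [_ ->] := lift_ofP lb => ->.
Qed.

Lemma binary_lifts u : bin u -> u \in lifts \/ - u \in lifts.
Proof.
move=> [su Gu]; have la : lifted (cover u) by exists u.
have al : lift_of (cover u) \in lifts.
  by apply: map_f; rewrite mem_filter Gu andbT; apply/asboolP.
have [sl cl] := lift_ofP la.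
by have [->|e] := cover_fibre su sl (esym cl); [left|right; rewrite e opprK].
Qed.

Lemma lifts_uniq : uniq lifts.
Proof.
rewrite map_inj_in_uniq ?filter_uniq ?fset_uniq // => a b.
rewrite !mem_filter => /andP[/asboolP la _] /andP[/asboolP lb _] e.
by have [_ <-] := lift_ofP la; have [_ <-] := lift_ofP lb; rewrite e.
Qed.

Lemma stab_order_lifts (L : {vspace 'cV[C]_2}) :
  (forall u, act (- u) L = act u L) ->
  stab_order G L = count (fun u => act u L == L) lifts.
Proof.
move=> actN; rewrite /stab_order count_map count_filter -size_filter.
apply/perm_size/uniq_perm; rewrite ?fset_uniq ?filter_uniq ?fset_uniq // => a.
rewrite mem_filter !inE /= [RHS]andbC; congr (_ && _).
apply/asboolP/andP => [[u [su ca uL]]|[/eqP lL /asboolP la]].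
  have la : lifted a by exists u.
  split; last by apply/asboolP.
  have [sl cl] := lift_ofP la; rewrite /=.
  have [e|e] := cover_fibre su sl (etrans ca (esym cl)); rewrite -{2}uL e ?actN //.
by have [sl cl] := lift_ofP la; exists (lift_of a); split.
Qed.

(** ** Change of basis *)

Variable B : 'M[C]_2.
Hypothesis detB : \det B = 1.

Let UB : B \in unitmx. Proof. by rewrite unitmxE detB unitr1. Qed.

(** The action of the binary group in the coordinates with respect to the basis [B]. *)
Definition conj_lifts : seq 'M[C]_2 := [seq invmx B *m u *m B | u <- lifts].

Lemma conj_liftsP h : signed_mem conj_lifts h <-> bin (B *m h *m invmx B).
Proof.
have K u : B *m (invmx B *m u *m B) *m invmx B = u.
  by rewrite -!mulmxA mulmxV // mulmx1 mulKVmx.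
have K' u : invmx B *m (B *m u *m invmx B) *m B = u.
  by rewrite -!mulmxA mulVmx // mulmx1 mulKmx.
split.
  case/orP => /mapP[u /mem_lifts bu e]; first by rewrite e K.
  have -> : h = - (invmx B *m u *m B) by rewrite -e opprK.
  by rewrite mulmxN mulNmx K; apply: binaryN.
case/binary_lifts => l; apply/orP; [left|right]; apply/mapP.
  by exists (B *m h *m invmx B); rewrite ?K'.
by exists (- (B *m h *m invmx B)) => //; rewrite mulmxN mulNmx K'.
Qed.

Lemma conj_lifts_group : signed_group conj_lifts.
Proof.
have conj1 u v : B *m (u *m v) *m invmx B = (B *m u *m invmx B) *m (B *m v *m invmx B).
  by rewrite !mulmxA mulmxKV.
split.
- move=> _ /mapP[u /mem_lifts[[_ du] _] ->].
  by rewrite !det_mulmx du det_inv detB invr1 !mulr1.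
- rewrite map_inj_uniq ?lifts_uniq // => u v e.
  by apply: (can_inj (mulKmx (_ : invmx B \in unitmx))); rewrite ?unitmx_inv //; apply: (can_inj (mulmxK UB)).
- move=> _ /mapP[u lu ->]; apply/negP => /mapP[v lv e].
  have bu := mem_lifts lu; have bv := mem_lifts lv.
  have uv : v = - u.
    apply: (can_inj (mulKmx (_ : invmx B \in unitmx))); rewrite ?unitmx_inv //.
    by apply: (can_inj (mulmxK UB)); rewrite -e mulmxN mulNmx.
  have := lifts_inj lu lv; rewrite uv coverN => /(_ erefl) uu.
  have [[_ du] _] := bu; move: du; have -> : u = 0.
    by apply/eqP; rewrite -(inj_eq (scalerI (_ : 2%:R != 0 :> C))) ?pnatr_eq0 // scaler0 scaler_nat mulr2n {1}uu addNr.
  by rewrite det0 => /eqP; rewrite eq_sym oner_eq0.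
- by apply/conj_liftsP; rewrite mulmx1 mulmxV //; apply: binary_1.
- move=> u v /mem_signed/conj_liftsP bu /mem_signed/conj_liftsP bv.
  by apply/conj_liftsP; rewrite conj1; apply: binaryM.
- move=> u /mem_signed/conj_liftsP bu; apply/conj_liftsP.
  suff -> : B *m invmx u *m invmx B = invmx (B *m u *m invmx B) by apply: binaryV.
  have Uu : B *m u *m invmx B \in unitmx by have [[_ du] _] := bu; rewrite unitmxE du unitr1.
  have uu : u \in unitmx.
    by move: Uu; rewrite !unitmx_mul => /andP[/andP[]].
  by apply: (can_inj (mulKmx Uu)); rewrite mulmxV // -!mulmxA mulKmx // mulKVmx // mulmxV.
Qed.

End Cover.

(** * Forms in an affine coordinate *)

Section Slice.
Variable R : realType.
Local Notation C := R[i].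
Local Notation pt x := (vec2 x 1).
Local Notation inf := (vec2 1 0 : 'cV[C]_2).
Variable B : 'M[C]_2.
Hypothesis detB : \det B = 1.
Implicit Types (Q : {mpoly C[2]}) (A : {poly C}) (v w : 'cV[C]_2) (x c : C).

Let UB : B \in unitmx. Proof. by rewrite unitmxE detB unitr1. Qed.

Lemma ev_scale Q d c v : Q \is d.-homog -> ev Q (c *: v) = c ^+ d * ev Q v.
Proof.
move=> /dhomogP hQ; rewrite /ev !mevalE mulr_sumr big_seq [RHS]big_seq.
apply: eq_bigr => m /hQ /= <-; rewrite mulrCA; congr (_ * _).
rewrite mdegE !big_ord_recl !big_ord0 !mulr1 addn0 exprD !mxE.
by rewrite !exprMn mulrACA.
Qed.

Lemma ev_0 Q d : (0 < d)%N -> Q \is d.-homog -> ev Q 0 = 0.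
Proof. by move=> d0 /ev_scale h; rewrite -[0](scale0r 0) h expr0n eqn0Ngt d0 mul0r. Qed.

(** The restriction of a form to the affine line of vectors with second coordinate [1] in the
basis [B]. *)
Definition slice Q : {poly C} :=
  \sum_(m <- msupp Q) Q@_m *: \prod_(i <- nseq (m 0) (0 : 'I_2) ++ nseq (m 1) 1)
    (B i 0 *: 'X - (- B i 1)%:P).

Lemma sliceE Q x : (slice Q).[x] = ev Q (B *m pt x).
Proof.
rewrite horner_sum /ev mevalE; apply: eq_bigr => m _; rewrite hornerZ; congr (_ * _).
rewrite horner_prod big_cat !big_nseq -!Monoid.iteropE /= big_ord_recl big_ord1.
have -> : lift ord0 ord0 = 1 :> 'I_2 by apply/val_inj.
by rewrite !mul2E !mxE /= mulr1 !hornerE !opprK.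
Qed.

Lemma slice_size Q d : Q \is d.-homog -> (size (slice Q) <= d.+1)%N /\ (slice Q)`_d = ev Q (B *m inf).
Proof.
move=> /dhomogP hQ.
have E m : m \in msupp Q -> size (nseq (m 0) (0 : 'I_2) ++ nseq (m 1) 1) = d.
  move=> /hQ <-; rewrite size_cat !size_nseq /= mdegE big_ord_recl big_ord1.
  by congr (_ + m _)%N; apply/val_inj.
have L (m : 'X_{1..2}) := @size_prod_lin _ _ (nseq (m 0) (0 : 'I_2) ++ nseq (m 1) 1)
  (fun i => B i 0) (fun i => - B i 1).
split.
  apply: (leq_trans (size_sum _ _ _)); apply/bigmax_leqP_seq => m mQ _.
  by apply: leq_trans (size_scale_leq _ _) _; rewrite -(E m mQ); have [] := L m.
rewrite coef_sum /ev mevalE big_seq [RHS]big_seq; apply: eq_bigr => m mQ.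
rewrite coefZ -(E m mQ); have [_ ->] := L m; congr (_ * _).
rewrite big_cat !big_nseq -!Monoid.iteropE /= big_ord_recl big_ord1.
have -> : lift ord0 ord0 = 1 :> 'I_2 by apply/val_inj.
by rewrite !mul2E !mxE /= !mulr1 !mulr0 !addr0.
Qed.

Definition coord_form (i : 'I_2) : {mpoly C[2]} := \sum_j (invmx B) i j *: 'X_j.

(** The homogenisation of [A], of degree [d], in the coordinates with respect to [B]. *)
Definition form_of d A : {mpoly C[2]} :=
  \sum_(i < d.+1) A`_i *: (coord_form 0 ^+ i * coord_form 1 ^+ (d - i)).

Lemma coord_formE i v : ev (coord_form i) v = (invmx B *m v) i 0.
Proof.
rewrite /ev raddf_sum /= mxE; apply: eq_bigr => j _.
by rewrite mevalZ mevalXU.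
Qed.

Lemma form_of_homog d A : form_of d A \is d.-homog.
Proof.
have X1 i : coord_form i \is 1.-homog.
  by apply: rpred_sum => j _; apply: dhomogZ; rewrite dhomogX /= mdeg1.
apply: rpred_sum => i _; apply: dhomogZ.
have := dhomogM (dhomogMn i (X1 0)) (dhomogMn (d - i) (X1 1)).
by rewrite !mul1n subnKC // -ltnS.
Qed.

Lemma form_ofE d A v : (size A <= d.+1)%N -> (invmx B *m v) 1 0 != 0 ->
  ev (form_of d A) v =
  (invmx B *m v) 1 0 ^+ d * A.[(invmx B *m v) 0 0 / (invmx B *m v) 1 0].
Proof.
move=> sA; set w := invmx B *m v => w1.
rewrite (horner_coef_wide _ sA) /ev raddf_sum mulr_sumr /=; apply: eq_bigr => i _.
rewrite mevalZ mevalM !rmorphXn /= -!/(ev _ _) !coord_formE -/w expr_div_n.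
have -> : w 1 0 ^+ d = w 1 0 ^+ i * w 1 0 ^+ (d - i).
  by rewrite -exprD subnKC // -ltnS.
by field; rewrite expf_neq0.
Qed.

End Slice.

Section Lines.
Variable R : realType.
Local Notation C := R[i].
Implicit Types (u : 'M[C]_2) (v w : 'cV[C]_2).

Lemma act_line u v : act u <[v]>%VS = <[u *m v]>%VS.
Proof. by rewrite /act limg_line lfunE. Qed.

Lemma actN u (L : {vspace 'cV[C]_2}) : act (- u) L = act u L.
Proof.
rewrite /act; apply/eqP; rewrite eqEsubv; apply/andP; split; apply/subvP => v /memv_imgP[w wL ->];
  apply/memv_imgP; exists (- w); rewrite ?memvN // !lfunE /= ?mulmxN ?mulNmx ?opprK //.
Qed.

Lemma lineZ c v : c != 0 -> <[c *: v]>%VS = <[v]>%VS.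
Proof.
move=> c0; apply/eqP; rewrite eqEsubv -!memvE memvZ ?memv_line //=.
by rewrite -[v in v \in _](scalerK c0) memvZ // memv_line.
Qed.

Lemma line_eqP v w : v != 0 -> w != 0 -> <[v]>%VS = <[w]>%VS <-> det2 v w = 0.
Proof.
move=> v0 w0; split => [vw|/(det2_eq0 v0)[c wc]].
  have : w \in <[v]>%VS by rewrite vw memv_line.
  by case/vlineP => c ->; rewrite det2Zr det2vv mulr0.
rewrite wc lineZ //; apply: contraNneq w0 => c0; by rewrite wc c0 scale0r.
Qed.

Lemma point_line (L : {vspace 'cV[C]_2}) : is_point L -> vpick L != 0 /\ L = <[vpick L]>%VS.
Proof.
move=> L1; have L0 : L != 0%VS by rewrite -dimv_eq0 (L1 : _ = _).
have v0 : vpick L != 0 by rewrite vpick0.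
by split=> //; apply/esym/eqP; rewrite eqEdim -memvE memv_pick dim_vline v0 (L1 : _ = _).
Qed.

Lemma basis_completion v : v != 0 -> exists B : 'M[C]_2, \det B = 1 /\ B *m vec2 1 0 = v.
Proof.
move=> v0; pose w := if v 0 0 == 0 then vec2 (- (v 1 0)^-1) 0 else vec2 0 (v 0 0)^-1.
exists (\matrix_(i, j) if j == 0 then v i 0 else w i 0); split; last first.
  by apply: vec2P; rewrite mul2E !mxE /= mulr1 mulr0 addr0.
rewrite det2E !mxE /= /w; case: (eqVneq (v 0 0) 0) => [v00|v00]; rewrite !mxE /=.
  have v10 : v 1 0 != 0.
    by apply: contraNneq v0 => v10; apply/eqP/vec2P; rewrite mxE.
  by rewrite mulr0 sub0r mulrN opprK divff.
by rewrite mulr0 subr0 divff.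
Qed.

End Lines.

(** * Automorphic functions in an affine coordinate *)

Section AutomorphicSlice.
Variables (R : realType) (g : vectType R[i]) (br : lieBracket g).
Variable A : automorphic_data br.
Local Notation C := R[i].
Local Notation pt x := (vec2 x 1).
Local Notation inf := (vec2 1 0 : 'cV[C]_2).
Local Notation orbit := Defs.orbit.
Variable B : 'M[C]_2.
Hypothesis detB : \det B = 1.
Hypothesis poleB : al_S A = orbit (al_G A) <[B *m inf]>%VS.
Implicit Types (v w : 'cV[C]_2) (x y c : C) (h : 'M[C]_2).

Local Notation G := (al_G A).
Local Notation P := (al_P A).
Local Notation Ks := (conj_lifts G B).
Local Notation U := (finite_pt Ks).

Let UB : B \in unitmx. Proof. by rewrite unitmxE detB unitr1. Qed.

Lemma sliceG : signed_group Ks.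
Proof. exact: (conj_lifts_group (al_polyhedral A) detB). Qed.
Local Notation KG := sliceG.

Lemma mulB_neq0 w : w != 0 -> B *m w != 0.
Proof. by apply: contra => /eqP e; rewrite -[w](mulKmx UB) e mulmx0. Qed.

Lemma mulS_neq0 h w : signed_mem Ks h -> w != 0 -> h *m w != 0.
Proof. by move=> Kh; apply: contra => /eqP e; rewrite -[w](mulKmx (signed_unit KG Kh)) e mulmx0. Qed.

Lemma inf_neq0 : inf != 0.
Proof. by apply/eqP => /(congr1 (fun v : 'cV[C]_2 => v 0 0))/eqP; rewrite !mxE /= oner_eq0. Qed.

Lemma pt_neq0 x : (pt x : 'cV[C]_2) != 0.
Proof. by apply/eqP => /(congr1 (fun v : 'cV[C]_2 => v 1 0))/eqP; rewrite !mxE /= oner_eq0. Qed.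

Lemma binary_conj u : binary G u -> signed_mem Ks (invmx B *m u *m B) /\
  forall w, u *m (B *m w) = B *m (invmx B *m u *m B *m w).
Proof.
move=> bu; split; last by move=> w; rewrite !mulmxA mulmxV // mul1mx.
apply/(conj_liftsP _ detB).
by rewrite !mulmxA (mulmxV UB) mul1mx (mulmxK UB).
Qed.

Lemma conj_binary h : signed_mem Ks h -> binary G (B *m h *m invmx B) /\
  forall w, B *m h *m invmx B *m (B *m w) = B *m (h *m w).
Proof.
move=> Kh; split; first exact/(conj_liftsP _ detB).
by move=> w; rewrite -!mulmxA mulKmx.
Qed.

(** Two lines agree when the determinant of their generators vanishes, so that [theta] vanishes
when some element of the group carries one line to the other. *)
Lemma orbit_lineP w w' : w != 0 -> w' != 0 ->
  orbit G <[B *m w]>%VS <[B *m w']>%VS <-> theta Ks w' w = 0.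
Proof.
move=> w0 w'0; split.
  move=> [u bu]; have [Kh hu] := binary_conj bu.
  rewrite act_line hu => /(line_eqP (mulB_neq0 w'0) (mulB_neq0 (mulS_neq0 Kh w0))).
  by rewrite det2_mul detB mul1r => /(theta_signed Kh).
move/eqP; rewrite theta_eq0 => /hasP[h Kh /eqP e].
have {}Kh := mem_signed Kh; have [bu hu] := conj_binary Kh.
exists (B *m h *m invmx B) => //; rewrite act_line hu.
by apply/(line_eqP (mulB_neq0 w'0) (mulB_neq0 (mulS_neq0 Kh w0))); rewrite det2_mul e mulr0.
Qed.

Lemma card_G_gt0 : (0 < #|` G|)%N.
Proof. by have [_ G1 _] := al_polyhedral A; rewrite cardfs_gt0; apply/fset0Pn; exists 1%:M. Qed.

Lemma homogP : P \is #|` G|.-homog. Proof. by have [] := al_pole A. Qed.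

Lemma ev_theta w : (ev P (B *m w) == 0) = (theta Ks w inf == 0).
Proof.
have [hP zP _] := al_pole A; have [->|w0] := eqVneq w 0.
  rewrite mulmx0 (ev_0 card_G_gt0 hP) eqxx; apply/esym/eqP.
  by have := thetaZl Ks 0 inf inf; rewrite scale0r (th_inf KG) mulr0.
have E := zP _ (mulB_neq0 w0); rewrite poleB in E.
have E' := orbit_lineP inf_neq0 w0.
by apply/eqP/eqP => [/E/E'|/E'/E].
Qed.

Lemma finite_ev x : U x = (ev P (B *m pt x) != 0).
Proof. by rewrite ev_theta /finite_pt orbit_formE. Qed.

Lemma finite_slice x : U x = ((slice B P).[x] != 0).
Proof. by rewrite finite_ev sliceE. Qed.

(** The vectors whose second coordinate in the basis [B] is zero lie on the first basis line,
which belongs to [S]. *)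
Lemma ev_finite v : ev P v != 0 -> let w := invmx B *m v in
  [/\ w 1 0 != 0, U (w 0 0 / w 1 0) & v = w 1 0 *: (B *m pt (w 0 0 / w 1 0))].
Proof.
move=> Pv w; have vE : v = B *m w by rewrite mulKVmx.
clearbody w.
have w1 : w 1 0 != 0.
  apply: contraNneq Pv => w1; rewrite vE ev_theta.
  have -> : w = w 0 0 *: inf by apply: vec2P; rewrite !mxE /= ?mulr1 ?mulr0.
  by rewrite thetaZl (th_inf KG) mulr0.
have wE : w = w 1 0 *: pt (w 0 0 / w 1 0).
  by apply: vec2P; rewrite !mxE /= ?mulr1 // mulrC divfK.
have vE' : v = w 1 0 *: (B *m pt (w 0 0 / w 1 0)) by rewrite -linearZ /= -wE.
split=> //; rewrite finite_ev; apply: contraNneq Pv => e.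
by rewrite vE' (ev_scale _ _ homogP) e mulr0.
Qed.

Lemma finite_ex : exists y, U y.
Proof.
have : orbit_form Ks inf != 0.
  rewrite prodf_seq_neq0; apply/allP => u Ku /=; have := mulS_neq0 (mem_signed Ku) inf_neq0.
  apply: contra => /eqP e; apply/eqP/vec2P; rewrite [RHS]mxE.
    have := congr1 (fun p : {poly C} => p`_0) e.
    by rewrite coefB coefZ coefX coefC mulr0 sub0r coef0 /= => /eqP; rewrite oppr_eq0 => /eqP.
  have := congr1 (fun p : {poly C} => p`_1) e.
  by rewrite coefB coefZ coefX coefC mulr1 subr0 coef0.
by move/closed_nonrootP => [y ny]; exists y.
Qed.

Lemma stab_slice x : stab_order G <[B *m pt x]>%VS = stab_count Ks x.
Proof.
rewrite stab_order_lifts; last by move=> u; apply: actN.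
rewrite /stab_count [in RHS]count_map; apply: eq_in_count => u lu /=.
have [Kh hu] := binary_conj (mem_lifts lu).
rewrite act_line hu; apply/eqP/eqP.
  move=> /(line_eqP (mulB_neq0 (mulS_neq0 Kh (pt_neq0 x))) (mulB_neq0 (pt_neq0 x))).
  by rewrite det2_mul detB mul1r det2C => /eqP; rewrite oppr_eq0 => /eqP.
move=> e; apply/(line_eqP (mulB_neq0 (mulS_neq0 Kh (pt_neq0 x))) (mulB_neq0 (pt_neq0 x))).
by rewrite det2_mul detB mul1r det2C e oppr0.
Qed.

(** ** Regular vector-valued functions *)

Definition vregular (f : C -> g) := exists m (F : 'I_m -> C -> C) (b : 'I_m -> g),
  (forall i, regular Ks (F i)) /\ forall x, U x -> f x = \sum_i F i x *: b i.

Lemma regular_slice (Q : {mpoly C[2]}) (n : nat) :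
  regular Ks (fun x => ev Q (B *m pt x) / ev P (B *m pt x) ^+ n).
Proof.
exists (slice B Q), (slice B P ^+ n); split=> x Ux.
  by rewrite horner_exp sliceE expf_neq0 // -finite_ev.
by rewrite horner_exp !sliceE.
Qed.

Lemma deg0_scale (f : 'cV[C]_2 -> g) c v : deg0_form #|` G| P f -> c != 0 -> f (c *: v) = f v.
Proof.
move=> [n [s [hs fE]]] c0; rewrite !fE (ev_scale _ _ homogP).
rewrite mulf_eq0 expf_eq0 (negPf c0) andbF /=; case: ifP => // _.
rewrite big_seq [RHS]big_seq; apply: eq_bigr => t ts.
rewrite (ev_scale _ _ (hs t ts)) exprMn -exprM mulnC -mulf_div divff ?mul1r //.
by rewrite expf_neq0.
Qed.

Lemma deg0_vregular (f : 'cV[C]_2 -> g) : deg0_form #|` G| P f -> vregular (fun x => f (B *m pt x)).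
Proof.
move=> [n [s [hs fE]]].
exists (size s), (fun i x => ev (nth (0, 0) s i).1 (B *m pt x) / ev P (B *m pt x) ^+ n),
  (fun i => (nth (0, 0) s i).2); split=> [i|x Ux]; first exact: regular_slice.
have := Ux; rewrite finite_ev fE => /negPf ->.
by rewrite (big_nth (0, 0)) big_mkord.
Qed.

Lemma slice_pole_size : (size (slice B P) <= #|` G|)%N.
Proof.
have [s c] := slice_size B homogP; move: s; rewrite leq_eqVlt => /orP[/eqP s|//].
have l0 : (slice B P)`_#|` G| = 0.
  by rewrite c; apply/eqP; rewrite ev_theta (th_inf KG).
have [y Uy] := finite_ex.
have : slice B P != 0.
  by apply/eqP => e; have := Uy; rewrite finite_ev -sliceE e horner0 eqxx.
by rewrite -lead_coef_eq0 lead_coefE s /= l0 eqxx.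
Qed.

(** Over a common power of [P] the numerators of the components are homogenised to forms of the
degree of the denominator; they describe [f] everywhere by homogeneity. *)
Lemma vregular_deg0 (f : 'cV[C]_2 -> g) : (forall v, ev P v == 0 -> f v = 0) ->
  (forall c v, c != 0 -> f (c *: v) = f v) ->
  vregular (fun x => f (B *m pt x)) -> deg0_form #|` G| P f.
Proof.
move=> f0 fZ [m [F [b [rF fE]]]].
have [k hk] : exists k, forall i, exists E : {poly C}, (size E <= (k * #|` G|).+1)%N /\
    forall x, U x -> F i x = E.[x] / (slice B P).[x] ^+ k.
  have [y Uy] := finite_ex.
  have h i := regular_frac Uy (rF i) finite_slice slice_pole_size.
  pose k i := projT1 (cid (h i)); exists (\max_i k i) => i.
  by apply: (projT2 (cid (h i))); apply: leq_bigmax.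
pose E i := projT1 (cid (hk i)).
have EP i : (size (E i) <= (k * #|` G|).+1)%N /\
    forall x, U x -> F i x = (E i).[x] / (slice B P).[x] ^+ k by apply: projT2 (cid (hk i)).
exists k, [seq (form_of B (k * #|` G|) (E i), b i) | i : 'I_m]; split.
  by move=> _ /mapP[i _ ->]; apply: form_of_homog.
move=> v; have [/f0//|Pv] := ifPn.
have [w1 Uw vE] := ev_finite Pv; rewrite {1}vE fZ // fE // big_map big_enum /=.
apply: eq_bigr => i _; have [sE FE] := EP i; rewrite FE //; congr (_ *: _).
rewrite form_ofE // sliceE.
have -> : ev P v = (invmx B *m v) 1 0 ^+ #|` G| *
    ev P (B *m pt ((invmx B *m v) 0 0 / (invmx B *m v) 1 0)).
  by rewrite -(ev_scale _ _ homogP) -vE.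
rewrite exprMn -exprM mulnC -mulf_div divff ?mul1r //.
by rewrite expf_neq0.
Qed.

End AutomorphicSlice.

(** * The model *)

Section Model.
Variables (R : realType) (g : vectType R[i]).
Local Notation C := R[i].

(** The component of weight [2 m] in the model is a polynomial multiple of this factor. *)
Definition wt_factor (ms : seq (C * nat)) (m : int) (z : C) : C :=
  \prod_(t <- ms) (z - t.1) ^ (ceil_div m t.2).

Definition vpoly (q : C -> g) := exists s : seq (nat * g), forall z, q z = vsum s z.

(** The model: rational functions of the coordinate of the quotient, taken as zero at the marks so
that they are functions. *)
Definition model (H : 'End(g)) (K : nat) (ms : seq (C * nat)) : set (C -> g) :=
  [set p | (forall z, z \in unzip1 ms -> p z = 0) /\
    exists q : int -> C -> g,
      (forall m, vpoly (q m) /\ forall z, H (q m z) = (m * 2)%:~R *: q m z) /\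
      forall z, z \notin unzip1 ms ->
        p z = \sum_(m <- wts K) wt_factor ms m z *: q m z]%classic.

(** A quotient of absolute value less than one is rounded up to [0] or [1]. *)
Lemma ceil_div_small (m : int) (k : nat) : (`|m| < k)%N -> ceil_div m k = (0 < m)%R%:Z.
Proof.
move=> mk; rewrite /ceil_div; case: ltP => m0 /=.
  have -> : - m = (- 1) * k%:Z + (k%:Z - m) by ring.
  rewrite divzMDl; last by lia.
  by rewrite divz_small; lia.
by rewrite divz_small ?oppr0 //; lia.
Qed.

Lemma ceil_div_trunc (m : int) (k K : nat) : (`|m| <= K)%N ->
  ceil_div m (minn k K.+1) = ceil_div m k.
Proof.
move=> mK; case: (leqP k K) => kK; first by rewrite (minn_idPl _) // ltnW.
by rewrite (minn_idPr _) // !ceil_div_small //; apply: leq_ltn_trans kK.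
Qed.

Lemma even_weights (V : nmodType) (F : int -> V) (B : nat) :
  (forall m, F (m * 2 + 1) = 0) ->
  \sum_(j <- wts B) F j = \sum_(m <- wts B./2) F (m * 2).
Proof.
move=> F0; rewrite (bigID (fun j => (2 %| j)%Z)) /= [X in _ + X]big1 ?addr0; last first.
  move=> j jo; have -> : j = (j %/ 2)%Z * 2 + 1 by lia.
  exact: F0.
rewrite -big_filter -[RHS](big_map (fun m => m * 2) xpredT F); apply: perm_big.
apply: uniq_perm; first exact/filter_uniq/wts_uniq.
  by rewrite map_inj_uniq; [apply: wts_uniq | move=> a b; lia].
move=> j; rewrite mem_filter mem_wts; apply/andP/mapP => [[j2 jB]|[m]].
  by exists (j %/ 2)%Z; rewrite ?mem_wts; lia.
by rewrite mem_wts => mB ->; lia.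
Qed.

End Model.

Section RegularClosure.
Variables (R : realType) (g : vectType R[i]) (br : lieBracket g).
Local Notation C := R[i].
Variable (A : automorphic_data br) (B : 'M[C]_2).
Local Notation Ks := (conj_lifts (al_G A) B).
Local Notation U := (finite_pt Ks).
Implicit Types (f : C -> g) (x : C).

Lemma vregular_ext f1 f2 : (forall x, U x -> f1 x = f2 x) -> vregular A B f1 -> vregular A B f2.
Proof.
by move=> e [m [F [b [rF h]]]]; exists m, F, b; split=> // x Ux; rewrite -e // h.
Qed.

Lemma vregular_term (phi : C -> C) (b : g) : regular Ks phi -> vregular A B (fun x => phi x *: b).
Proof.
move=> rp; exists 1%N, (fun=> phi), (fun=> b); split=> // x Ux.
by rewrite big_ord1.
Qed.

Lemma vregularD f1 f2 : vregular A B f1 -> vregular A B f2 -> vregular A B (fun x => f1 x + f2 x).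
Proof.
move=> [m1 [F1 [b1 [rF1 h1]]]] [m2 [F2 [b2 [rF2 h2]]]].
exists (m1 + m2)%N, (fun i : 'I_(m1 + m2) => match fintype.split i with inl j => F1 j | inr j => F2 j end),
  (fun i : 'I_(m1 + m2) => match fintype.split i with inl j => b1 j | inr j => b2 j end); split=> [i|x Ux].
  by case: (fintype.split i).
rewrite h1 // h2 // big_split_ord /=; congr (_ + _); apply: eq_bigr => i _.
  by rewrite -[lshift _ _]/(unsplit (inl i)) unsplitK.
by rewrite -[rshift _ _]/(unsplit (inr i)) unsplitK.
Qed.

Lemma vregular0 : vregular A B (fun=> 0).
Proof.
exists 0%N, (fun=> fun=> 0), (fun=> 0); split=> [|x _]; last by rewrite big_ord0.
by case.
Qed.

Lemma vregular_sum (I : eqType) (s : seq I) (F : I -> C -> g) :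
  (forall i, vregular A B (F i)) -> vregular A B (fun x => \sum_(i <- s) F i x).
Proof.
move=> rF; elim: s => [|i s IH].
  by apply: vregular_ext vregular0 => x _; rewrite big_nil.
by apply: vregular_ext (vregularD (rF i) IH) => x _; rewrite big_cons.
Qed.

Lemma vregularZ (phi : C -> C) f : regular Ks phi -> vregular A B f ->
  vregular A B (fun x => phi x *: f x).
Proof.
move=> rp [m [F [b [rF h]]]]; exists m, (fun i x => phi x * F i x), b; split=> [i|x Ux].
  exact: regularM.
by rewrite h // scaler_sumr; apply: eq_bigr => i _; rewrite scalerA.
Qed.

Lemma vregular_coord f j : vregular A B f ->
  regular Ks (fun x => coord (vbasis fullv) j (f x)).
Proof.
move=> [m [F [b [rF h]]]].
apply: (@regular_ext _ _ (fun x => \sum_i F i x * coord (vbasis fullv) j (b i))) => [x Ux|].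
  by rewrite h // linear_sum; apply: eq_bigr => i _; rewrite linearZ.
by apply: regular_sum => i; apply: regularM (rF i) (regular_cst _ _).
Qed.

Lemma vregular_end (p : 'End(g)) f : vregular A B f -> vregular A B (fun x => p (f x)).
Proof.
move=> [m [F [b [rF h]]]]; exists m, F, (fun i => p (b i)); split=> // x Ux.
by rewrite h // end_sum; apply: eq_bigr => i _; rewrite endZ.
Qed.

Lemma regular_meval n (Q : {mpoly C[n]}) (v : C -> 'I_n -> C) :
  (forall k, regular Ks (fun x => v x k)) -> regular Ks (fun x => Q.@[v x]).
Proof.
move=> rv; elim/mpolyind: Q => [|a m p _ _ IH].
  by apply: regular_ext (regular_cst Ks 0) => x _; rewrite meval0.
apply: (@regular_ext _ _ (fun x => a * \prod_(i < n) v x i ^+ m i + p.@[v x])) => [x _|].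
  by rewrite mevalD mevalZ mevalX.
apply: regularD IH; apply: regularM (regular_cst _ _) _.
have : forall s : seq 'I_n, regular Ks (fun x => \prod_(i <- s) v x i ^+ m i).
  elim=> [|i s IHs].
    by apply: regular_ext (regular_cst Ks 1) => x _; rewrite big_nil.
  by apply: regular_ext (regularM (regularX (m i) (rv i)) IHs) => x _; rewrite big_cons.
exact.
Qed.

Variable rb : 'M[C]_2 -> 'End(g).
Hypothesis rbA : is_SL2_action br rb.

(** The action is polynomial in the entries of the matrix. *)
Lemma vregular_rb (M : C -> 'M[C]_2) f : (forall x, U x -> isSL2 (M x)) ->
  (forall i j, regular Ks (fun x => M x i j)) -> vregular A B f ->
  vregular A B (fun x => rb (M x) (f x)).
Proof.
move=> sM rM [m [F [b [rF h]]]].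
pose s i := projT1 (cid ((let: And3 _ _ r := rbA in r) (b i))).
have sP i : represents rb (b i) (s i) by apply: projT2 (cid _).
apply: (@vregular_ext (fun x => \sum_i F i x *:
    (\sum_(t <- s i) t.1.@[mxvec (M x) 0] *: t.2))) => [x Ux|].
  by rewrite h // end_sum; apply: eq_bigr => i _; rewrite endZ (sP i _ (sM x Ux)).
apply: vregular_sum => i; apply: vregularZ => //.
have : forall l : seq ({mpoly C[2 * 2]} * g),
    vregular A B (fun x => \sum_(t <- l) t.1.@[mxvec (M x) 0] *: t.2).
  elim=> [|t l IH]; first by apply: vregular_ext vregular0 => x _; rewrite big_nil.
  apply: (vregular_ext _ (vregularD (vregular_term t.2 _) IH)) => [x _|]; first by rewrite big_cons.
  apply: regular_meval => k; case/mxvec_indexP: k => a c.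
  by apply: regular_ext (rM a c) => x _; rewrite mxvecE.
exact.
Qed.

End RegularClosure.

(** * Trivialising the action *)

Section Trivialisation.
Variables (R : realType) (g : vectType R[i]) (br : lieBracket g).
Variable A : automorphic_data br.
Local Notation C := R[i].
Local Notation pt x := (vec2 x 1).
Local Notation inf := (vec2 1 0 : 'cV[C]_2).
Variable B : 'M[C]_2.
Hypothesis detB : \det B = 1.
Hypothesis poleB : al_S A = Defs.orbit (al_G A) <[B *m inf]>%VS.
Implicit Types (v w : 'cV[C]_2) (x y z c : C) (h : 'M[C]_2) (f : 'cV[C]_2 -> g) (m : int).

Local Notation G := (al_G A).
Local Notation P := (al_P A).
Local Notation Ks := (conj_lifts G B).
Local Notation U := (finite_pt Ks).
Local Notation KG := (sliceG A detB).

Variable rb : 'M[C]_2 -> 'End(g).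
Hypothesis fact : factorises A rb.
Variable H : 'End(g).
Hypothesis Hdiff : is_differential rb (diag1N1 R) H.
Variable top : nat.
Hypothesis top_ge : forall (y : g) (j : int), y != 0 -> H y = j%:~R *: y -> (j <= top%:Z)%R.

Variable y0 : C.
Hypothesis Uy0 : U y0.
Local Notation J := (qcoord Ks y0).
Local Notation slope := (slope Ks).

Variable ms : seq (C * nat).
Hypothesis ms_uniq : uniq (unzip1 ms).
Hypothesis ms_orbit : forall t, t \in ms ->
  exists2 y, U y & J y = t.1 /\ stab_count Ks y = t.2.
Hypothesis ms_all : forall y, U y -> (1 < stab_count Ks y)%N -> J y \in unzip1 ms.
Local Notation unmarked := (unmarked Ks y0 ms).
Local Notation dcoord := (dcoord Ks y0).

Let UB : B \in unitmx. Proof. by rewrite unitmxE detB unitr1. Qed.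
Let rbA : is_SL2_action br rb. Proof. by case: fact. Qed.

(** ** The equivariant frame *)

(** The logarithmic derivative of the form vanishing on the poles provides, at each point off the
poles, a second vector completing the point to a basis of determinant one, in a way that commutes
with the group: this frame trivialises the action. *)
Definition frame x : 'M[C]_2 := B *m mk2 x (x * slope x - 1) 1 (slope x).
Definition coframe x : 'M[C]_2 := mk2 (slope x) (1 - x * slope x) (- 1) x *m invmx B.

Lemma frame_SL2 x : isSL2 (frame x).
Proof. by rewrite /isSL2 det_mulmx detB mul1r det2E !mxE /=; ring. Qed.

Lemma coframe_SL2 x : isSL2 (coframe x).
Proof. by rewrite /isSL2 det_mulmx det_inv detB invr1 mulr1 det2E !mxE /=; ring. Qed.

Lemma coframeK x : coframe x *m frame x = 1%:M.
Proof.
rewrite /coframe /frame -mulmxA mulKmx //.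
by apply: eq_mx2; rewrite mxM2 !mxE /=; ring.
Qed.

Lemma frameK x : frame x *m coframe x = 1%:M.
Proof. exact: mulmx1C (coframeK x). Qed.

Lemma coframe_mob h x : signed_mem Ks h -> U x ->
  coframe (mob h x) *m (B *m h *m invmx B) = torus (den h x) *m coframe x.
Proof.
move=> Kh Ux; have [d0 _] := finite_mob KG Kh Ux.
have dh := signed_det KG Kh; rewrite det2E in dh.
rewrite /coframe -!mulmxA (mulmxA (invmx B) B) (mulVmx UB) mul1mx !mulmxA.
congr (_ *m _); set t := den h x.
have s1 := slope_mob KG Kh Ux; rewrite -/t in s1.
have m1 : mob h x * t = num h x by rewrite divfK.
have e1 : t * (h 0 0 - mob h x * h 1 0) = 1.
  by rewrite mulrBr mulrA (mulrC t (mob h x)) m1 /t /den /num -dh; ring.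
have e2 : t * (h 0 1 - mob h x * h 1 1) = - x.
  rewrite mulrBr mulrA (mulrC t (mob h x)) m1 /t /den /num.
  by rewrite -[RHS]mulr1 -dh; ring.
apply: eq_mx2; rewrite !mxM2 !torusE /= !mxE /= ?mul0r ?addr0 ?add0r.
- transitivity (h 1 0 + slope (mob h x) * (h 0 0 - mob h x * h 1 0)); first by ring.
  rewrite s1; transitivity (h 1 0 + (t * slope x - h 1 0) * (t * (h 0 0 - mob h x * h 1 0))).
    by ring.
  by rewrite e1; ring.
- transitivity (h 1 1 + slope (mob h x) * (h 0 1 - mob h x * h 1 1)); first by ring.
  rewrite s1; transitivity (h 1 1 + (t * slope x - h 1 0) * (t * (h 0 1 - mob h x * h 1 1))).
    by ring.
  by rewrite e2 /t /den; ring.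
- apply: (mulfI d0); rewrite -/t; transitivity (- (t * (h 0 0 - mob h x * h 1 0))); first by ring.
  by rewrite e1 mulrA divff // mul1r.
- apply: (mulfI d0); rewrite -/t; transitivity (- (t * (h 0 1 - mob h x * h 1 1))); first by ring.
  by rewrite e2 opprK mulrA divff // mul1r.
Qed.

Lemma regular_mk2 (a b c d : C -> C) (i j : 'I_2) : regular Ks a -> regular Ks b ->
  regular Ks c -> regular Ks d -> regular Ks (fun x => mk2 (a x) (b x) (c x) (d x) i j).
Proof.
move=> ra rb0 rc rd; case: (ord2P i) => ->; case: (ord2P j) => ->.
- by apply: regular_ext ra => x _; rewrite mxE.
- by apply: regular_ext rb0 => x _; rewrite mxE.
- by apply: regular_ext rc => x _; rewrite mxE.
- by apply: regular_ext rd => x _; rewrite mxE.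
Qed.

Lemma regular_mul_mx (M N : C -> 'M[C]_2) : (forall i j, regular Ks (fun x => M x i j)) ->
  (forall i j, regular Ks (fun x => N x i j)) ->
  forall i j, regular Ks (fun x => (M x *m N x) i j).
Proof.
move=> rM rN i j; apply: regular_ext (regularD (regularM (rM i 0) (rN 0 j))
  (regularM (rM i 1) (rN 1 j))) => x _.
by rewrite mxM2.
Qed.

Lemma regular_frame i j : regular Ks (fun x => frame x i j).
Proof.
apply: regular_mul_mx => {}i {}j; first exact: regular_cst.
apply: regular_mk2 (regular_cst _ _) (regular_slope KG); first exact: regular_id.
apply: regularB (regular_cst _ _); exact: regularM (regular_id _) (regular_slope KG).
Qed.

Lemma regular_coframe i j : regular Ks (fun x => coframe x i j).
Proof.
apply: regular_mul_mx => {}i {}j; last exact: regular_cst.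
apply: regular_mk2 (regular_slope KG) _ (regular_cst _ _) (regular_id _).
apply: regularB; first exact: regular_cst.
exact: regularM (regular_id _) (regular_slope KG).
Qed.

(** ** From invariants to weights *)

Definition untwist f x : g := rb (coframe x) (f (B *m pt x)).

Lemma autom_equiv f u v : autom_lie A f -> binary G u -> f (u *m v) = rb u (f v).
Proof.
move=> [_ inv] bu; have [_ <-] := fact; last exact: bu.
have Uu : u \in unitmx by have [[_ du] _] := bu; rewrite unitmxE du unitr1.
by rewrite -{1}(inv u bu) mulKmx.
Qed.

Lemma slice_mob h x : signed_mem Ks h -> U x ->
  (B *m h *m invmx B) *m (B *m pt x) = den h x *: (B *m pt (mob h x)).
Proof.
move=> Kh Ux; have [d0 _] := finite_mob KG Kh Ux.
by rewrite (mulmxA _ B) (mulmxKV UB) -mulmxA mul_pt_mob // -scalemxAr.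
Qed.

Lemma autom_mob f h x : autom_lie A f -> signed_mem Ks h -> U x ->
  f (B *m pt (mob h x)) = rb (B *m h *m invmx B) (f (B *m pt x)).
Proof.
move=> af Kh Ux; have [d0 _] := finite_mob KG Kh Ux.
have [bu _] := conj_binary detB Kh; have [dg _] := af.
by rewrite -(autom_equiv _ af bu) slice_mob // (deg0_scale _ dg d0).
Qed.

Lemma untwist_mob f h x : autom_lie A f -> signed_mem Ks h -> U x ->
  untwist f (mob h x) = rb (torus (den h x)) (untwist f x).
Proof.
move=> af Kh Ux; have [d0 _] := finite_mob KG Kh Ux.
have [[[_ du] _] _] := conj_binary detB Kh.
rewrite /untwist (autom_mob af Kh Ux) -(rbM rbA _ (coframe_SL2 _) du) (coframe_mob Kh Ux).
by rewrite (rbM rbA _ (torus_SL2 d0) (coframe_SL2 _)).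
Qed.

Lemma untwist_regular f : autom_lie A f -> vregular A B (untwist f).
Proof.
move=> [dg _]; apply: (vregular_rb rbA) (deg0_vregular detB poleB dg).
  by move=> x _; apply: coframe_SL2.
exact: regular_coframe.
Qed.

Local Notation proj := (wt_proj H top).

(** The element [- 1] of the binary group acts trivially on the sphere and multiplies odd weights
by [- 1]. *)
Lemma untwist_odd f x m : autom_lie A f -> U x -> proj (m * 2 + 1) (untwist f x) = 0.
Proof.
move=> af Ux; have Kn : signed_mem Ks (- 1%:M).
  by rewrite signed_memN; apply: sg_one KG.
have dn : den (- 1%:M) x = -1 by rewrite /den !mxE /=; ring.
have mx : mob (- 1%:M) x = x by rewrite /mob dn /num !mxE /= invrN1; ring.
have := untwist_mob af Kn Ux; rewrite mx dn => E.
have n1 : (-1 : C) != 0 by rewrite oppr_eq0 oner_eq0.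
have := congr1 (proj (m * 2 + 1)) E; rewrite (wt_proj_torus rbA Hdiff top_ge) //.
rewrite expfzDr // mulrC -exprz_exp -exprnP sqrrN expr1n exp1rz mul1r expr1z scaleN1r.
by move/eqP; rewrite -addr_eq0 -mulr2n -scaler_nat scaler_eq0 pnatr_eq0 => /eqP.
Qed.

(** Apply [weight_invariant] to each coordinate. *)
Lemma weight_component f m : autom_lie A f -> exists q : C -> g, vpoly q /\
  forall x, unmarked x ->
    proj (m * 2) (untwist f x) = weight_gen Ks y0 ms m x *: q (J x).
Proof.
move=> af; pose e j := (vbasis {:g})`_j.
have comp (j : 'I_(\dim {:g})) : exists a : {poly C}, forall x, unmarked x ->
    coord (vbasis fullv) j (proj (m * 2) (untwist f x)) = weight_gen Ks y0 ms m x * a.[J x].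
  apply: (weight_invariant KG Uy0 ms_uniq ms_orbit ms_all).
    by apply: vregular_coord; apply: vregular_end; apply: untwist_regular.
  move=> h x /mem_signed Kh Ux; have [d0 _] := finite_mob KG Kh Ux.
  rewrite untwist_mob // (wt_proj_torus rbA Hdiff top_ge) // linearZ /=; congr (_ * _).
  by rewrite mulrC -exprz_exp.
pose a j := projT1 (cid (comp j)).
have aP j x : unmarked x -> coord (vbasis fullv) j (proj (m * 2) (untwist f x)) =
    weight_gen Ks y0 ms m x * (a j).[J x] by apply: (projT2 (cid (comp j))).
exists (fun z => \sum_j (a j).[z] *: e j); split; last first.
  move=> x ux; rewrite [LHS](coord_vbasis (memvf _)) scaler_sumr; apply: eq_bigr => j _.
  by rewrite aP // scalerA.
have : forall l : seq 'I_(\dim {:g}), vpoly (fun z => \sum_(j <- l) (a j).[z] *: e j).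
  elim=> [|j l [s IH]]; first by exists [::] => z; rewrite /vsum !big_nil.
  exists (poly_terms (a j) (e j) ++ s) => z.
  by rewrite vsum_cat vsum_poly -IH big_cons.
exact.
Qed.

Lemma wt_factor_gen m x : unmarked x ->
  weight_gen Ks y0 ms m x = (dcoord x / \prod_(t <- ms) (J x - t.1)) ^ m * wt_factor ms m (J x).
Proof.
move=> ux; rewrite /weight_gen /wt_factor (expfzMl (dcoord x)) exprz_inv -mulrA; congr (_ * _).
have h t : t \in ms -> J x - t.1 != 0 by apply: sub_mark_neq0.
elim: (ms) h => [|t l IH] h; first by rewrite !big_nil exp1rz mulr1.
have t0 : J x - t.1 != 0 by apply: h; apply: mem_head.
rewrite !big_cons IH => [|s sl]; last by apply: h; rewrite in_cons sl orbT.
by rewrite expfzMl (expfzDr _ _ t0); ring.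
Qed.

(** The scale that makes the frame invariant: at unmarked points the derivative of the coordinate
is corrected by its zeros on the exceptional orbits. *)
Definition scale x : C := dcoord x / \prod_(t <- ms) (J x - t.1).

Lemma scale_neq0 x : unmarked x -> scale x != 0.
Proof.
move=> ux; rewrite mulf_neq0 ?(dcoord_neq0 KG Uy0 ms_all ux) // invr_eq0 prodf_seq_neq0.
by apply/allP => t tm; apply: (sub_mark_neq0 ux).
Qed.

Definition scale_root x : C := (sqrtC (scale x))^-1.

Lemma scale_root_neq0 x : unmarked x -> scale_root x != 0.
Proof. by move=> ux; rewrite invr_eq0 sqrtC_eq0 scale_neq0. Qed.

Lemma scale_rootE x m : unmarked x -> scale_root x ^ (m * 2) * scale x ^ m = 1.
Proof.
move=> ux; rewrite mulrC -[in X in _ * X](mulrC 2) -exprz_exp -exprnP exprVn sqrtCK.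
by rewrite -expfzMl divff ?exp1rz // scale_neq0.
Qed.

Lemma section_ex z : exists x, U x /\ J x = z.
Proof. by have [x Ux Jx] := qcoord_surj KG Uy0 z; exists x. Qed.

(** In the rescaled frame an invariant function is constant on the fibres of the coordinate, so
that it does not matter which point of the fibre is chosen. *)
Definition section z : C := projT1 (cid (section_ex z)).

Lemma sectionP z : U (section z) /\ J (section z) = z.
Proof. exact: projT2 (cid (section_ex z)). Qed.

Lemma section_unmarked z : z \notin unzip1 ms -> unmarked (section z).
Proof. by move=> zm; have [Us Js] := sectionP z; apply/andP; rewrite Us Js. Qed.

Local Notation K := top./2.
Definition trunc_marks := [seq (t.1, minn t.2 K.+1) | t <- ms].

Lemma trunc_marks1 : unzip1 trunc_marks = unzip1 ms.
Proof. by rewrite /unzip1 -map_comp; apply: eq_map. Qed.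

Lemma wt_factor_trunc m z : (`|m| <= K)%N -> wt_factor trunc_marks m z = wt_factor ms m z.
Proof. by move=> mK; rewrite /wt_factor big_map; apply: eq_bigr => t _ /=; rewrite ceil_div_trunc. Qed.

Definition trivialise f (z : C) : g := if z \in unzip1 ms then 0 else
  rb (torus (scale_root (section z)) *m coframe (section z)) (f (B *m pt (section z))).

Lemma trivialiseE f z : z \notin unzip1 ms ->
  trivialise f z = rb (torus (scale_root (section z))) (untwist f (section z)).
Proof.
move=> zm; rewrite /trivialise (negPf zm); have ux := section_unmarked zm.
exact: (rbM rbA _ (torus_SL2 (scale_root_neq0 ux)) (coframe_SL2 _)).
Qed.

Lemma double_wts m : (m \in wts K) -> m * 2 \in wts top.
Proof. by rewrite !mem_wts; lia. Qed.

Lemma trivialise_model f : autom_lie A f -> model H K trunc_marks (trivialise f).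
Proof.
move=> af; split=> [z|]; rewrite ?trunc_marks1; first by rewrite /trivialise => ->.
have wc m := cid (weight_component m af).
pose q m z : g := proj (m * 2) (projT1 (wc m) z).
exists q; split=> [m|z zm].
  split; last by move=> z; apply: (wt_projP rbA Hdiff top_ge).
  have [[s sE] _] := projT2 (wc m).
  exists [seq (t.1, proj (m * 2) t.2) | t <- s] => z.
  by rewrite /q sE /vsum big_map end_sum; apply: eq_bigr => t _; rewrite endZ.
have ux := section_unmarked zm; have [Ux Jx] := sectionP z.
rewrite trivialiseE // (rb_torus rbA Hdiff top_ge) ?scale_root_neq0 //.
rewrite even_weights => [|m]; last by rewrite untwist_odd // scaler0.
rewrite big_seq [RHS]big_seq; apply: eq_bigr => m mK.
have [_ qE] := projT2 (wc m).
have E := wt_projP rbA Hdiff top_ge (m * 2) (untwist f (section z)).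
have idem : proj (m * 2) (proj (m * 2) (untwist f (section z))) =
    proj (m * 2) (untwist f (section z)).
  by rewrite (wt_proj_eigen _ E (double_wts mK)) eqxx.
rewrite -idem qE // endZ Jx /q -/(wc m) scalerA; congr (_ *: _).
rewrite wt_factor_gen // mulrA scale_rootE // mul1r Jx wt_factor_trunc //.
by rewrite -mem_wts.
Qed.

(** A point over an unmarked value is moved to the chosen point of its fibre by the group, and
functions that agree at the unmarked points agree. *)
Lemma trivialise_inj f1 f2 : autom_lie A f1 -> autom_lie A f2 ->
  trivialise f1 = trivialise f2 -> f1 = f2.
Proof.
move=> a1 a2 e.
have E z : z \notin unzip1 ms -> f1 (B *m pt (section z)) = f2 (B *m pt (section z)).
  move=> zm; have := congr1 (fun p => p z) e; rewrite /trivialise (negPf zm).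
  apply: (rb_inj rbA); apply: SL2M; last exact: coframe_SL2.
  exact/torus_SL2/scale_root_neq0/section_unmarked.
have E2 x : unmarked x -> f1 (B *m pt x) = f2 (B *m pt x).
  move=> ux; have Ux := unmarked_finite ux; have /andP[_ zm] := ux.
  have [Us /eqP] := sectionP (J x); rewrite eq_sym => /(qcoord_eqP KG Uy0 Ux Us)[u Ku ->].
  by rewrite !autom_mob ?mem_signed // E.
have E3 x : U x -> f1 (B *m pt x) = f2 (B *m pt x).
  move=> Ux; apply: coord_inj => j; move: x Ux.
  have [[d1 _] [d2 _]] := (a1, a2).
  apply: (regular_dense Uy0 (mark_form_neq0 KG Uy0 ms)).
  - exact: vregular_coord (deg0_vregular detB poleB d1).
  - exact: vregular_coord (deg0_vregular detB poleB d2).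
  - by move=> x Ux /(mark_formP Ux)/E2 ->.
apply/funext => v; have [[d1 _] [d2 _]] := (a1, a2).
have [Pv|Pv] := eqVneq (ev P v) 0.
  have [n1 [s1 [_ ->]]] := d1; have [n2 [s2 [_ ->]]] := d2.
  by rewrite Pv eqxx.
have [w1 Uw ->] := ev_finite detB poleB Pv.
by rewrite (deg0_scale _ d1) // (deg0_scale _ d2) // E3.
Qed.

(** The regular extension of [weight_gen m] to the exceptional orbits keeps the factor of
automorphy, by density. *)
Lemma weight_ext m : exists E : C -> C, regular Ks E /\
  (forall x, unmarked x -> E x = weight_gen Ks y0 ms m x) /\
  forall h x, signed_mem Ks h -> U x -> E (mob h x) = (den h x ^+ 2) ^ m * E x.
Proof.
have [E rE EE] := weight_gen_regular KG Uy0 ms_uniq ms_orbit ms_all m.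
exists E; split=> //; split=> // h x Kh; move: x.
have r2 : regular Ks (fun x => (den h x ^+ 2) ^ m).
  have rd : regular Ks (fun x => den h x).
    by apply: regular_ext (regular_poly Ks (den_poly h)) => x _; rewrite den_polyE.
  case: m {E rE EE} => k; first exact: regularX (regularX 2 rd).
  have rdV : regular Ks (fun x => (den h x)^-1).
    apply: regular_ext (regularV_poly (A := den_poly h) _) => [x _|x Ux]; rewrite den_polyE //.
    by have [] := finite_mob KG Kh Ux.
  apply: regular_ext (regularX k.+1 (regularX 2 rdV)) => x _.
  by rewrite NegzE -exprnN !exprVn.
apply: (regular_dense Uy0 (mark_form_neq0 KG Uy0 ms)).
- exact: (regular_mob KG Kh rE).
- exact: (regularM r2 rE).
- move=> x Ux /(mark_formP Ux) ux; rewrite (EE _ (unmarked_mob KG Kh ux)) (EE _ ux).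
  by rewrite (weight_gen_mob KG y0).
Qed.

Lemma ev_binary u v : binary G u -> (ev P (u *m v) == 0) = (ev P v == 0).
Proof.
move=> bu; have [_ _ hP] := al_pole A.
have Uu : u \in unitmx by have [[_ du] _] := bu; rewrite unitmxE du unitr1.
apply/eqP/eqP => e.
  by have [c hc] := hP u bu; rewrite -[v](mulKmx Uu) hc e mulr0.
have [c hc] := hP _ (binaryV (al_polyhedral A) bu).
by have := hc v; rewrite invmxK e mulr0.
Qed.

(** Given a member of the model, the frame turns the sum of its components, with the factors
[wt_factor] replaced by [weight_gen], into an invariant function without poles off [S]. *)
Lemma trivialise_surj p : model H K trunc_marks p -> exists2 f, autom_lie A f & trivialise f = p.
Proof.
move=> [p0 [q [qP pE]]]; rewrite trunc_marks1 in p0 pE.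
pose E m := projT1 (cid (weight_ext m)).
have EP m : regular Ks (E m) /\ (forall x, unmarked x -> E m x = weight_gen Ks y0 ms m x) /\
  forall h x, signed_mem Ks h -> U x -> E m (mob h x) = (den h x ^+ 2) ^ m * E m x.
  exact: projT2 (cid (weight_ext m)).
pose h x : g := \sum_(m <- wts K) E m x *: q m (J x).
have rh : vregular A B h.
  apply: vregular_sum => m; have [rE _] := EP m; apply: vregularZ => //.
  have [[s sE] _] := qP m.
  apply: (@vregular_ext _ _ _ _ _ (fun x => \sum_(t <- s) J x ^+ t.1 *: t.2)).
    by move=> x _; rewrite sE.
  by apply: vregular_sum => t; apply: vregular_term; apply: regularX; apply: regular_qcoord.
have q_torus m c z : c != 0 -> rb (torus c) (q m z) = c ^ (m * 2) *: q m z.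
  by move=> c0; have [_ Hq] := qP m; apply: (eigen_torus rbA Hdiff c0 (Hq z)).
have h_mob k x : signed_mem Ks k -> U x -> h (mob k x) = rb (torus (den k x)) (h x).
  move=> Kk Ux; have [d0 _] := finite_mob KG Kk Ux.
  rewrite /h end_sum; apply: eq_bigr => m _; have [_ [_ ->]] := EP m; rewrite //.
  rewrite (qcoord_mob KG) // endZ q_torus // scalerA; congr (_ *: _).
  by rewrite mulrC (mulrC m) -exprz_exp.
pose crd v : C := (invmx B *m v) 0 0 / (invmx B *m v) 1 0.
pose f v : g := if ev P v == 0 then 0 else rb (frame (crd v)) (h (crd v)).
have crdZ c v : c != 0 -> crd (c *: v) = crd v.
  move=> c0; rewrite /crd -scalemxAr !mxE.
  by rewrite -mulf_div divff // mul1r.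
have fZ c v : c != 0 -> f (c *: v) = f v.
  move=> c0; rewrite /f crdZ // (ev_scale _ _ (homogP A)) mulf_eq0 expf_eq0.
  by rewrite (negPf c0) andbF.
have f_slice x : U x -> f (B *m pt x) = rb (frame x) (h x).
  move=> Ux; rewrite /f; have := Ux; rewrite (finite_ev detB poleB) => /negPf ->.
  by rewrite /crd mulKmx // !mxE /= divr1.
have fdeg : deg0_form #|` G| P f.
  apply: (vregular_deg0 detB poleB) => //; first by move=> v; rewrite /f => ->.
  apply: (vregular_ext (f1 := fun x => rb (frame x) (h x))) => [x Ux|]; first by rewrite f_slice.
  by apply: (vregular_rb rbA) rh => [x _|]; [apply: frame_SL2|apply: regular_frame].
have f_equiv u v : binary G u -> f (u *m v) = rb u (f v).
  move=> bu; have [Pv|Pv] := boolP (ev P v == 0).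
    by rewrite /f ev_binary // Pv end0.
  have [w1 Ux ->] := ev_finite detB poleB Pv; set x := _ / _ in Ux *.
  rewrite -scalemxAr !fZ //; have [Kk _] := binary_conj detB bu.
  set k := _ *m B in Kk; have uE : u = B *m k *m invmx B.
    by rewrite /k !mulmxA mulmxV // mul1mx mulmxK.
  have [d0 Uk] := finite_mob KG Kk Ux; have [[_ du] _] := bu.
  rewrite {1}uE slice_mob // fZ // !f_slice // h_mob //.
  rewrite -(rbM rbA _ (frame_SL2 _) (torus_SL2 d0)) -(rbM rbA _ du (frame_SL2 _)).
  have E1 := coframe_mob Kk Ux; rewrite -uE in E1.
  congr (rb _ _); rewrite -[torus _]mulmx1 -(coframeK x) (mulmxA (torus _)) -E1.
  by rewrite -(mulmxA (coframe _)) (mulmxA (frame _) (coframe _)) frameK mul1mx.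
exists f.
  split=> // u bu; apply/funext => v.
  have [_ ->] := fact; last exact: bu.
  by rewrite -f_equiv // mulKVmx //; have [[_ du] _] := bu; rewrite unitmxE du unitr1.
apply/funext => z; have [zm|zm] := boolP (z \in unzip1 ms).
  by rewrite /trivialise zm p0.
have ux := section_unmarked zm; have [Ux Jx] := sectionP z.
rewrite trivialiseE // /untwist f_slice //.
rewrite -(rbM rbA (h _) (coframe_SL2 _) (frame_SL2 _)) coframeK (rb1 rbA).
rewrite pE // /h end_sum big_seq [RHS]big_seq; apply: eq_bigr => m mK.
have [_ [Eu _]] := EP m; rewrite endZ q_torus ?scale_root_neq0 // Jx scalerA; congr (_ *: _).
rewrite Eu // wt_factor_gen // mulrC mulrA scale_rootE // mul1r Jx wt_factor_trunc //.
by rewrite -mem_wts.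
Qed.

Theorem autom_lie_model :
  lie_isomorphic (lie_fct 'cV[C]_2 br) (lie_fct C br) (autom_lie A) (model H K trunc_marks).
Proof.
exists trivialise; split.
- split=> [f af|f1 f2 /set_mem a1 /set_mem a2 e|p mp]; first exact: trivialise_model.
    exact: trivialise_inj.
  by have [f af fp] := trivialise_surj mp; exists f.
- move=> a f1 f2 _ _; apply/funext => z; rewrite /trivialise !fctE.
  by case: ifP => _; rewrite ?scaler0 ?addr0 // linearP.
- move=> f1 f2 _ _; apply/funext => z; rewrite /trivialise /=.
  case: ifPn => [_|zm]; first by rewrite lie_alt.
  have ux := section_unmarked zm; case: rbA => aut _ _.
  have [|_ ->] // := aut (torus (scale_root (section z)) *m coframe (section z)).
  by apply: SL2M (coframe_SL2 _); apply/torus_SL2/scale_root_neq0.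
Qed.

End Trivialisation.

(** * Isomorphisms between models *)

Section Isomorphisms.
Variables (F : fieldType) (V1 V2 V3 : lmodType F).
Variables (br1 : lieBracket V1) (br2 : lieBracket V2) (br3 : lieBracket V3).
Variables (L1 : set V1) (L2 : set V2) (L3 : set V3).

Lemma lie_isomorphic_trans : lie_isomorphic br1 br2 L1 L2 -> lie_isomorphic br2 br3 L2 L3 ->
  lie_isomorphic br1 br3 L1 L3.
Proof.
move=> [f [[f12 fi fs] fl fb]] [h [[h23 hi hs] hl hb]]; exists (h \o f); split.
- split=> [x /f12/h23//|x y Lx Ly /= e|z /hs[y /fs[x Lx <-] <-]]; last by exists x.
  apply: fi => //; apply: hi => //; apply/mem_set/f12; exact/set_mem.
- by move=> a x y Lx Ly /=; rewrite fl // hl //; apply: f12.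
- by move=> x y Lx Ly /=; rewrite fb // hb //; apply: f12.
Qed.

(** The inverse map is compatible with the operations because these do not leave [L1]. *)
Lemma lie_isomorphic_sym : is_lie_subalgebra br1 L1 ->
  lie_isomorphic br1 br2 L1 L2 -> lie_isomorphic br2 br1 L2 L1.
Proof.
move=> [_ L1l L1b] [f [[f12 fi fs] fl fb]].
have inv y : exists x, L2 y -> L1 x /\ f x = y.
  have [/fs[x Lx <-]|nL] := pselect (L2 y); first by exists x.
  by exists 0.
pose h y := projT1 (cid (inv y)).
have hP y : L2 y -> L1 (h y) /\ f (h y) = y by apply: projT2 (cid (inv y)).
have hf x : L1 x -> h (f x) = x.
  move=> Lx; have [L e] := hP _ (f12 _ Lx).
  by apply: fi; rewrite ?inE.
exists h; split.
- split=> [y /hP[]//|y z /set_mem Ly /set_mem Lz e|x Lx].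
    by have [_ <-] := hP y Ly; have [_ <-] := hP z Lz; rewrite e.
  by exists (f x); [apply: f12|apply: hf].
- move=> a y z Ly Lz; have [Lhy ey] := hP y Ly; have [Lhz ez] := hP z Lz.
  by rewrite -{1}ey -{1}ez -fl // hf //; apply: L1l.
- move=> y z Ly Lz; have [Lhy ey] := hP y Ly; have [Lhz ez] := hP z Lz.
  by rewrite -{1}ey -{1}ez -fb // hf //; apply: L1b.
Qed.

End Isomorphisms.

Section ModelIso.
Variables (R : realType) (g : vectType R[i]) (br : lieBracket g).
Local Notation C := R[i].
Implicit Types (ms : seq (C * nat)) (K : nat) (p : C -> g) (q : C -> g).

Lemma vpoly_ext q1 q2 : (forall z, q1 z = q2 z) -> vpoly q1 -> vpoly q2.
Proof. by move=> e [s sE]; exists s => z; rewrite -e. Qed.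

Lemma vpoly_affine q (a b : C) : vpoly q -> vpoly (fun z => q (a * z + b)).
Proof.
move=> [s sE]; suff : vpoly (fun z => vsum s (a * z + b)) by apply: vpoly_ext => z.
elim: s {sE} => [|[k v] s [s' IH]]; first by exists [::] => z; rewrite /vsum !big_nil.
exists (poly_terms ((a *: 'X + b%:P) ^+ k) v ++ s') => z.
rewrite vsum_cat vsum_poly -IH /vsum big_cons /= horner_exp.
by rewrite hornerD hornerZ hornerX hornerC.
Qed.

Lemma vpoly_end (f : 'End(g)) q : vpoly q -> vpoly (fun z => f (q z)).
Proof.
move=> [s sE]; exists [seq (t.1, f t.2) | t <- s] => z.
by rewrite sE /vsum big_map end_sum; apply: eq_bigr => t _; rewrite endZ.
Qed.

Lemma vpolyZ (a : C) q : vpoly q -> vpoly (fun z => a *: q z).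
Proof.
move=> [s sE]; exists [seq (t.1, a *: t.2) | t <- s] => z.
by rewrite sE /vsum big_map scaler_sumr; apply: eq_bigr => t _; rewrite scaler_swap.
Qed.

Lemma vpoly_dense q1 q2 (e : {poly C}) : e != 0 -> vpoly q1 -> vpoly q2 ->
  (forall z, e.[z] != 0 -> q1 z = q2 z) -> forall z, q1 z = q2 z.
Proof.
move=> e0 [s1 E1] [s2 E2] h z; rewrite E1 E2; apply: coord_inj => j.
rewrite -!coord_polyE; congr (_.[z]); apply: (poly_dense e0) => y ey.
by rewrite !coord_polyE -E1 -E2 h.
Qed.

Definition move_marks (a b : C) ms := [seq (a * t.1 + b, t.2) | t <- ms].

Lemma mem_move_marks (a b : C) ms z : a != 0 ->
  (z \in unzip1 (move_marks a b ms)) = ((z - b) / a \in unzip1 ms).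
Proof.
move=> a0; have -> : unzip1 (move_marks a b ms) = [seq a * y + b | y <- unzip1 ms].
  by rewrite /unzip1 /move_marks -!map_comp.
have zE : z = a * ((z - b) / a) + b by field.
rewrite {1}zE (mem_map (f := fun y => a * y + b)) // => x y /addIr; exact: mulfI.
Qed.

(** The change of coordinate multiplies the factor [wt_factor] for [m] by a constant, a product of
powers of [a], which the polynomial for [m] absorbs. *)
Lemma model_move (H1 H2 f : 'End(g)) (a b : C) K ms p : a != 0 ->
  (forall x, f (H1 x) = H2 (f x)) -> model H1 K ms p ->
  model H2 K (move_marks a b ms) (fun z => f (p ((z - b) / a))).
Proof.
move=> a0 fH [p0 [q [qP pE]]]; split=> [z|].
  by rewrite mem_move_marks // => /p0 ->; rewrite end0.
pose k m : C := \prod_(t <- ms) a ^ ceil_div m t.2.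
have k0 m : k m != 0 by rewrite prodf_seq_neq0; apply/allP => t _; rewrite /= expfz_neq0.
exists (fun m z => (k m)^-1 *: (f (q m ((z - b) / a)) : g)); split=> [m|z].
  have [vq Hq] := qP m; split; last first.
    by move=> z; rewrite endZ -fH Hq endZ scaler_swap.
  apply/vpolyZ/vpoly_end; apply: vpoly_ext (vpoly_affine a^-1 (- b / a) vq) => z.
  by congr (q m _); field.
rewrite mem_move_marks // => zm; rewrite pE // end_sum; apply: eq_bigr => m _.
rewrite endZ scalerA; congr (_ *: _); apply: (mulIf (k0 m)).
rewrite divfK // /wt_factor /move_marks big_map mulrC -big_split /=.
apply: eq_bigr => t _; rewrite -expfzMl; congr (_ ^ _).
by field.
Qed.

Lemma model_move_iso (H1 H2 f : 'End(g)) (a b : C) K ms : a != 0 -> is_lie_aut br f ->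
  (forall x, f (H1 x) = H2 (f x)) ->
  lie_isomorphic (lie_fct C br) (lie_fct C br)
    (model H1 K ms) (model H2 K (move_marks a b ms)).
Proof.
move=> a0 [fbij fbr] fH; have finj := bij_inj fbij.
have fker : lker f == 0%VS by apply/lker0P.
exists (fun p z => f (p ((z - b) / a))); split.
- split=> [p mp|p1 p2 _ _ e|p mp].
  + exact: model_move mp.
  + apply/funext => z; have := congr1 (fun p => p (a * z + b)) e => /finj.
    by have -> : (a * z + b - b) / a = z by field.
  + have fH' x : f^-1%VF (H2 x) = H1 (f^-1%VF x).
      by apply: finj; rewrite fH !lker0_lfunVK.
    have ai : a^-1 != 0 by rewrite invr_eq0.
    have := model_move (- b / a) ai fH' mp.
    have -> : move_marks a^-1 (- b / a) (move_marks a b ms) = ms.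
      rewrite /move_marks -map_comp -[RHS]map_id; apply: eq_map => -[z k] /=.
      by congr (_, _); field.
    move=> mp'; eexists; first exact: mp'.
    apply/funext => z; rewrite lker0_lfunVK //; congr (p _).
    by field.
- by move=> c p1 p2 _ _; apply/funext => z; rewrite !fctE linearP.
- by move=> p1 p2 _ _; apply/funext => z; apply: fbr.
Qed.

Lemma wt_factor_perm ms1 ms2 m z : perm_eq ms1 ms2 -> wt_factor ms1 m z = wt_factor ms2 m z.
Proof. exact: perm_big. Qed.

Lemma model_perm (H : 'End(g)) K ms1 ms2 : perm_eq ms1 ms2 -> model H K ms1 = model H K ms2.
Proof.
move=> e; have e1 : unzip1 ms1 =i unzip1 ms2 by apply/perm_mem/perm_map.
apply/seteqP; split=> p [p0 [q [qP pE]]]; split.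
- by move=> z; rewrite -e1; apply: p0.
- exists q; split=> // z; rewrite -e1 => /pE ->; apply: eq_bigr => m _.
  by rewrite (wt_factor_perm _ _ e).
- by move=> z; rewrite e1; apply: p0.
- exists q; split=> // z; rewrite e1 => /pE ->; apply: eq_bigr => m _.
  by rewrite (wt_factor_perm _ _ e).
Qed.

Lemma wt_factor0 ms z : wt_factor ms 0 z = 1.
Proof. by rewrite /wt_factor big1 // => t _; rewrite /ceil_div oppr0 div0z oppr0. Qed.

Lemma sum_wts0 (E : int -> g) : \sum_(m <- wts 0) E m = E 0.
Proof. by rewrite /wts /= big_seq1 subrr. Qed.

Lemma model0P (H : 'End(g)) p : model H 0 [::] p <-> vpoly p /\ forall z, H (p z) = 0.
Proof.
split=> [[_ [q [qP pE]]]|[vp Hp]].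
  have pq z : p z = q 0 z by rewrite pE // sum_wts0 wt_factor0 scale1r.
  have [vq Hq] := qP 0; split; first by apply: vpoly_ext vq => z; rewrite pq.
  by move=> z; rewrite pq Hq mul0r scale0r.
split=> //; exists (fun m z => if m == 0 then p z else 0); split=> [m|z _]; last first.
  by rewrite sum_wts0 wt_factor0 scale1r /= ?eqxx.
case: eqP => [->|_]; split=> //; first by move=> z; rewrite Hp mul0r scale0r.
  by exists [::] => z; rewrite /vsum big_nil.
by move=> z; rewrite end0 scaler0.
Qed.

Lemma vpolyD q1 q2 : vpoly q1 -> vpoly q2 -> vpoly (fun z => q1 z + q2 z).
Proof. by move=> [s1 E1] [s2 E2]; exists (s1 ++ s2) => z; rewrite vsum_cat E1 E2. Qed.

Lemma vpoly_br q1 q2 : vpoly q1 -> vpoly q2 -> vpoly (fun z => br (q1 z) (q2 z)).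
Proof.
move=> [s1 E1] [s2 E2]; exists [seq ((t.1 + t'.1)%N, br t.2 t'.2) | t <- s1, t' <- s2] => z.
rewrite E1 E2 /vsum; elim: s1 {E1} => [|t s1 IH]; first by rewrite !big_nil br0l.
rewrite big_cons lie_linearl IH /= big_cat big_map; congr (_ + _) => /=.
elim: s2 {E2 IH} => [|t' s2 IH]; first by rewrite !big_nil br0r scaler0.
by rewrite !big_cons lie_linearr scalerDr IH scalerA exprD.
Qed.

(** The kernel of a derivation is a subalgebra, and brackets of polynomials are polynomials. *)
Lemma model0_subalgebra (H : 'End(g)) (t : g) : (forall x, H x = br t x) ->
  is_lie_subalgebra (lie_fct C br) (model H 0 [::]).
Proof.
move=> Ht; split.
- apply/model0P; split; last by move=> z; rewrite end0.
  by exists [::] => z; rewrite /vsum big_nil.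
- move=> a p1 p2 /model0P[v1 h1] /model0P[v2 h2]; apply/model0P; split.
    exact: vpolyD (vpolyZ a v1) v2.
  by move=> z; rewrite !fctE linearD /= endZ h1 h2 scaler0 addr0.
- move=> p1 p2 /model0P[v1 h1] /model0P[v2 h2]; apply/model0P; split.
    exact: vpoly_br.
  by move=> z; have := br_br br t (p1 z) (p2 z); rewrite -!Ht h1 h2 br0l br0r subr0.
Qed.

(** For [K = 0] only [m = 0] contributes, with the factor [1]: the members of the model are
polynomials, set to zero at the marks. *)
Lemma model_unmark (H : 'End(g)) ms :
  lie_isomorphic (lie_fct C br) (lie_fct C br) (model H 0 [::]) (model H 0 ms).
Proof.
pose e : {poly C} := \prod_(z <- unzip1 ms) ('X - z%:P).
have e0 : e != 0 by rewrite monic_neq0 // monic_prod_XsubC.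
have eP z : z \notin unzip1 ms -> e.[z] != 0 by rewrite -root_prod_XsubC.
have eP' z : e.[z] != 0 -> z \notin unzip1 ms by rewrite -root_prod_XsubC.
pose cut p : C -> g := fun z => if z \in unzip1 ms then 0 else p z.
have mod0 := model0P H.
exists cut; split.
- split=> [p /mod0[vp Hp]|p1 p2 /set_mem/mod0[v1 _] /set_mem/mod0[v2 _] E|p [p0 [q [qP pE]]]].
  + split=> [z|]; first by rewrite /cut => ->.
    exists (fun m z => if m == 0 then p z else 0); split=> [m|z zm]; last first.
      by rewrite sum_wts0 wt_factor0 scale1r /cut (negPf zm) /= ?eqxx.
    case: eqP => [->|_]; split=> //; first by move=> z; rewrite Hp mul0r scale0r.
      by exists [::] => z; rewrite /vsum big_nil.
    by move=> z; rewrite end0 scaler0.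
  + apply/funext; apply: (vpoly_dense e0 v1 v2) => z /eP' zm.
    by have := congr1 (fun p => p z) E; rewrite /cut (negPf zm).
  + have [vq Hq] := qP 0; exists (q 0).
      by apply/mod0; split=> // z; rewrite Hq mul0r scale0r.
    apply/funext => z; rewrite /cut; have [zm|zm] := boolP (z \in unzip1 ms).
      by rewrite p0.
    by rewrite pE // sum_wts0 wt_factor0 scale1r.
- move=> a p1 p2 _ _; apply/funext => z; rewrite /cut !fctE.
  by case: ifP => _; rewrite ?scaler0 ?addr0.
- move=> p1 p2 _ _; apply/funext => z; rewrite /cut /=.
  by case: ifP => _; rewrite ?lie_alt.
Qed.

End ModelIso.

(** * Matching the marked points *)

Section InjectivePolynomial.
Variable C : numClosedFieldType.
Implicit Types a b : {poly C}.

Lemma single_root b (y : C) : b != 0 -> (forall z, root b z -> z = y) ->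
  b = lead_coef b *: ('X - y%:P) ^+ (size b).-1.
Proof.
move=> b0 hb; have [s bE] := closed_field_poly_normal b.
have sy : s = nseq (size s) y.
  apply/all_pred1P/allP => z zs; apply/eqP/hb; rewrite bE rootZ ?lead_coef_eq0 //.
  by rewrite root_prod_XsubC.
have sb : (size b).-1 = size s.
  by rewrite bE size_scale ?lead_coef_eq0 // size_prod_XsubC.
rewrite sb {1}bE; congr (_ *: _); rewrite [in LHS]sy.
by rewrite big_nseq -Monoid.iteropE.
Qed.

(** The fibres of [a] over [a.[0]] and [a.[1]] are single points, so that [a] is a constant plus a
multiple of ['X ^+ k], and also a constant plus a multiple of [('X - 1) ^+ k]; comparing the
derivatives gives [k = 1]. *)
Lemma injective_poly_affine a : injective (fun z => a.[z]) ->
  exists2 c, c != 0 & exists d, forall z, a.[z] = c * z + d.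
Proof.
move=> inj; have sz (c : C) : size (a - c%:P) = size a /\ lead_coef (a - c%:P) = lead_coef a.
  have s1 : (1 < size a)%N.
    rewrite ltnNge; apply/negP => /size1_polyC aE.
    have : (0 : C) = 1 by apply: inj; rewrite /= aE !hornerC.
    by move/eqP; rewrite eq_sym oner_eq0.
  have lt : (size (- c%:P) < size a)%N.
    by rewrite size_polyN (leq_ltn_trans (size_polyC_leq1 _)).
  by rewrite size_polyDl // lead_coefDl.
pose l := lead_coef a; pose k := (size a).-1.
have aE y : a - (a.[y])%:P = l *: ('X - y%:P) ^+ k.
  have [s1 l1] := sz a.[y]; rewrite /l /k -s1 -l1; apply: single_root.
    rewrite -size_poly_eq0 s1 size_poly_eq0; apply/eqP => a0.
    have : (0 : C) = 1 by apply: inj; rewrite /= a0 !hornerC.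
    by move/eqP; rewrite eq_sym oner_eq0.
  by move=> z; rewrite /root !hornerE subr_eq0 => /eqP/inj.
have a0 : a != 0.
  apply/eqP => a0; have : (0 : C) = 1 by apply: inj; rewrite /= a0 !hornerC.
  by move/eqP; rewrite eq_sym oner_eq0.
have l0 : l != 0 by rewrite lead_coef_eq0.
have d0 : a^`() = l *: ('X ^+ k)^`().
  have := congr1 (@deriv C) (aE 0); rewrite derivB derivC subr0 derivZ => ->.
  by rewrite subr0.
have d1 : a^`() = l *: (('X - 1%:P) ^+ k)^`().
  by have := congr1 (@deriv C) (aE 1); rewrite derivB derivC subr0 derivZ.
have k1 : k = 1%N.
  case: k aE d0 d1 => [|[|k]] aE d0 d1 //.
    have : (0 : C) = 1.
      apply: inj; have := congr1 (horner^~ 1) (aE 0).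
      have := congr1 (horner^~ 0) (aE 0).
      rewrite !hornerE /= subrr => /esym/eqP; rewrite ?mulr1 => /eqP l00.
      by move: l0; rewrite l00 eqxx.
    by move/eqP; rewrite eq_sym oner_eq0.
  have := congr1 (horner^~ 1) (etrans (esym d0) d1).
  rewrite !hornerZ derivXn deriv_exp hornerMn hornerXn expr1n hornerMn hornerM.
  rewrite horner_exp hornerXsubC subrr exprS mul0r mulr0 mul0rn mulr0 => /eqP.
  by rewrite mulf_eq0 (negPf l0) pnatr_eq0.
exists l => //; exists a.[0] => z.
have := congr1 (horner^~ z) (aE 0); rewrite k1 subr0 !hornerE => /eqP.
by rewrite subr_eq => /eqP.
Qed.

End InjectivePolynomial.

Section PermLift.
Variables (I1 I2 T : eqType).

Lemma perm_map_lift (r1 : seq I1) (r2 : seq I2) (f1 : I1 -> T) (f2 : I2 -> T) :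
  perm_eq [seq f1 i | i <- r1] [seq f2 i | i <- r2] ->
  exists2 r, perm_eq r r2 & [seq f1 i | i <- r1] = [seq f2 i | i <- r].
Proof.
elim: r1 r2 => [|i r1 IH] r2 /=.
  by move=> /perm_size /=; case: r2 => // _; exists [::].
move=> e; have /mapP[j jr ij] : f1 i \in [seq f2 i | i <- r2].
  by rewrite -(perm_mem e) mem_head.
have p2 := perm_to_rem jr; have := perm_trans e (perm_map f2 p2).
rewrite /= ij perm_cons => /IH[r rr rE].
exists (j :: r); last by rewrite /= rE.
by rewrite perm_sym (perm_trans p2) // perm_cons perm_sym.
Qed.

End PermLift.

Lemma eq_map2 (I1 I2 T1 T2 : Type) (r1 : seq I1) (r2 : seq I2)
    (f1 : I1 -> T1) (f2 : I2 -> T1) (g1 : I1 -> T2) (g2 : I2 -> T2) :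
  (forall i j, f1 i = f2 j -> g1 i = g2 j) ->
  [seq f1 i | i <- r1] = [seq f2 i | i <- r2] -> [seq g1 i | i <- r1] = [seq g2 i | i <- r2].
Proof.
move=> h; elim: r1 r2 => [|i r1 IH] [|j r2] //= [/h-> /IH->].
by [].
Qed.

(** The bound [k / 2 + 1] only takes part in the minimum through its integral part: an integer is
below the bound exactly if it is at most [k./2 + 1]. *)
Lemma trunc_number (a b k : nat) :
  Num.min (a%:R : rat) (k%:R / 2%:R + 1) = Num.min b%:R (k%:R / 2%:R + 1) ->
  minn a k./2.+1 = minn b k./2.+1.
Proof.
have kE : (k%:R : rat) = (odd k)%:R + k./2%:R * 2%:R.
  by rewrite -{1}(odd_double_half k) natrD -muln2 natrM.
have bnd c : (k%:R / 2%:R + 1 <= c%:R :> rat) -> (k./2.+1 <= c)%N.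
  move=> h; have : (k./2.+1%:R <= c%:R :> rat).
    apply: le_trans h; rewrite -addn1 natrD lerD2r ler_pdivlMr ?ltr0n // kE.
    by rewrite lerDr ler0n.
  by rewrite ler_nat.
have [ha|/ltW ha] := lerP (a%:R : rat) (k%:R / 2%:R + 1);
have [hb|/ltW hb] := lerP (b%:R : rat) (k%:R / 2%:R + 1) => e.
- by move/eqP: e; rewrite eqr_nat => /eqP ->.
- have := bnd a; rewrite e lexx => /(_ isT) ka.
  by rewrite (minn_idPr ka) (minn_idPr (bnd b hb)).
- have := bnd b; rewrite -e lexx => /(_ isT) kb.
  by rewrite (minn_idPr kb) (minn_idPr (bnd a ha)).
- by rewrite (minn_idPr (bnd a ha)) (minn_idPr (bnd b hb)).
Qed.

Section AutomorphicMarks.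
Variables (R : realType) (g : vectType R[i]) (br : lieBracket g).
Local Notation C := R[i].
Local Notation pt x := (vec2 x 1).
Local Notation inf := (vec2 1 0 : 'cV[C]_2).
Variables (A : automorphic_data br) (rb : 'M[C]_2 -> 'End(g)) (H : 'End(g)).
Hypothesis fact : factorises A rb.
Hypothesis Hdiff : is_differential rb (diag1N1 R) H.
Variable D : dynkin_grading br H.
Variable r : seq {vspace 'cV[C]_2}.
Hypothesis points : is_orbifold_points A r.
Local Notation P := (al_P A).

Lemma rb_action : is_SL2_action br rb. Proof. by case: fact. Qed.

Lemma grading_top (y : g) (j : int) : y != 0 -> H y = j%:~R *: y -> (j <= (dg_top D)%:Z)%R.
Proof.
move=> y0 Hy; have [n E] := eigenvalue_top D (eigen_semisimple rb_action Hdiff) y0 Hy.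
have : ((dg_top D)%:Z)%:~R = (j + n%:Z)%:~R :> C by rewrite rmorphD.
by move/intr_inj => ->; rewrite lerDl.
Qed.

(** The position of an orbifold point is the value of the coordinate at it. Any other coordinate
[Q / P] is an invariant function, hence a polynomial in the coordinate, and it is injective since
both separate the orbits. *)
Lemma autom_lie_marks : exists z : {vspace 'cV[C]_2} -> C,
  [/\ {in r &, injective z},
      lie_isomorphic (lie_fct 'cV[C]_2 br) (lie_fct C br) (autom_lie A)
        (model H (dg_top D)./2
          [seq (z L, minn (stab_order (al_G A) L) (dg_top D)./2.+1) | L <- r]) &
      forall Q, is_quotient_coord A Q -> exists2 a, a != 0 &
        exists b, forall L, L \in r -> coord_at A Q L = a * z L + b].
Proof.
have [L0 pL0 SE] := al_orbit A; have [v0 L0E] := point_line pL0.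
have [B [detB Binf]] := basis_completion v0.
have poleB : al_S A = Defs.orbit (al_G A) <[B *m inf]>%VS by rewrite Binf -L0E.
have [y0 Uy0] := finite_ex A detB.
have KG := sliceG A detB.
pose Ks := conj_lifts (al_G A) B; pose J := qcoord Ks y0.
pose xL (L : {vspace 'cV[C]_2}) : C := (invmx B *m vpick L) 0 0 / (invmx B *m vpick L) 1 0.
have [orb ur sep cov] := points.
have [_ zP _] := al_pole A.
have xP L : is_point L -> ~ al_S A L ->
    [/\ finite_pt Ks (xL L), L = <[B *m pt (xL L)]>%VS &
      exists2 c, c != 0 & vpick L = c *: (B *m pt (xL L))].
  move=> pL nS; have [vL LE] := point_line pL.
  have Pv : ev P (vpick L) != 0.
    by apply/eqP => /(zP _ vL); rewrite -LE.
  have [w1 Uw vE] := ev_finite detB poleB Pv.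
  split=> //; last by exists ((invmx B *m vpick L) 1 0).
  by rewrite {1}LE {1}vE lineZ.
have rP L : L \in r -> [/\ finite_pt Ks (xL L), L = <[B *m pt (xL L)]>%VS &
      exists2 c, c != 0 & vpick L = c *: (B *m pt (xL L))].
  by move=> /orb[pL _ nS]; apply: xP.
have orbJ x y : finite_pt Ks x -> finite_pt Ks y ->
    Defs.orbit (al_G A) <[B *m pt x]>%VS <[B *m pt y]>%VS <-> J y = J x.
  move=> Ux Uy; rewrite (orbit_lineP A detB (pt_neq0 _) (pt_neq0 _)).
  rewrite /J; split=> [/eqP|/eqP]; first by rewrite -(qcoord_eq KG Uy0 Uy Ux) => /eqP.
  by rewrite (qcoord_eq KG Uy0 Uy Ux) => /eqP.
pose z L := J (xL L).
have z_inj : {in r &, injective z}.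
  move=> L L' rL rL' e; have [UL LE _] := rP L rL; have [UL' LE' _] := rP L' rL'.
  by apply: (sep _ _ rL rL'); rewrite LE LE'; apply/(orbJ _ _ UL UL')/esym.
pose ms := [seq (z L, stab_order (al_G A) L) | L <- r].
have ms1 : unzip1 ms = [seq z L | L <- r] by rewrite /unzip1 -map_comp.
have ms_uniq : uniq (unzip1 ms) by rewrite ms1 map_inj_in_uniq.
have ms_orbit t : t \in ms -> exists2 y, finite_pt Ks y & J y = t.1 /\ stab_count Ks y = t.2.
  move=> /mapP[L rL ->] /=; have [UL LE _] := rP L rL; exists (xL L) => //; split=> //.
  by rewrite [in RHS]LE (stab_slice A detB).
have ms_all y : finite_pt Ks y -> (1 < stab_count Ks y)%N -> J y \in unzip1 ms.
  move=> Uy sy; pose L := <[B *m pt y]>%VS.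
  have Bv : B *m pt y != 0 by apply: (mulB_neq0 detB); apply: pt_neq0.
  have pL : is_point L by rewrite /is_point dim_vline Bv.
  have nS : ~ al_S A L.
    by move=> /(zP _ Bv)/eqP; apply/negP; rewrite -(finite_ev detB poleB).
  have [|L' rL' oL] := cov L; first by split=> //; rewrite (stab_slice A detB).
  rewrite ms1; apply/mapP; exists L' => //; have [UL' LE' _] := rP L' rL'.
  by apply/orbJ => //; rewrite -LE'.
exists z; split=> //.
  have := autom_lie_model detB poleB fact Hdiff grading_top Uy0 ms_uniq ms_orbit ms_all.
  by rewrite /trunc_marks -map_comp.
move=> Q [hQ cQ]; have hP := homogP A.
pose phi x := ev Q (B *m pt x) / ev P (B *m pt x).
have rphi : regular Ks phi.
  apply: regular_ext (regular_slice detB poleB Q 1) => x _.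
  by rewrite expr1.
have evP x : finite_pt Ks x -> ev P (B *m pt x) != 0 by rewrite (finite_ev detB poleB).
have [|a aE] := invariant_poly KG Uy0 rphi (oner_neq0 _).
  move=> h x Kh Ux _; have [_ Uh] := finite_mob KG (mem_signed Kh) Ux.
  apply/(cQ _ _ (evP _ Uh) (evP _ Ux))/orbJ => //.
  by rewrite /J (qcoord_mob KG) // mem_signed.
have inj : injective (fun c => a.[c]).
  move=> c d; have [x Ux <-] := qcoord_surj KG Uy0 c; have [y Uy <-] := qcoord_surj KG Uy0 d.
  rewrite /= -(aE _ Ux) -(aE _ Uy) => /(cQ _ _ (evP _ Ux) (evP _ Uy)) o.
  by apply/esym/(orbJ _ _ Ux Uy).
have [c c0 [d ad]] := injective_poly_affine inj.
exists c => //; exists d => L rL; have [UL _ [e e0 vE]] := rP L rL.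
rewrite -ad -aE // /coord_at vE (ev_scale _ _ hQ) (ev_scale _ _ hP).
by rewrite -mulf_div divff ?mul1r // expf_neq0.
Qed.

End AutomorphicMarks.

Section SameGrading.
Variables (R : realType) (g : vectType R[i]) (br : lieBracket g).
Local Notation C := R[i].
Variables (H1 H2 f : 'End(g)) (D1 : dynkin_grading br H1) (D2 : dynkin_grading br H2).
Hypothesis f_aut : is_lie_aut br f.
Hypothesis f_t0 : f (vsval (dg_t0 D1)) = vsval (dg_t0 D2).

Lemma grading_intertwine x : f (H1 x) = H2 (f x).
Proof. by have [_ fbr] := f_aut; rewrite (dg_ad D1) fbr f_t0 (dg_ad D2). Qed.

(** The highest root is a root, so that its value is an eigenvalue of [H]; an intertwiner makes it
an eigenvalue of [H'], bounded by the highest root there. *)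
Lemma top_le_of (H H' : 'End(g)) (D : dynkin_grading br H) (D' : dynkin_grading br H') (h : 'End(g)) :
  (forall (x : g) (l : C) n, iter n (fun z => H' z - l *: z) x = 0 -> H' x = l *: x) ->
  injective h -> (forall x, h (H x) = H' (h x)) -> (dg_top D <= dg_top D')%N.
Proof.
move=> ss hinj hH; have [x x0 Hx] := top_eigen D.
have hx0 : h x != 0 by apply: contraNneq x0 => e; apply/eqP/hinj; rewrite e end0.
have Hhx : H' (h x) = (dg_top D)%:R *: (h x : g) by rewrite -hH Hx endZ.
have [n /eqP] := eigenvalue_top D' ss hx0 Hhx.
by rewrite -natrD eqr_nat => /eqP ->; rewrite leq_addr.
Qed.

End SameGrading.

(** The affine group acts sharply doubly transitively on the line. *)
Lemma affine_match (C : fieldType) (I1 I2 : eqType) (r1 : seq I1) (r2 : seq I2)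
    (z1 : I1 -> C) (z2 : I2 -> C) :
  uniq r1 -> uniq r2 -> {in r1 &, injective z1} -> {in r2 &, injective z2} ->
  size r1 = size r2 -> (size r1 <= 2)%N ->
  exists2 a, a != 0 & exists b, [seq a * z1 i + b | i <- r1] = [seq z2 i | i <- r2].
Proof.
move=> u1 u2 inj1 inj2; case: r1 u1 inj1 => [|i [|j [|]]] //; case: r2 u2 inj2 => [|k [|l [|]]] //.
- by exists 1; rewrite ?oner_neq0 //; exists 0.
- by exists 1; rewrite ?oner_neq0 //; exists (z2 k - z1 i) => /=; rewrite mul1r addrC subrK.
rewrite /= !inE !andbT => kl inj2 ij inj1 _ _.
have z1ij : z1 i - z1 j != 0.
  rewrite subr_eq0; apply: contraNneq ij => e; apply/eqP/inj1 => //; by rewrite !inE eqxx ?orbT.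
have z2kl : z2 k - z2 l != 0.
  rewrite subr_eq0; apply: contraNneq kl => e; apply/eqP/inj2 => //; by rewrite !inE eqxx ?orbT.
exists ((z2 k - z2 l) / (z1 i - z1 j)); first by rewrite mulf_neq0 ?invr_neq0.
exists (z2 k - (z2 k - z2 l) / (z1 i - z1 j) * z1 i) => /=.
by congr [:: _; _]; field.
Qed.

Theorem corollary3p7 (R : realType) (g : vectType R[i]) (br : lieBracket g)
    (g_simple : is_simple_lie br)
    (A1 A2 : automorphic_data br)
    (rb1 rb2 : 'M[R[i]]_2 -> 'End(g))
    (fact1 : factorises A1 rb1) (fact2 : factorises A2 rb2)
    (H1 H2 : 'End(g))
    (diff1 : is_differential rb1 (diag1N1 R) H1)
    (diff2 : is_differential rb2 (diag1N1 R) H2)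
    (D1 : dynkin_grading br H1) (D2 : dynkin_grading br H2)
    (gradings : same_grading D1 D2)
    (r1 r2 : seq {vspace 'cV[R[i]]_2})
    (points1 : is_orbifold_points A1 r1) (points2 : is_orbifold_points A2 r2)
    (numbers : perm_eq [seq orbifold_number A1 (dg_top D1) L | L <- r1]
                       [seq orbifold_number A2 (dg_top D2) L | L <- r2])
    (positions : (0 < dg_top D1)%N -> (2 < size r1)%N ->
       same_marked_quotient A1 A2 (dg_top D1) (dg_top D2) r1 r2) :
  lie_isomorphic (lie_fct 'cV[R[i]]_2 br) (lie_fct 'cV[R[i]]_2 br)
    (autom_lie A1) (autom_lie A2).
Proof.
have [f f_aut f_t0] := gradings; have [fbij _] := f_aut.
have fH := grading_intertwine f_aut f_t0.
have fker : lker f == 0%VS by apply/lker0P/bij_inj.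
have topE : dg_top D1 = dg_top D2.
  apply/eqP; rewrite eqn_leq; apply/andP; split.
    exact: top_le_of (eigen_semisimple (rb_action fact2) diff2) (bij_inj fbij) fH.
  apply: (top_le_of D2 D1 (h := (f^-1)%VF) (eigen_semisimple (rb_action fact1) diff1)).
    exact: can_inj (lker0_lfunVK fker).
  by move=> x; apply: (bij_inj fbij); rewrite fH !lker0_lfunVK.
have [z1 [inj1 iso1 coord1]] := autom_lie_marks fact1 diff1 D1 points1.
have [z2 [inj2 iso2 coord2]] := autom_lie_marks fact2 diff2 D2 points2.
have [_ u1 _ _] := points1; have [_ u2 _ _] := points2.
apply: lie_isomorphic_trans iso1 _.
apply: lie_isomorphic_trans (lie_isomorphic_sym (autom_lie_subalgebra A2) iso2).
rewrite -topE in numbers positions *; set K := (dg_top D1)./2.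
set ms1 := [seq _ | L <- r1]; set ms2 := [seq _ | L <- r2].
have [top0|top_gt0] := posnP (dg_top D1).
  have K0 : K = 0%N by rewrite /K top0.
  rewrite K0; apply: lie_isomorphic_trans (model_unmark br H2 ms2).
  have sub := model0_subalgebra (dg_ad D1).
  apply: lie_isomorphic_trans (lie_isomorphic_sym sub (model_unmark br H1 ms1)) _.
  exact: (model_move_iso (a := 1) 0 0 [::] (oner_neq0 _) f_aut fH).
suff [a a0 [b perm]] : exists2 a, a != 0 & exists b, perm_eq (move_marks a b ms1) ms2.
  by rewrite -(model_perm H2 K perm); apply: model_move_iso f_aut fH.
have matched (r : seq {vspace 'cV[R[i]]_2}) (a b : R[i]) : perm_eq r r2 ->
    [seq orbifold_number A1 (dg_top D1) L | L <- r1] =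
      [seq orbifold_number A2 (dg_top D1) L | L <- r] ->
    [seq a * z1 L + b | L <- r1] = [seq z2 L | L <- r] ->
    perm_eq (move_marks a b ms1) ms2.
  move=> rr2 nE zE.
  suff -> : move_marks a b ms1 =
      [seq (z2 L, minn (stab_order (al_G A2) L) K.+1) | L <- r] by apply: perm_map.
  rewrite /move_marks -map_comp.
  apply: (eq_map2 (f1 := fun L => (a * z1 L + b, orbifold_number A1 (dg_top D1) L))
    (f2 := fun L => (z2 L, orbifold_number A2 (dg_top D1) L))) => [L L' [-> e]|].
    by congr (_, _); apply: trunc_number e.
  elim: (r1) r nE zE {rr2} => [|L s IH] [|L' s'] //= [-> nE] [-> zE].
  by rewrite (IH s').
have [small|large] := leqP (size r1) 2.
  have [r rr2 nE] := perm_map_lift numbers.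
  have [a a0 [b zE]] : exists2 a, a != 0 &
      exists b, [seq a * z1 L + b | L <- r1] = [seq z2 L | L <- r].
    apply: affine_match => //; first by rewrite (perm_uniq rr2).
      by move=> L L'; rewrite !(perm_mem rr2); apply: inj2.
    by rewrite -(size_map (orbifold_number A1 (dg_top D1))) nE size_map.
  by exists a => //; exists b; apply: matched zE.
have [Q1 [Q2 [q1 q2 same]]] := positions top_gt0 large.
have [r rr2 E] := perm_map_lift same.
have [a1 a10 [b1 e1]] := coord1 _ q1; have [a2 a20 [b2 e2]] := coord2 _ q2.
exists (a1 / a2); first by rewrite mulf_neq0 ?invr_neq0.
exists ((b1 - b2) / a2); apply: (matched r) => //.
  by apply: eq_map2 E => L L' [].
have {}e2 : {in r, forall L, coord_at A2 Q2 L = a2 * z2 L + b2}.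
  by move=> L; rewrite (perm_mem rr2); apply: e2.
elim: (r1) (r) e1 e2 E => [|L s IH] [|L' s'] //= e1 e2 [E _ Es].
congr (_ :: _).
  rewrite e1 ?mem_head // e2 ?mem_head // in E.
  apply: (mulfI a20); apply: (addIr b2); rewrite -E.
  by field.
by apply: IH Es => M Ms; [apply: e1|apply: e2]; rewrite in_cons Ms orbT.
Qed.
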